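(* Let $X(K,U)$ be an Oeljeklaus-Toma manifold, where $K$ is a number field with exactly $s\ge 1$ real embeddings $\sigma_1,\dots,\sigma_s$ and $2t\ge2$ non-real embeddings $\sigma_{s+1},\dots,\sigma_{s+2t}$ with $\sigma_{s+i}=\overline{\sigma_{s+t+i}}$ for $1\le i\le t$. Let $E$ be the flat complex line bundle over $X(K,U)$ corresponding to $\rho\in\mathrm{Hom}(U,\mathbb{C}^{*})$, regarded as a holomorphic line bundle. Then $H^{p,q}(X(K,U),E)\neq 0$ if and only if for some multi-indices $I\subset[s]$ and $M,L\subset[t]$ with $|I|+|M|=p$ and $|L|\le q$ we have $$\rho(u)=\prod_{i\in I}\sigma_i(u)\prod_{k\in M}\sigma_{s+k}(u)\prod_{l\in L}\sigma_{s+t+l}(u)\qquad\text{for any }u\in U.$$ If, for such multi-indices $I,M,L$, $$\rho(u)=\prod_{i\in I}\sigma_i(u)\prod_{k\in M}\sigma_{s+k}(u)\prod_{l\in L}\sigma_{s+t+l}(u)\qquad\text{for any }u\in U,$$ then $$\dim H^{p,q}(X(K,U),E)\ge\binom{s}{q-|L|}.$$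
   Context: Notation: $[n]=\{1,\dots,n\}$; a multi-index is a subset of $[n]$ with the natural order; $\binom{n}{k}$ is the number of $k$-combinations of an $n$-element set. OT-manifolds. Let $s,t$ be positive integers and $K$ an extension field of $\mathbb{Q}$ of degree $s+2t$ with embeddings $\sigma_1,\dots,\sigma_{s+2t}$ into $\mathbb{C}$ as in the claim. Let $\mathcal{O}_K$ be the ring of integers, $\mathcal{O}_K^{*}$ its unit group and $\mathcal{O}_K^{*,+}=\{a\in\mathcal{O}_K^{*}:\sigma_i(a)>0 \text{ for } 1\le i\le s\}$. Let $U\subset\mathcal{O}_K^{*,+}$ be a free abelian subgroup of rank $s$ such that $\{(\log\sigma_1(u),\dots,\log\sigma_s(u)):u\in U\}$ is a lattice in $\mathbb{R}^{s}$. With $H=\{z\in\mathbb{C}:\mathrm{Im}\,z>0\}$, the group $U\ltimes\mathcal{O}_K$ acts on $H^{s}\times\mathbb{C}^{t}$ by $(a,b)\cdot(w_1,\dots,w_s,z_1,\dots,z_t)=(\sigma_1(a)w_1+\sigma_1(b),\dots,\sigma_s(a)w_s+\sigma_s(b),\sigma_{s+1}(a)z_1+\sigma_{s+1}(b),\dots,\sigma_{s+t}(a)z_t+\sigma_{s+t}(b))$. The quotient $X(K,U)=(U\ltimes\mathcal{O}_K)\backslash(H^{s}\times\mathbb{C}^{t})$ is a compact complex manifold of dimension $s+t$, called an Oeljeklaus-Toma (OT) manifold; its fundamental group is $U\ltimes\mathcal{O}_K$. Flat line bundles. A homomorphism $\rho\in\mathrm{Hom}(U,\mathbb{C}^{*})$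 is regarded as a character of $U\ltimes\mathcal{O}_K$ via the projection to $U$, and the corresponding flat line bundle is $E=(U\ltimes\mathcal{O}_K)\backslash\big((H^{s}\times\mathbb{C}^{t})\times\mathbb{C}\big)$ for the action $\gamma\cdot(x,c)=(\gamma x,\rho(\gamma)c)$. $H^{p,q}(X(K,U),E)=H^{q}(X(K,U),\Omega^{p}(E))$ denotes Dolbeault cohomology with values in $E$, for integers $p,q$.
   Formalization: In the equivalence, the condition |L| ≤ q is replaced by |L| ≤ q ≤ |L|+s; as printed it fails, e.g. for trivial ρ, p=0, I=M=L=∅ and q>s+t, where H^{0,q}=0. The dimension bound is unchanged. *)

(* Defs.v *)
Set Warnings "-notation-overridden,-ambiguous-paths,-notation-incompatible-prefix".
From mathcomp Require Export all_boot all_order all_algebra all_field.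
From mathcomp Require Export all_classical all_reals all_analysis.
From mathcomp Require Export complex.

Set Implicit Arguments.
Unset Strict Implicit.
Unset Printing Implicit Defensive.

Export Order.TTheory GRing.Theory Num.Theory numFieldNormedType.Exports.
Global Open Scope classical_set_scope.
Global Open Scope ring_scope.
Global Open Scope complex_scope.

(** The field of complex numbers is [R[i]] with [R : realType].  Embeddings are
    indexed by ['I_(s + t + t)]: the three blocks are [sigma_1..sigma_s],
    [sigma_(s+1)..sigma_(s+t)] and [sigma_(s+t+1)..sigma_(s+2t)]. *)

Section Embeddings.
Variables (R : realType) (s t : nat) (K : fieldExtType rat).
Variable sigma : 'I_(s + t + t) -> {rmorphism K -> R[i]}.

Definition sig_real (i : 'I_s) : {rmorphism K -> R[i]} :=
  sigma (lshift t (lshift t i)).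
Definition sig_cplx (k : 'I_t) : {rmorphism K -> R[i]} :=
  sigma (lshift t (rshift s k)).
Definition sig_conj (l : 'I_t) : {rmorphism K -> R[i]} :=
  sigma (rshift (s + t) l).
(** The embedding that acts on the [j]-th coordinate of [H^s * C^t]. *)
Definition sig_coord (j : 'I_(s + t)) : {rmorphism K -> R[i]} :=
  sigma (lshift t j).

(** By the degree condition, [sigma] lists every embedding exactly once. *)
Record OT_embeddings : Prop := {
  OT_degree : \dim {:K} = (s + t + t)%N;
  OT_distinct : forall i j, sigma i =1 sigma j -> i = j;
  OT_real : forall i x, complex.Im (sig_real i x) = 0;
  OT_nonreal : forall k, exists x, complex.Im (sig_cplx k x) != 0;
  OT_conjugate : forall k x, sig_cplx k x = (sig_conj k x)^*
}.

Definition algebraic_integers : set K := [set x | integralOver (intr : int -> K) x].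

Definition integer_units : set K :=
  [set x | [/\ x != 0, algebraic_integers x & algebraic_integers x^-1]].

Definition positive_units : set K :=
  [set x | integer_units x /\ forall i, 0 < sig_real i x].

Definition is_lattice (n : nat) (A : set 'rV[R]_n) : Prop :=
  exists2 B : 'M[R]_n, B \in unitmx &
    A = [set map_mx intr m *m B | m in [set: 'rV[int]_n]].

Definition log_vector (u : K) : 'rV[R]_s :=
  \row_i ln (complex.Re (sig_real i u)).

Record OT_group (U : set K) : Prop := {
  OT_sub : U `<=` positive_units;
  OT_one : U 1;
  OT_mul : forall u v, U u -> U v -> U (u * v);
  OT_inv : forall u, U u -> U u^-1;
  OT_free : exists2 g : 'I_s -> K, (forall i, U (g i)) &
    forall u, U u -> exists! m : 'rV[int]_s, u = \prod_i g i ^ m 0 i;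
  OT_lattice : is_lattice [set log_vector u | u in U]
}.

(** Only the restriction of [rho] to [U] matters. *)
Record U_character (U : set K) (rho : K -> R[i]) : Prop := {
  chi_neq0 : forall u, U u -> rho u != 0;
  chi_mul : forall u v, U u -> U v -> rho (u * v) = rho u * rho v
}.

End Embeddings.

Section ComplexSpace.
Variables (R : realType) (n : nat).

(** [C^n] through its real coordinates [(x, y)], [zeta = x + i y], so that it
    carries the library's structure of normed module over [R]. *)
Definition cspace : Type := ('rV[R]_n * 'rV[R]_n)%type.

Definition zeta (z : cspace) (j : 'I_n) : R[i] := z.1 0 j +i* z.2 0 j.

Definition of_zeta (w : 'I_n -> R[i]) : cspace :=
  (\row_j complex.Re (w j), \row_j complex.Im (w j)).

Definition dir_x (j : 'I_n) : cspace := (delta_mx 0 j, 0).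
Definition dir_y (j : 'I_n) : cspace := (0, delta_mx 0 j).

Fixpoint Ck_on (k : nat) (D : set cspace) (f : 'rV[R]_n * 'rV[R]_n -> R) : Prop :=
  (forall z, D z -> {for z, continuous f}) /\
  if k is k'.+1 then
    forall v, (forall z, D z -> derivable f z v) /\ Ck_on k' D ('D_v f)
  else True.

(** Meaningful for open [D] only. *)
Definition smooth_on (D : set cspace) (f : cspace -> R[i]) : Prop :=
  forall k, Ck_on k D (fun z => complex.Re (f z)) /\
            Ck_on k D (fun z => complex.Im (f z)).

Definition cderive (v : cspace) (f : cspace -> R[i]) (z : cspace) : R[i] :=
  'D_v (fun w : 'rV[R]_n * 'rV[R]_n => complex.Re (f w)) z +i*
  'D_v (fun w : 'rV[R]_n * 'rV[R]_n => complex.Im (f w)) z.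

Definition d_zetabar (j : 'I_n) (f : cspace -> R[i]) (z : cspace) : R[i] :=
  2^-1 * (cderive (dir_x j) f z + 'i * cderive (dir_y j) f z).

(** [w : cform] stands for the sum over [A], [B] of
    [w A B * dzeta_A /\ dzetabar_B], where [dzeta_A] is the wedge product of
    the [dzeta_j], [j \in A], in increasing order, and likewise [dzetabar_B]. *)
Definition cform : Type := {set 'I_n} -> {set 'I_n} -> cspace -> R[i].

(** In [dzetabar_j /\ dzeta_A /\ dzetabar_(B :\ j)] the factor [dzetabar_j]
    moves past [A] and past the elements of [B] smaller than [j]. *)
Definition dbar (w : cform) : cform := fun A B z =>
  \sum_(j in B) (-1) ^+ (#|A| + #|[set b in B | (b < j)%N]|) *
                d_zetabar j (w A (B :\ j)) z.

Definition form_eq (D : set cspace) (w w' : cform) : Prop :=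
  forall A B z, D z -> w A B z = w' A B z.

Definition form_lincomb (N : nat) (c : 'I_N -> R[i]) (w : 'I_N -> cform) : cform :=
  fun A B z => \sum_k c k * w k A B z.

End ComplexSpace.

Section Dolbeault.
Variables (R : realType) (s t : nat) (K : fieldExtType rat).
Variable sigma : 'I_(s + t + t) -> {rmorphism K -> R[i]}.
Variables (U : set K) (rho : K -> R[i]).

(** [H^s * C^t]. *)
Definition OT_cover : set (cspace R (s + t)) :=
  [set z | forall i : 'I_s, 0 < complex.Im (zeta z (lshift t i))].

Definition OT_act (a b : K) (z : cspace R (s + t)) : cspace R (s + t) :=
  of_zeta (fun j => sig_coord sigma j a * zeta z j + sig_coord sigma j b).

(** [U |>< O_K] acts freely and properly discontinuously, and sections of [E]
    are the functions [f] on the cover with [f (gamma z) = rho gamma * f z].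
    Hence [E]-valued forms on [X(K,U)] are the forms [w] on the cover with
    [gamma^* w = rho gamma * w]; the pull-back multiplies [dzeta_j] by
    [sigma_j a] and [dzetabar_j] by its conjugate. *)
Definition equivariant (w : cform R (s + t)) : Prop :=
  forall a b, U a -> @algebraic_integers K b ->
  forall (A B : {set 'I_(s + t)}) z, OT_cover z ->
    w A B (OT_act a b z) *
      (\prod_(j in A) sig_coord sigma j a) *
      (\prod_(j in B) (sig_coord sigma j a)^*) = rho a * w A B z.

(** [A^{p,q}(X(K,U), E)]; two representatives that agree on the cover
    are the same form. *)
Definition E_form (p q : nat) (w : cform R (s + t)) : Prop :=
  [/\ forall A B : {set 'I_(s + t)}, smooth_on OT_cover (w A B),
      equivariant w
    & forall (A B : {set 'I_(s + t)}) z, OT_cover z ->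
        ~~ ((#|A| == p) && (#|B| == q)) -> w A B z = 0].

Definition E_closed (p q : nat) (w : cform R (s + t)) : Prop :=
  E_form p q w /\ form_eq OT_cover (dbar w) (fun _ _ _ => 0).

Definition E_exact (p q : nat) (w : cform R (s + t)) : Prop :=
  if q is q'.+1 then
    exists2 v, E_form p q' v & form_eq OT_cover w (dbar v)
  else form_eq OT_cover w (fun _ _ _ => 0).

(** [H^{p,q}(X(K,U), E)] is the quotient of [E_closed p q] by [E_exact p q]. *)
Definition Hpq_neq0 (p q : nat) : Prop :=
  exists w, E_closed p q w /\ ~ E_exact p q w.

(** [N] classes of [H^{p,q}] are linearly independent over [C]. *)
Definition Hpq_dim_ge (p q N : nat) : Prop :=
  exists2 w : 'I_N -> cform R (s + t), (forall k, E_closed p q (w k)) &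
    forall c : 'I_N -> R[i],
      E_exact p q (form_lincomb c w) -> forall k, c k = 0.

(** A triple [(I, M, L)] with [rho_formula I M L] and [#|I| + #|M| = p]
    contributes ['C(s, q - #|L|)] classes to [H^{p,q}]: products of [dw_I],
    [dz_M], [dzbar_L] and [q - #|L|] of the [s] invariant forms
    [dwbar_i / Im w_i].  So it makes [H^{p,q}] nonzero exactly when
    [#|L| <= q <= #|L| + s].  The upper bound cannot be dropped: for trivial
    [rho], the triple [(set0, set0, set0)] has [p = 0] and [#|L| <= q] for all
    [q], while [H^{0,q} = 0] for [q > s + t] (and already for [s = 1], [t = 2],
    [q = 2]). *)
Definition rho_formula (I : {set 'I_s}) (M L : {set 'I_t}) : Prop :=
  forall u, U u ->
    rho u = (\prod_(i in I) sig_real sigma i u) *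
            (\prod_(k in M) sig_cplx sigma k u) *
            (\prod_(l in L) sig_conj sigma l u).

End Dolbeault.

(* Main.v *)
(** Fix the multi-index of the [dzeta]'s.  The coefficients of an [E]-valued form
    are functions on the cover that are periodic under [O_K], hence have Fourier
    series along the fibres of [z |-> (Im w_1, ..., Im w_s)].  For a complex
    coordinate [k], [d_zetabar k] multiplies the mode [m] by a multiple of
    [sigma_(s+t+k) mu], where [mu] is the element of the dual lattice given by [m].
    The product of all [sigma_j mu] is a norm, so it is bounded away from [0], and
    the inverse of one factor is bounded by the product of the others: dividing the
    nonconstant modes by it costs finitely many derivatives and preserves
    smoothness.  By the Koszul homotopy formula, every closed form is therefore
    cohomologous to a form whose coefficients depend only on the [y_i = Im w_i].

    After multiplication of the coefficient of [dzetabar_B] by the [y_i], [i] real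
    in [B], the operator [dbar] acts on such forms through [y_i d/dy_i], and [u] in
    [U] acts through translation by [log u].  Integrating along this translation
    gives a homotopy for multiplication by [chi u - 1], where [chi] is the quotient
    of [rho] by the product of embeddings attached to the bidegree.  If [chi] is
    nontrivial for all bidegrees, every closed form is exact.  If it is trivial for
    [(I, M, L)], the forms [dw_I dz_M dzbar_L] times [q - #|L|] of the invariant
    forms [dwbar_i / Im w_i] are closed; averaging over the lattice [log U] kills the
    derivatives in a potential primitive, so their classes are independent. *)

(* Only one symbol is ever inverted, that of [d_zetabar] for a single complex coordinate [k];
   [t > 0] provides it. The inverse is built from an integral basis that the units do not preserve,
   whereas a primitive has to be equivariant under [U]. The operators are therefore normalised by
   properties that do not mention the basis: [prim f] is the unique solution of
   [d_zetabar g = f - red f] with [red g = 0], and uniqueness yields its transformation law.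

   On forms constant along the fibres, division by [chi u - 1] needs a unit common to all
   coefficients coupled by [dbar]. Multiplication by the [y_i] removes the real embeddings of the
   [dzetabar] part from the character, so [chi] sees only the complex part of [B]; and coefficients
   constant along the fibres have [d_zetabar] derivatives in real coordinates only. One unit for
   each complex part is thus a consistent choice.

   Smoothness is given by iterated directional derivatives, so the analysis rests on the mean value
   theorem along segments and on bounds with a continuous factor, which stand for locally uniform
   ones. *)
Require Import Defs.
From mathcomp Require Import ring lra.
Set Implicit Arguments.
Unset Strict Implicit.
Unset Printing Implicit Defensive.

(** * Integration over the unit interval *)

Section Int01.
Variable R : realType.
Implicit Types (f g F : R -> R).

Definition int01 f : R := \int[@lebesgue_measure R]_(x in `[0, 1]) f x.

Lemma int01_integrable f : continuous f ->
  (@lebesgue_measure R).-integrable `[0, 1] (EFin \o f).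
Proof.
move=> cf; apply: continuous_compact_integrable; first exact: segment_compact.
exact: continuous_subspaceT.
Qed.

Lemma int01D f g : continuous f -> continuous g ->
  int01 (fun x => f x + g x) = int01 f + int01 g.
Proof. by move=> cf cg; apply: RintegralD => //; exact: int01_integrable. Qed.

Lemma int01B f g : continuous f -> continuous g ->
  int01 (fun x => f x - g x) = int01 f - int01 g.
Proof. by move=> cf cg; apply: RintegralB => //; exact: int01_integrable. Qed.

Lemma int01Z c f : continuous f -> int01 (fun x => c * f x) = c * int01 f.
Proof. by move=> cf; apply: RintegralZl => //; exact: int01_integrable. Qed.

Lemma int01_cst c : int01 (fun=> c) = c.
Proof.
rewrite /int01 Rintegral_cst// (_ : fine _ = 1) ?mulr1// .
have := @lebesgue_measure_itv R `[0, 1]; rewrite /= lte_fin ltr01 oppr0 adde0 => e.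
by rewrite -[RHS]/(fine 1%:E) -e.
Qed.

Lemma eq_int01 f g : (forall x, f x = g x) -> int01 f = int01 g.
Proof. by move=> fg; apply: eq_Rintegral => x _; exact: fg. Qed.

Lemma int01_sum I (s : seq I) (F : I -> R -> R) : (forall i, continuous (F i)) ->
  int01 (fun x => \sum_(i <- s) F i x) = \sum_(i <- s) int01 (F i).
Proof.
move=> cF; elim: s => [|i s IHs].
  by rewrite big_nil -[RHS](int01_cst 0); apply: eq_int01 => x; rewrite big_nil.
rewrite big_cons -IHs -int01D //; last first.
  move=> x; rewrite /continuous_at; elim: s {IHs} => [|j s IHs].
    by under eq_fun do rewrite big_nil; rewrite big_nil; exact: cvg_cst.
  by under eq_fun do rewrite big_cons; rewrite big_cons; apply: cvgD => //; exact: cF.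
by apply: eq_int01 => x; rewrite big_cons.
Qed.

Lemma le_int01 f g : continuous f -> continuous g ->
  (forall x : R, 0 <= x <= 1 -> f x <= g x) -> int01 f <= int01 g.
Proof.
move=> cf cg fg; apply: le_Rintegral => //; first exact: int01_integrable.
  exact: int01_integrable.
Qed.

Lemma ler_norm_int01 f g : continuous f -> continuous g ->
  (forall x : R, 0 <= x <= 1 -> `|f x| <= g x) -> `|int01 f| <= int01 g.
Proof.
move=> cf cg fg.
apply: (@le_trans _ _ (int01 (fun x => `|f x|))).
  by apply: le_normr_Rintegral => //; exact: int01_integrable.
by apply: le_int01 => // x; apply: continuous_comp; [exact: cf|exact: norm_continuous].
Qed.

Lemma int01_FTC F f : (forall x : R, is_derive x 1 F (f x)) -> continuous f ->
  int01 f = F 1 - F 0.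
Proof.
move=> dF cf; rewrite /int01 /Rintegral.
rewrite (@continuous_FTC2 _ f F) ?ltr01 //.
- exact: continuous_subspaceT.
- have cF x : {for x, continuous F}.
    by apply/differentiable_continuous/derivable1_diffP; case: (dF x).
  split.
  + by move=> x _; case: (dF x).
  + by apply: cvg_at_right_filter; exact: (cF 0).
  + by apply: cvg_at_left_filter; exact: (cF 1).
- by move=> x _; rewrite derive1E; apply: derive_val.
Qed.

End Int01.

(** * Directional derivatives, the chain rule and integrals with a parameter *)

Lemma is_derive_quotP (R : realType) (V : normedModType R) (f : V -> R) z v d :
  is_derive z v f d <->
  h^-1 * (f (h *: v + z) - f z) @[h --> 0^'] --> d.
Proof.
split=> [[df <-]|fd]; first exact: df.
by apply: DeriveDef; [apply/cvg_ex; exists d|exact: (cvg_lim _ fd)].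
Qed.

Lemma cvg_sumr (K : numFieldType) (W : normedModType K) T (F : set_system T)
  {FF : Filter F} I (s : seq I) (f : I -> T -> W) (l : I -> W) :
  (forall i, f i x @[x --> F] --> l i) ->
  \sum_(i <- s) f i x @[x --> F] --> \sum_(i <- s) l i.
Proof.
move=> fl; elim: s => [|i s IHs].
  by under eq_fun do rewrite big_nil; rewrite big_nil; exact: cvg_cst.
by under eq_fun do rewrite big_cons; rewrite big_cons; exact: cvgD.
Qed.

Section DirectionalDerivatives.
Variables (R : realType) (V : normedModType R).
Implicit Types (f g : V -> R) (z v w : V).

Lemma is_derive_line f z v (x d : R) : is_derive (z + x *: v) v f d ->
  is_derive x 1 (fun h : R => f (z + h *: v)) d.
Proof.
move=> /is_derive_quotP fd; apply/is_derive_quotP; apply: cvg_trans fd.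
apply: near_eq_cvg; near=> h; congr (_ * (f _ - _)).
by rewrite scalerDl -scalerA scale1r addrCA.
Unshelve. all: by end_near. Qed.

Lemma is_derive_line0 f z v d :
  is_derive (0 : R) 1 (fun h : R => f (z + h *: v)) d -> is_derive z v f d.
Proof.
move=> /is_derive_quotP fd; apply/is_derive_quotP; apply: cvg_trans fd.
apply: near_eq_cvg; near=> h; congr (_ * (f _ - f _)).
  by rewrite addr0 [h *: 1]mulr1 addrC.
by rewrite scale0r addr0.
Unshelve. all: by end_near. Qed.

(** Parametrising the segment by [x * c] with [x] in [0, 1] covers both signs of [c] and asks for
    derivability on the segment only. *)
Lemma MVT_dir f z v (c : R) :
  (forall x : R, 0 <= x <= 1 -> derivable f (z + (x * c) *: v) v) ->
  exists2 x : R, 0 <= x <= 1 &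
    f (z + c *: v) - f z = c * 'D_v f (z + (x * c) *: v).
Proof.
move=> df; pose g (x : R) := f (z + (x * c) *: v).
have dg (x : R) : 0 <= x <= 1 ->
    is_derive x 1 g ('D_v f (z + (x * c) *: v) * c).
  move=> x01; apply: (@is_derive1_comp _ (fun h : R => f (z + h *: v)) ( *%R^~ c)).
    by apply: is_derive_line; apply: derivableP; exact: df.
  have -> : *%R^~ c = c *: (id : R -> R) by apply/funext => y /=; rewrite mulrC.
  by apply: is_derive_eq; rewrite [c *: _]mulr1.
have [x x01] : exists2 x : R, x \in `[0, 1] &
    g 1 - g 0 = 'D_v f (z + (x * c) *: v) * c * (1 - 0).
  apply: MVT_segment => //.
    by move=> x; rewrite in_itv/= => /andP[x0 x1]; apply: dg; rewrite !ltW.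
  apply: derivable_within_continuous => x; rewrite in_itv/= => /dg dx.
  exact: ex_derive.
rewrite /g mul1r mul0r scale0r addr0 subr0 mulr1 => e.
by exists x; [rewrite in_itv in x01|rewrite e mulrC].
Qed.

(** The increment along [d] is [c h] times a value of ['D_d f] near [q 0] by the mean value theorem,
    and continuity of this one partial derivative identifies the limit. The curve [q] itself
    contributes [a]. *)
Lemma is_derive_step f (D : set V) (q : R -> V) (c : R -> R) d a c' :
  open D -> D (q 0) -> (forall z, D z -> derivable f z d) ->
  {for q 0, continuous ('D_d f)} ->
  {for (0 : R), continuous q} -> c 0 = 0 -> is_derive (0 : R) 1 c c' ->
  is_derive (0 : R) 1 (f \o q) a ->
  is_derive (0 : R) 1 (fun h => f (q h + c h *: d)) (a + c' * 'D_d f (q 0)).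
Proof.
move=> oD Dq df cD cq c0 dc dfq.
have cc : c h @[h --> (0 : R)] --> (0 : R).
  rewrite -[X in _ --> X]c0.
  by apply/differentiable_continuous/derivable1_diffP; exact: ex_derive.
have -> : (fun h => f (q h + c h *: d)) =
    (f \o q) + (fun h => f (q h + c h *: d) - f (q h)).
  by apply/funext => h /=; rewrite [RHS]addrC subrK.
apply: is_deriveD; apply/is_derive_quotP.
pose r h := f (q h + c h *: d) - f (q h).
(* The value chosen where [c h = 0] makes [r h = c h * m h] hold for every [h], so that the quotient
   [r h / h] splits as [(c h / h) * m h] even if [c] vanishes near 0. *)
pose m h := if c h == 0 then 'D_d f (q 0) else r h / c h.
have rE h : r h = c h * m h.
  rewrite /m; case: eqVneq => [c0'|cn0]; last by rewrite mulrC divfK.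
  by rewrite /r c0' scale0r addr0 subrr mul0r.
have mcv : m h @[h --> (0 : R)] --> 'D_d f (q 0).
  apply/cvgrPdist_lt => e e0.
  have /nbhs_ballP[r0 /= r00 br] : nbhs (q 0) [set y | D y /\ `|'D_d f (q 0) - 'D_d f y| < e].
    apply: filterI; first exact: open_nbhs_nbhs.
    by have /cvgrPdist_lt := cD; apply.
  have r20 : 0 < r0 / 2 by rewrite divr_gt0.
  have cqn : \forall h \near (0 : R), `|q 0 - q h| < r0 / 2.
    by have /cvgrPdist_lt := cq; apply.
  have ccn : \forall h \near (0 : R), `|0 - c h *: d| < r0 / 2.
    have : c h *: d @[h --> (0 : R)] --> (0 : R) *: d by apply: cvgZr_tmp.
    by rewrite scale0r => /cvgrPdist_lt; apply.
  near=> h.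
  have qh (x : R) : 0 <= x <= 1 -> D (q h + (x * c h) *: d) /\
      `|'D_d f (q 0) - 'D_d f (q h + (x * c h) *: d)| < e.
    move=> /andP[x0 x1]; apply: br; rewrite -ball_normE /= opprD addrA.
    apply: le_lt_trans (ler_normB _ _) _; rewrite [r0]splitr; apply: ltr_leD.
      by near: h.
    rewrite -scalerA normrZ ger0_norm// -[leRHS]mul1r ler_pM// ltW//.
    by rewrite -normrN -sub0r; near: h.
  rewrite /m; case: eqVneq => [|cn0]; first by rewrite subrr normr0.
  have [x x01 e1] := @MVT_dir f (q h) d (c h) (fun x hx => df _ (qh x hx).1).
  by rewrite /r e1 mulrC mulKf//; exact: (qh x x01).2.
have -> : (fun h : R => h^-1 * (r (h *: 1 + 0) - r 0)) =
    (fun h => (h^-1 * c h) * m h).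
  apply/funext => h; rewrite addr0 [h *: 1]mulr1 !rE c0 mul0r subr0.
  by rewrite mulrA.
apply: cvgM.
  move/is_derive_quotP : dc; apply: cvg_trans; apply: near_eq_cvg; near=> h.
  by rewrite addr0 [h *: 1]mulr1 c0 subr0.
exact: cvg_within_filter mcv.
Unshelve. all: by end_near. Qed.

(** [Ck_on] gives a derivative in each fixed direction but no differential. The chain rule is
    recovered from continuous partial derivatives by adding the directions one at a time. *)
Lemma is_derive_path f (D : set V) p m (d : 'I_m -> V) (c : 'I_m -> R -> R) c' :
  open D -> D p -> (forall i z, D z -> derivable f z (d i)) ->
  (forall i, {for p, continuous ('D_(d i) f)}) ->
  (forall i, c i 0 = 0) -> (forall i, is_derive (0 : R) 1 (c i) (c' i)) ->
  is_derive (0 : R) 1 (fun h => f (p + \sum_i c i h *: d i))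
    (\sum_i c' i * 'D_(d i) f p).
Proof.
move=> oD Dp; elim: m d c c' => [|m IHm] d c c' df cD c0 dc.
  under eq_fun do rewrite big_ord0 addr0; rewrite big_ord0.
  exact: is_derive_cst.
under eq_fun do rewrite big_ord_recr /= addrA; rewrite big_ord_recr /=.
pose q h := p + \sum_(i < m) c (widen_ord (leqnSn m) i) h *: d (widen_ord (leqnSn m) i).
have q0 : q 0 = p.
  by rewrite /q big1 ?addr0// => i _; rewrite c0 scale0r.
rewrite -[in X in _ + _ * X]q0.
apply: (@is_derive_step f D q (c ord_max)) => //; rewrite ?q0 //.
- exact: df.
- apply: cvgD; first exact: cvg_cst.
  apply: cvg_sumr => i; apply: cvgZr_tmp.
  apply/differentiable_continuous/derivable1_diffP.
  exact: (@ex_derive _ _ _ _ _ _ _ (dc _)).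
- have := IHm (fun i => d (widen_ord (leqnSn m) i))
    (fun i => c (widen_ord (leqnSn m) i)) (fun i => c' (widen_ord (leqnSn m) i)).
  by move=> H; apply: H => [i z|i|i]; [exact: df|exact: cD|exact: c0].
Qed.

Lemma section_continuous (g : R -> V -> R) z :
  (forall x, {for (x, z), continuous (fun p : R * V => g p.1 p.2)}) ->
  continuous (g ^~ z).
Proof.
move=> cg x; apply: (cvg_comp (fun x : R => (x, z)) _ _ (cg x)).
exact: (@cvg_pair _ _ _ (nbhs x) (nbhs x) (nbhs z) _ _ _ id (fun=> z) cvg_id (cvg_cst z)).
Qed.

(** Compactness of [0, 1], in its near-covering form, makes the neighbourhood of [z] independent of
    [x]. *)
Lemma int01_uniform (g : R -> V -> R) z e : 0 < e ->
  (forall x, {for (x, z), continuous (fun p : R * V => g p.1 p.2)}) ->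
  \forall z' \near z, forall x : R, 0 <= x <= 1 -> `|g x z - g x z'| < e.
Proof.
move=> e0 cg.
have covK : near_covering `[(0 : R), 1]%classic.
  by apply/compact_near_coveringP; exact: segment_compact.
have : \forall z' \near z, `[(0 : R), 1] `<=` (fun x => `|g x z - g x z'| < e).
  apply: covK => x _.
  have e20 : 0 < e / 2 by rewrite divr_gt0.
  have /cvgrPdist_lt /(_ _ e20) [[A B] /= [xA zB] AB] := cg x.
  have /cvgrPdist_lt /(_ _ e20) c2 := @section_continuous g z cg x.
  near=> x' z'.
  rewrite (_ : g x' z - g x' z' = (g x z - g x' z') - (g x z - g x' z)); last first.
    by rewrite opprB [in RHS]addrC addrA subrK.
  rewrite (splitr e); apply: le_lt_trans (ler_normB _ _) _; apply: ltrD.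
    by apply: (AB (x', z')); split => /=; [near: x'|near: z'].
  by near: x'.
apply: filterS => z' Hz' x x01; apply: Hz'; by rewrite /= in_itv/=.
Unshelve. all: by end_near. Qed.

Lemma int01_continuous (g : R -> V -> R) (D : set V) : open D ->
  (forall x z, D z -> {for (x, z), continuous (fun p : R * V => g p.1 p.2)}) ->
  forall z, D z -> {for z, continuous (fun z => int01 (g ^~ z))}.
Proof.
move=> oD cg z Dz; apply/cvgrPdist_lt => e e0.
have e20 : 0 < e / 2 by rewrite divr_gt0.
have unif := @int01_uniform g z _ e20 (fun x => cg x z Dz).
near=> z'.
have Dz' : D z' by near: z'; exact: open_nbhs_nbhs.
have sc y : D y -> continuous (g ^~ y).
  by move=> Dy; apply: section_continuous => x; exact: cg.
rewrite -int01B; [|exact: sc..].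
apply: (@le_lt_trans _ _ (e / 2)); last by rewrite ltr_pdivrMr// ltr_pMr// ltr1n.
rewrite -[leRHS]int01_cst; apply: ler_norm_int01.
- by move=> x; apply: cvgB; exact: sc.
- by move=> x; exact: cvg_cst.
- suff : forall x : R, 0 <= x <= 1 -> `|g x z - g x z'| < e / 2.
    by move=> H x x01; rewrite ltW// H.
  by near: z'; exact: unif.
Unshelve. all: by end_near. Qed.

(** For each [x] the difference quotient is ['D_v (g x)] at a point of the segment; [int01_uniform]
    applied to the derivative brings it close to ['D_v (g x) z] for all [x] at once. *)
Lemma int01_derive (g : R -> V -> R) (D : set V) z v :
  open D -> D z ->
  (forall x z, D z -> {for (x, z), continuous (fun p : R * V => g p.1 p.2)}) ->
  (forall x z, D z -> derivable (g x) z v) ->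
  (forall x z, D z -> {for (x, z), continuous (fun p : R * V => 'D_v (g p.1) p.2)}) ->
  is_derive z v (fun z => int01 (g ^~ z)) (int01 (fun x => 'D_v (g x) z)).
Proof.
move=> oD Dz cg dg cDg.
have sc y : D y -> continuous (g ^~ y).
  by move=> Dy; apply: section_continuous => x; exact: cg.
have sd y : D y -> continuous (fun x => 'D_v (g x) y).
  move=> Dy; apply: (@section_continuous (fun x => 'D_v (g x))) => x; exact: cDg.
apply/is_derive_quotP/cvgrPdist_lt => e e0.
have e20 : 0 < e / 2 by rewrite divr_gt0.
have : \forall y \near z, D y /\
    forall x : R, 0 <= x <= 1 -> `|'D_v (g x) z - 'D_v (g x) y| < e / 2.
  apply: filterI; first exact: open_nbhs_nbhs.
  by apply: (@int01_uniform (fun x => 'D_v (g x))) => // x; exact: cDg.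
move=> /nbhs_ballP[r /= r0 br].
have hv0 : \forall h \near (0 : R)^', `|0 - h *: v| < r.
  have : h *: v @[h --> (0 : R)^'] --> (0 : R) *: v.
    by apply: cvgZr_tmp; apply: cvg_within.
  by rewrite scale0r => /cvgrPdist_lt; apply.
near=> h.
have h0 : h != 0 by near: h; exact: nbhs_dnbhs_neq.
have bv (x : R) : 0 <= x <= 1 -> D (z + (x * h) *: v) /\
    forall x' : R, 0 <= x' <= 1 ->
      `|'D_v (g x') z - 'D_v (g x') (z + (x * h) *: v)| < e / 2.
  move=> /andP[x0 x1]; apply: br; rewrite -ball_normE /= opprD addrA subrr.
  rewrite -scalerA sub0r normrN normrZ ger0_norm//.
  apply: (@le_lt_trans _ _ `|h *: v|).
    by rewrite -[leRHS]mul1r ler_pM.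
  by rewrite -normrN -sub0r; near: h.
have Dzh : D (h *: v + z).
  by have := (bv 1 _).1; rewrite mul1r addrC; apply; rewrite ler01 lexx.
have cq : continuous (fun x => h^-1 * (g x (h *: v + z) - g x z)).
  by move=> x; apply: cvgM; [exact: cvg_cst|apply: cvgB; exact: sc].
rewrite -int01B; [|exact: sc..].
rewrite -int01Z; last by move=> x; apply: cvgB; exact: sc.
rewrite -int01B//; last exact: sd.
apply: (@le_lt_trans _ _ (e / 2)); last by rewrite ltr_pdivrMr// ltr_pMr// ltr1n.
rewrite -[leRHS]int01_cst; apply: ler_norm_int01.
- by move=> x; apply: cvgB; [exact: sd|exact: cq].
- by move=> x; exact: cvg_cst.
- move=> x x01.
  have [y y01 ey] := @MVT_dir (g x) z v h (fun y y01 => dg x _ (bv y y01).1).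
  by rewrite [h *: v + z]addrC ey mulKf// ltW// (bv y y01).2.
Unshelve. all: by end_near. Qed.

End DirectionalDerivatives.

Lemma is_derive_mull (R : realType) (a x : R) : is_derive x 1 ( *%R a) a.
Proof. by apply: is_derive_eq (is_deriveZ a (is_derive_id x 1)) _; rewrite [a *: _]mulr1. Qed.

Lemma continuous_at_ext (T U : topologicalType) (f g : T -> U) z : (\forall z' \near z, f z' = g z') ->
  {for z, continuous f} -> {for z, continuous g}.
Proof.
move=> fg cf; suff : g @ z --> g z by [].
rewrite -(nbhs_singleton fg); apply: cvg_trans cf.
by apply: near_eq_cvg; apply: filterS fg => y ->.
Qed.

Section SmoothFunctions.
Variables (R : realType) (n : nat).
Local Notation V := ('rV[R]_n * 'rV[R]_n)%type.
Variable D : set V.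
Hypothesis oD : open D.
Implicit Types (f g : V -> R) (k : nat).

Lemma near_open f g z : (forall z, D z -> f z = g z) -> D z ->
  \forall z' \near z, f z' = g z'.
Proof. by move=> fg Dz; near=> z'; apply: fg; near: z'; exact: open_nbhs_nbhs.
Unshelve. all: by end_near. Qed.

Lemma Ck_on_cont k f z : Ck_on k D f -> D z -> {for z, continuous f}.
Proof. by case: k => [|k] [cf _] Dz; exact: cf. Qed.

Lemma Ck_on_derivable k f v z : Ck_on k.+1 D f -> D z -> derivable f z v.
Proof. by case=> _ /(_ v)[df _] Dz; exact: df. Qed.

Lemma Ck_on_ext k f g : (forall z, D z -> f z = g z) -> Ck_on k D f -> Ck_on k D g.
Proof.
elim: k f g => [|k IHk] f g fg [cf dfk].
  split=> // z Dz; have fgz := near_open fg Dz.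
  exact: continuous_at_ext fgz (cf _ Dz).
split=> [z Dz|v].
  have fgz := near_open fg Dz.
  exact: continuous_at_ext fgz (cf _ Dz).
have [df dk] := dfk v; split=> [z Dz|].
  by apply: near_eq_derivable (df _ Dz); exact: near_open.
by apply: IHk dk => z Dz; apply: near_eq_derive; exact: near_open.
Qed.

Lemma Ck_onS k f : Ck_on k.+1 D f -> Ck_on k D f.
Proof.
elim: k f => [|k IHk] f [cf dfk]; first by split.
by split=> // v; have [df dk] := dfk v; split=> //; exact: IHk.
Qed.

Lemma Ck_on_cst k (a : R) : Ck_on k D (fun=> a).
Proof.
elim: k a => [|k IHk] a; split=> //; try by move=> z _; exact: cvg_cst.
move=> v; split=> [z _|]; first exact: derivable_cst.
apply: (@Ck_on_ext _ (fun=> 0)) => [z _|]; first by rewrite (derive_cst a).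
exact: IHk.
Qed.

Lemma Ck_onD k f g : Ck_on k D f -> Ck_on k D g -> Ck_on k D (fun z => f z + g z).
Proof.
elim: k f g => [|k IHk] f g [cf dfk] [cg dgk];
  (split=> [z Dz|]; first by apply: cvgD; [exact: cf|exact: cg]) => // v.
have [df fk] := dfk v; have [dg gk] := dgk v; split=> [z Dz|].
  by apply: derivableD; [exact: df|exact: dg].
apply: Ck_on_ext (IHk _ _ fk gk) => z Dz.
by rewrite (deriveD (df _ Dz) (dg _ Dz)).
Qed.

Lemma Ck_on_le k k' f : (k <= k')%N -> Ck_on k' D f -> Ck_on k D f.
Proof.
by elim: k' => [|k' IHk]; [rewrite leqn0 => /eqP ->|rewrite leq_eqVlt => /predU1P[->//|/IHk H /Ck_onS]].
Qed.

Lemma Ck_on_sum I (s : seq I) (F : I -> V -> R) k : (forall i, Ck_on k D (F i)) ->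
  Ck_on k D (fun z => \sum_(i <- s) F i z).
Proof.
move=> Fk; elim: s => [|i s IHs].
  by apply: Ck_on_ext (Ck_on_cst k 0) => z _; rewrite big_nil.
by apply: Ck_on_ext (Ck_onD (Fk i) IHs) => z _; rewrite big_cons.
Qed.

Lemma Ck_onM k f g : Ck_on k D f -> Ck_on k D g -> Ck_on k D (fun z => f z * g z).
Proof.
elim: k f g => [|k IHk] f g fk gk.
  by case: fk gk => [cf _] [cg _]; split=> // z Dz; apply: cvgM; [exact: cf|exact: cg].
have [[cf dfk] [cg dgk]] := (fk, gk).
split=> [z Dz|v]; first by apply: cvgM; [exact: cf|exact: cg].
have [df f'k] := dfk v; have [dg g'k] := dgk v; split=> [z Dz|].
  by apply: derivableM; [exact: df|exact: dg].
apply: Ck_on_ext (Ck_onD (IHk _ _ (Ck_onS fk) g'k) (IHk _ _ (Ck_onS gk) f'k)) => z Dz.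
by rewrite (deriveM (df _ Dz) (dg _ Dz)).
Qed.

Lemma Ck_onV k f : (forall z, D z -> f z != 0) -> Ck_on k D f ->
  Ck_on k D (fun z => (f z)^-1).
Proof.
move=> f0; elim: k => [|k IHk] fk.
  by case: fk => cf _; split=> // z Dz; apply: cvgV; [exact: f0|exact: cf].
have [cf dfk] := fk.
split=> [z Dz|v]; first by apply: cvgV; [exact: f0|exact: cf].
have [df f'k] := dfk v; split=> [z Dz|].
  by apply: derivableV; [exact: f0|exact: df].
have Vk := IHk (Ck_onS fk).
apply: Ck_on_ext (Ck_onM (Ck_on_cst _ (-1)) (Ck_onM (Ck_onM Vk Vk) f'k)) => z Dz.
by rewrite (deriveV (f0 _ Dz) (df _ Dz)) mulN1r expr2 invfM -mulNr.
Qed.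

Lemma Ck_on_linear k f : (forall h v z, f (h *: v + z) = h * f v + f z) ->
  continuous f -> Ck_on k D f.
Proof.
move=> lf cf; case: k => [|k]; (split=> [z _|]; first exact: cf) => // v.
have dl z : is_derive z v f (f v).
  apply/is_derive_quotP; apply: (@cvg_trans _ (f v @[h --> (0 : R)^'])); last exact: cvg_cst.
  apply: near_eq_cvg; near=> h; have h0 : h != 0 by near: h; exact: nbhs_dnbhs_neq.
  by rewrite lf addrK mulKf.
split=> [z _|]; first exact: (@ex_derive _ _ _ _ _ _ _ (dl z)).
apply: Ck_on_ext (Ck_on_cst k (f v)) => z _.
by rewrite (@derive_val _ _ _ _ _ _ _ (dl z)).
Unshelve. all: by end_near. Qed.

Lemma Ck_on_y k j : Ck_on k D (fun z => z.2 0 j).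
Proof.
apply: Ck_on_linear => [h v z|z]; first by rewrite !mxE.
exact: (cvg_comp snd (fun x : 'rV[R]_n => x 0 j) cvg_snd (@coord_continuous _ _ _ 0 j z.2)).
Qed.

Definition dir_xy (i : 'I_(n + n)) : V :=
  match fintype.split i with inl j => dir_x R j | inr j => dir_y R j end.

Definition coord_xy (v : V) (i : 'I_(n + n)) : R :=
  match fintype.split i with inl j => v.1 0 j | inr j => v.2 0 j end.

Lemma sum_xy (W : zmodType) (F : 'I_n + 'I_n -> W) :
  \sum_(i < n + n) F (fintype.split i) = \sum_j F (inl j) + \sum_j F (inr j).
Proof.
rewrite big_split_ord /=; congr (_ + _); apply: eq_bigr => i _.
  by rewrite (unsplitK (inl _)).
by rewrite (unsplitK (inr _)).
Qed.

Lemma dir_xy_sum (v : V) : v = \sum_i coord_xy v i *: dir_xy i.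
Proof.
have pl (F : 'I_n -> 'rV[R]_n) : \sum_j ((F j, 0) : V) = (\sum_j F j, 0).
  by elim/big_rec2: _ => // j y1 y2 _ ->; congr pair; rewrite /= addr0.
have pr (F : 'I_n -> 'rV[R]_n) : \sum_j ((0, F j) : V) = (0, \sum_j F j).
  by elim/big_rec2: _ => // j y1 y2 _ ->; congr pair; rewrite /= addr0.
pose F i : V := match i with inl j => v.1 0 j *: dir_x R j
  | inr j => v.2 0 j *: dir_y R j end.
rewrite (eq_bigr (fun i => F (fintype.split i))); last first.
  by move=> i _; rewrite /coord_xy /dir_xy /F; case: fintype.split.
rewrite (sum_xy F) /F.
have -> : \sum_j v.1 0 j *: dir_x R j = (v.1, 0) :> V.
  rewrite [in RHS](row_sum_delta v.1) -pl; apply: eq_bigr => j _.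
  by congr pair; rewrite /= scaler0.
have -> : \sum_j v.2 0 j *: dir_y R j = (0, v.2) :> V.
  rewrite [in RHS](row_sum_delta v.2) -pr; apply: eq_bigr => j _.
  by congr pair; rewrite /= scaler0.
by case: v {F} => v1 v2; congr pair; rewrite /= ?addr0 ?add0r.
Qed.

Lemma is_derive_xy f p (c : 'I_(n + n) -> R -> R) c' : Ck_on 1 D f -> D p ->
  (forall i, c i 0 = 0) -> (forall i, is_derive (0 : R) 1 (c i) (c' i)) ->
  is_derive (0 : R) 1 (fun h => f (p + \sum_i c i h *: dir_xy i))
    (\sum_i c' i * 'D_(dir_xy i) f p).
Proof.
move=> [_ df] Dp c0 dc; apply: (@is_derive_path _ _ _ D) => //.
- by move=> i z Dz; apply: (df _).1.
- by move=> i; have [_ [cD _]] := df (dir_xy i); exact: cD.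
Qed.

(** Linearity of the derivative in [v], which [Ck_on] does not contain by definition: the straight
    line along [v] is split into coordinate directions and the chain rule is applied. *)
Lemma is_derive_coord f (z v : V) : Ck_on 1 D f -> D z ->
  is_derive z v f (\sum_i coord_xy v i * 'D_(dir_xy i) f z).
Proof.
move=> fk Dz; apply: is_derive_line0.
rewrite (_ : (fun h : R => f (z + h *: v)) =
   (fun h : R => f (z + \sum_i (coord_xy v i * h) *: dir_xy i))); last first.
  apply/funext => h; rewrite {1}(dir_xy_sum v) scaler_sumr.
  by congr (f (_ + _)); apply: eq_bigr => i _; rewrite scalerA mulrC.
apply: (@is_derive_xy f z (fun i h => coord_xy v i * h)) => // i.
  by rewrite mulr0.
exact: is_derive_mull.
Qed.

End SmoothFunctions.

Lemma is_derive_continuous (R : realType) (f df : R -> R) :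
  (forall x : R, is_derive x 1 f (df x)) -> continuous f.
Proof.
move=> dfx x; apply/differentiable_continuous/derivable1_diffP.
exact: (@ex_derive _ _ _ _ _ _ _ (dfx x)).
Qed.

Lemma cvg_row (R : realType) n T (F : set_system T) {FF : Filter F}
    (f : 'I_n -> T -> R) (a : 'I_n -> R) :
  (forall j, f j x @[x --> F] --> a j) ->
  (\row_j f j x) @[x --> F] --> (\row_j a j : 'rV[R]_n).
Proof.
have E (u : 'I_n -> R) : (\row_j u j : 'rV[R]_n) = \sum_j u j *: delta_mx 0 j.
  by rewrite [LHS]row_sum_delta; apply: eq_bigr => j _; rewrite mxE.
by move=> fa; under eq_fun do rewrite E; rewrite E; apply: cvg_sumr => j; exact: cvgZr_tmp.
Qed.

Section FlowAverage.
Variables (R : realType) (n : nat).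
Local Notation V := ('rV[R]_n * 'rV[R]_n)%type.
Variable D : set V.
Hypothesis oD : open D.
Implicit Types (f g : V -> R) (k : nat) (kap : R -> R).

(** [l = 0] gives a translation flow, [e = 0] a scaling flow on the imaginary
    parts. *)
Definition flow (l : 'I_n -> R) (e : V) (x : R) (z : V) : V :=
  (z.1 + x *: e.1, (\row_j (expR (x * l j) * z.2 0 j)) + x *: e.2).

Lemma flow_continuous l e : continuous (fun p : R * V => flow l e p.1 p.2).
Proof.
move=> p.
have c1 : p.1 @[p --> p] --> p.1 by exact: cvg_fst.
have c2 : p.2 @[p --> p] --> p.2 by exact: cvg_snd.
have c21 : p.2.1 @[p --> p] --> p.2.1 by apply: (cvg_comp _ _ c2); exact: cvg_fst.
have c22 : p.2.2 @[p --> p] --> p.2.2 by apply: (cvg_comp _ _ c2); exact: cvg_snd.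
apply: (@cvg_pair _ _ _ (nbhs p) (nbhs _) (nbhs _)).
  by apply: cvgD => //; apply: cvgZr_tmp.
apply: cvgD; last exact: cvgZr_tmp.
apply: cvg_row => j; apply: cvgM.
  apply: (cvg_comp _ expR); last exact: continuous_expR.
  by apply: cvgM => //; exact: cvg_cst.
exact: (cvg_comp _ (fun x : 'rV[R]_n => x 0 j) c22 (@coord_continuous _ _ _ 0 j p.2.2)).
Qed.

Variables (l : 'I_n -> R) (e : V).
Hypothesis Dflow : forall x z, D z -> D (flow l e x z).
Local Notation phi := (flow l e).

Lemma flow_comp_continuous f : (forall z, D z -> {for z, continuous f}) ->
  forall x z, D z -> {for (x, z), continuous (fun p : R * V => f (phi p.1 p.2))}.
Proof.
move=> cf x z Dz; apply: (cvg_comp _ f (@flow_continuous l e (x, z))).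
by apply: cf; exact: Dflow.
Qed.

(** The eigenvalue of the differential of the flow at time [x] on the coordinate direction [i]; the
    differential itself is [flow_tan]. *)
Definition flow_rate (i : 'I_(n + n)) (x : R) : R :=
  match fintype.split i with inl _ => 1 | inr j => expR (x * l j) end.

Lemma flow_rate_continuous i : continuous (flow_rate i).
Proof.
rewrite /flow_rate; case: fintype.split => j x; first exact: cvg_cst.
apply: (cvg_comp _ expR); last exact: continuous_expR.
by apply: cvgM; [exact: cvg_id|exact: cvg_cst].
Qed.

Definition flow_tan (x : R) (v : V) : V := (v.1, \row_j (expR (x * l j) * v.2 0 j)).

Lemma coord_flow_tan x v i : coord_xy (flow_tan x v) i = coord_xy v i * flow_rate i x.
Proof.
rewrite /coord_xy /flow_rate; case: fintype.split => j /=; first by rewrite mulr1.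
by rewrite mxE mulrC.
Qed.

Lemma is_derive_flow_comp f x z v d : is_derive (phi x z) (flow_tan x v) f d ->
  is_derive z v (f \o phi x) d.
Proof.
move=> /is_derive_quotP fd; apply/is_derive_quotP; apply: cvg_trans fd.
apply: near_eq_cvg; near=> h; congr (_ * (f _ - _)).
congr pair => /=; first by rewrite addrA.
rewrite addrA; congr (_ + _); apply/rowP => j; rewrite !mxE mulrDr; congr (_ + _).
by rewrite mulrCA.
Unshelve. all: by end_near. Qed.

(** The kernel [kap] is arbitrary to make this class of averages stable under differentiation: a
    derivative in a coordinate direction replaces [kap] by [kap * flow_rate]. *)
Definition flow_avg kap f z := int01 (fun x => kap x * f (phi x z)).

Lemma flow_avg_jcont kap f : continuous kap ->
  (forall z, D z -> {for z, continuous f}) ->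
  forall x z, D z ->
    {for (x, z), continuous (fun p : R * V => kap p.1 * f (phi p.1 p.2))}.
Proof.
move=> ck cf x z Dz; apply: cvgM; last exact: flow_comp_continuous.
by apply: (cvg_comp fst kap _ (ck x)); exact: cvg_fst.
Qed.

Lemma flow_avg_continuous kap f : continuous kap ->
  (forall z, D z -> {for z, continuous f}) ->
  forall z, D z -> {for z, continuous (flow_avg kap f)}.
Proof.
move=> ck cf; apply: (@int01_continuous _ _ (fun x z => kap x * f (phi x z))) => //.
exact: flow_avg_jcont.
Qed.

Lemma flow_avg_int_cont kap f z : continuous kap ->
  (forall z, D z -> {for z, continuous f}) -> D z ->
  continuous (fun x => kap x * f (phi x z)).
Proof.
move=> ck cf Dz; apply: (@section_continuous _ _ (fun x z => kap x * f (phi x z))) => x.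
exact: flow_avg_jcont.
Qed.

Lemma is_derive_flow_avg kap f z v : continuous kap -> Ck_on 1 D f -> D z ->
  is_derive z v (flow_avg kap f) (\sum_i coord_xy v i *
    flow_avg (fun x => kap x * flow_rate i x) ('D_(dir_xy R i) f) z).
Proof.
move=> ck fk Dz; have [cf df] := fk.
have cDf i y : D y -> {for y, continuous ('D_(dir_xy R i) f)}.
  by move=> Dy; have [_ [+ _]] := df (dir_xy R i); apply.
have dd x y : D y -> is_derive y v (fun y => kap x * f (phi x y))
    (\sum_i coord_xy v i * (kap x * flow_rate i x * 'D_(dir_xy R i) f (phi x y))).
  move=> Dy; have /is_derive_flow_comp H := is_derive_coord oD (flow_tan x v) fk (Dflow x Dy).
  apply: is_derive_eq (is_deriveZ (kap x) H) _.
  rewrite scaler_sumr; apply: eq_bigr => i _; rewrite coord_flow_tan.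
  by rewrite /GRing.scale /=; ring.
have ckr i : continuous (fun x => kap x * flow_rate i x).
  by move=> x; apply: cvgM; [exact: ck|exact: flow_rate_continuous].
have cI i : continuous (fun x =>
    kap x * flow_rate i x * 'D_(dir_xy R i) f (phi x z)).
  exact: (@flow_avg_int_cont _ ('D_(dir_xy R i) f) z (ckr i) (cDf i) Dz).
have -> : \sum_i coord_xy v i *
    flow_avg (fun x => kap x * flow_rate i x) ('D_(dir_xy R i) f) z =
    int01 (fun x => 'D_v (fun y => kap x * f (phi x y)) z).
  under [RHS]eq_int01 do rewrite (@derive_val _ _ _ _ _ _ _ (dd _ _ Dz)).
  rewrite int01_sum => [|i]; last first.
    by move=> x; apply: cvgM; [exact: cvg_cst|exact: cI].
  by apply: eq_bigr => i _; rewrite int01Z//.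
apply: (@int01_derive _ _ (fun x z => kap x * f (phi x z)) D) => //.
- exact: flow_avg_jcont.
- move=> x y Dy; exact: (@ex_derive _ _ _ _ _ _ _ (dd x y Dy)).
- move=> x y Dy.
  have : {for (x, y), continuous (fun p : R * V => \sum_i coord_xy v i *
      (kap p.1 * flow_rate i p.1 * 'D_(dir_xy R i) f (phi p.1 p.2)))}.
    apply: cvg_sumr => i; apply: cvgM; first exact: cvg_cst.
    exact: (@flow_avg_jcont _ ('D_(dir_xy R i) f) (ckr i) (cDf i) x y Dy).
  apply: continuous_at_ext.
  near=> p; rewrite (@derive_val _ _ _ _ _ _ _ (dd _ _ _))//.
  near: p; apply: (@cvg_snd _ _ (nbhs x) (nbhs y)); exact: open_nbhs_nbhs.
Unshelve. all: by end_near. Qed.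

Lemma Ck_on_flow_avg k kap f : continuous kap -> Ck_on k D f ->
  Ck_on k D (flow_avg kap f).
Proof.
elim: k kap f => [|k IHk] kap f ck fk.
  by case: fk => cf _; split=> // z Dz; exact: flow_avg_continuous.
have fk1 := @Ck_on_le _ _ _ 1 _ _ (ltn0Sn k) fk.
split=> [z Dz|v]; first by apply: flow_avg_continuous => //; case: fk.
split=> [z Dz|]; first exact: (@ex_derive _ _ _ _ _ _ _ (is_derive_flow_avg v ck fk1 Dz)).
apply: (@Ck_on_ext _ _ _ oD _ (fun z => \sum_i coord_xy v i *
    flow_avg (fun x => kap x * flow_rate i x) ('D_(dir_xy R i) f) z)).
  by move=> z Dz; rewrite (@derive_val _ _ _ _ _ _ _ (is_derive_flow_avg v ck fk1 Dz)).
apply: Ck_on_sum => // i; apply: Ck_onM => //; first exact: Ck_on_cst.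
apply: IHk; last by case: fk => _ /(_ (dir_xy R i))[].
by move=> x; apply: cvgM; [exact: ck|exact: flow_rate_continuous].
Qed.

End FlowAverage.

(** * Smooth complex functions and averages along flows *)

Section ComplexNumbers.
Variable R : realType.
Implicit Types x y : R[i].
Local Notation Re := (@complex.Re R).
Local Notation Im := (@complex.Im R).

Lemma ReD x y : Re (x + y) = Re x + Re y.
Proof. by case: x; case: y. Qed.

Lemma ImD x y : Im (x + y) = Im x + Im y.
Proof. by case: x; case: y. Qed.

Lemma ReM x y : Re (x * y) = Re x * Re y - Im x * Im y.
Proof. by case: x; case: y. Qed.

Lemma ImM x y : Im (x * y) = Re x * Im y + Im x * Re y.
Proof. by case: x; case: y. Qed.

Lemma ReN x : Re (- x) = - Re x.
Proof. by case: x. Qed.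

Lemma ImN x : Im (- x) = - Im x.
Proof. by case: x. Qed.

Lemma Re_sum I (s : seq I) (P : pred I) (F : I -> R[i]) :
  Re (\sum_(i <- s | P i) F i) = \sum_(i <- s | P i) Re (F i).
Proof. by elim/big_rec2: _ => // i a b _ <-; rewrite ReD. Qed.

Lemma Im_sum I (s : seq I) (P : pred I) (F : I -> R[i]) :
  Im (\sum_(i <- s | P i) F i) = \sum_(i <- s | P i) Im (F i).
Proof. by elim/big_rec2: _ => // i a b _ <-; rewrite ImD. Qed.

Lemma complex_eqP x y : Re x = Re y -> Im x = Im y -> x = y.
Proof. by case: x; case: y => a b c d /= -> ->. Qed.

Lemma complexrD (a b : R) : (a + b)%:C = a%:C + b%:C.
Proof. by apply: complex_eqP; rewrite ?ReD ?ImD //= addr0. Qed.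

Lemma compReD T (f g : T -> R[i]) :
  Re \o (fun x : T => f x + g x) = fun x : T => Re (f x) + Re (g x).
Proof. by apply/funext => x /=; rewrite ReD. Qed.

Lemma compImD T (f g : T -> R[i]) :
  Im \o (fun x : T => f x + g x) = fun x : T => Im (f x) + Im (g x).
Proof. by apply/funext => x /=; rewrite ImD. Qed.

Lemma compReM T (f g : T -> R[i]) :
  Re \o (fun x : T => f x * g x) = fun x : T => Re (f x) * Re (g x) - Im (f x) * Im (g x).
Proof. by apply/funext => x /=; rewrite ReM. Qed.

Lemma compImM T (f g : T -> R[i]) :
  Im \o (fun x : T => f x * g x) = fun x : T => Re (f x) * Im (g x) + Im (f x) * Re (g x).
Proof. by apply/funext => x /=; rewrite ImM. Qed.

(** The taxicab norm is submultiplicative and needs no square root. *)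
Definition norm1c x : R := `|Re x| + `|Im x|.

Lemma norm1c_ge0 x : 0 <= norm1c x.
Proof. exact: addr_ge0. Qed.

Lemma norm1cD x y : norm1c (x + y) <= norm1c x + norm1c y.
Proof.
rewrite /norm1c ReD ImD addrACA; apply: lerD; exact: ler_normD.
Qed.

Lemma norm1cM x y : norm1c (x * y) <= norm1c x * norm1c y.
Proof.
rewrite /norm1c ReM ImM mulrDl !mulrDr -!normrM.
have := ler_normB (Re x * Re y) (Im x * Im y).
have := ler_normD (Re x * Im y) (Im x * Re y).
by lra.
Qed.

Lemma norm1cR (a : R) x : 0 <= a -> norm1c (a%:C * x) = a * norm1c x.
Proof.
by move=> a0; rewrite /norm1c ReM ImM /= !mul0r subr0 addr0 !normrM ger0_norm// mulrDr.
Qed.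

Lemma norm1cN x : norm1c (- x) = norm1c x.
Proof. by rewrite /norm1c ReN ImN !normrN. Qed.

Lemma norm1c_sum I (s : seq I) (F : I -> R[i]) :
  norm1c (\sum_(i <- s) F i) <= \sum_(i <- s) norm1c (F i).
Proof.
elim: s => [|i s IHs]; first by rewrite !big_nil /norm1c normr0 addr0.
by rewrite !big_cons; apply: le_trans (norm1cD _ _) _; rewrite lerD2l.
Qed.

End ComplexNumbers.

Section ComplexIntegral.
Variable R : realType.
Implicit Types (f g : R -> R[i]) (c : R[i]).
Local Notation Re := (@complex.Re R).
Local Notation Im := (@complex.Im R).

Definition ccontinuous f := continuous (Re \o f) /\ continuous (Im \o f).

Definition cint f : R[i] := int01 (Re \o f) +i* int01 (Im \o f).

Lemma ccontinuousD f g : ccontinuous f -> ccontinuous g ->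
  ccontinuous (fun x => f x + g x).
Proof.
move=> [f1 f2] [g1 g2]; rewrite /ccontinuous compReD compImD.
by split=> x; apply: cvgD; [exact: f1|exact: g1|exact: f2|exact: g2].
Qed.

Lemma ccontinuousM f g : ccontinuous f -> ccontinuous g ->
  ccontinuous (fun x => f x * g x).
Proof.
move=> [f1 f2] [g1 g2]; rewrite /ccontinuous compReM compImM; split=> x.
  by apply: cvgB; apply: cvgM; [exact: f1|exact: g1|exact: f2|exact: g2].
by apply: cvgD; apply: cvgM; [exact: f1|exact: g2|exact: f2|exact: g1].
Qed.

Lemma ccontinuous_cst c : ccontinuous (fun=> c).
Proof. by split=> x; exact: cvg_cst. Qed.

Lemma ccontinuous_sum I (s : seq I) (F : I -> R -> R[i]) :
  (forall i, ccontinuous (F i)) -> ccontinuous (fun x => \sum_(i <- s) F i x).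
Proof.
move=> cF; elim: s => [|i s IHs].
  by rewrite [X in ccontinuous X](_ : _ = fun=> 0) => [|]; [exact: ccontinuous_cst|apply/funext => x; rewrite big_nil].
rewrite [X in ccontinuous X](_ : _ = fun x => F i x + \sum_(i <- s) F i x).
  exact: ccontinuousD.
by apply/funext => x; rewrite big_cons.
Qed.

Lemma eq_cint f g : (forall x, f x = g x) -> cint f = cint g.
Proof. by move=> /funext ->. Qed.

Lemma cintD f g : ccontinuous f -> ccontinuous g ->
  cint (fun x => f x + g x) = cint f + cint g.
Proof.
move=> [f1 f2] [g1 g2]; by rewrite /cint compReD compImD !int01D.
Qed.

Lemma cintZ c f : ccontinuous f -> cint (fun x => c * f x) = c * cint f.
Proof.
move=> [f1 f2].
have cZ (a : R) (h : R -> R) : continuous h -> continuous (fun x => a * h x).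
  by move=> ch x; apply: cvgM; [exact: cvg_cst|exact: ch].
rewrite /cint compReM compImM int01B ?int01D ?int01Z//; try exact: cZ.
by apply: complex_eqP; rewrite ?ReM ?ImM.
Qed.

Lemma cint_cst c : cint (fun=> c) = c.
Proof. by apply: complex_eqP; rewrite /= -[RHS]int01_cst; apply: eq_int01. Qed.

Lemma cint_sum I (s : seq I) (F : I -> R -> R[i]) : (forall i, ccontinuous (F i)) ->
  cint (fun x => \sum_(i <- s) F i x) = \sum_(i <- s) cint (F i).
Proof.
move=> cF; elim: s => [|i s IHs].
  by rewrite big_nil -[RHS](cint_cst 0); apply: eq_cint => x; rewrite big_nil.
rewrite big_cons -IHs -cintD //; last exact: ccontinuous_sum.
by apply: eq_cint => x; rewrite big_cons.
Qed.

Lemma norm1c_cint f (g : R -> R) : ccontinuous f -> continuous g ->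
  (forall x : R, 0 <= x <= 1 -> norm1c (f x) <= g x) -> norm1c (cint f) <= 2 * int01 g.
Proof.
move=> [f1 f2] cg fg; rewrite mulr_natl mulr2n /norm1c /=; apply: lerD;
apply: ler_norm_int01 => // x x01; apply: le_trans (fg _ x01); rewrite /norm1c /=.
  by rewrite lerDl.
by rewrite lerDr.
Qed.

Lemma cint_FTC F f : (forall x : R, is_derive x 1 (Re \o F) (Re (f x)) /\
    is_derive x 1 (Im \o F) (Im (f x))) -> ccontinuous f -> cint f = F 1 - F 0.
Proof.
move=> dF [f1 f2]; apply: complex_eqP; rewrite ?ReD ?ImD ?ReN ?ImN /=.
  by apply: (@int01_FTC _ (Re \o F)) => // x; exact: (dF x).1.
by apply: (@int01_FTC _ (Im \o F)) => // x; exact: (dF x).2.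
Qed.

End ComplexIntegral.

Section DeriveProducts.
Variables (R : realType) (V : normedModType R) (f g f' g' : V -> R) (z v : V).
Hypotheses (df : derivable f z v) (dg : derivable g z v).
Hypotheses (df' : derivable f' z v) (dg' : derivable g' z v).

Lemma derive_mulD : 'D_v (fun z => f z * g z + f' z * g' z) z =
  (f z * 'D_v g z + g z * 'D_v f z) + (f' z * 'D_v g' z + g' z * 'D_v f' z).
Proof.
transitivity ('D_v (f * g + f' * g') z); first by [].
by rewrite (deriveD (derivableM df dg) (derivableM df' dg')) (deriveM df dg) (deriveM df' dg').
Qed.

Lemma derive_mulB : 'D_v (fun z => f z * g z - f' z * g' z) z =
  (f z * 'D_v g z + g z * 'D_v f z) - (f' z * 'D_v g' z + g' z * 'D_v f' z).
Proof.
transitivity ('D_v (f * g - f' * g') z); first by [].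
by rewrite (deriveB (derivableM df dg) (derivableM df' dg')) (deriveM df dg) (deriveM df' dg').
Qed.

End DeriveProducts.

Section ComplexSmooth.
Variables (R : realType) (n : nat).
Local Notation V := ('rV[R]_n * 'rV[R]_n)%type.
Local Notation Re := (@complex.Re R).
Local Notation Im := (@complex.Im R).
Variable D : set V.
Hypothesis oD : open D.
Implicit Types (f g : V -> R[i]) (v z : V) (c : R[i]).
Local Notation smooth := (@smooth_on R n D).

Lemma smooth_on_ext f g : (forall z, D z -> f z = g z) -> smooth f -> smooth g.
Proof.
move=> fg sf k; have [f1 f2] := sf k.
by split; [apply: Ck_on_ext f1|apply: Ck_on_ext f2] => // z Dz; rewrite fg.
Qed.

Lemma smooth_on_cst c : smooth (fun=> c).
Proof. by move=> k; split; exact: Ck_on_cst. Qed.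

Lemma smooth_onD f g : smooth f -> smooth g -> smooth (fun z => f z + g z).
Proof.
move=> sf sg k; have [f1 f2] := sf k; have [g1 g2] := sg k; split.
  by apply: Ck_on_ext (Ck_onD oD f1 g1) => // z _; rewrite ReD.
by apply: Ck_on_ext (Ck_onD oD f2 g2) => // z _; rewrite ImD.
Qed.

Lemma smooth_onM f g : smooth f -> smooth g -> smooth (fun z => f z * g z).
Proof.
move=> sf sg k; have [f1 f2] := sf k; have [g1 g2] := sg k.
have N := Ck_on_cst oD k (-1).
split.
  apply: Ck_on_ext (Ck_onD oD (Ck_onM oD f1 g1) (Ck_onM oD N (Ck_onM oD f2 g2))) => // z _.
  by rewrite ReM mulN1r.
by apply: Ck_on_ext (Ck_onD oD (Ck_onM oD f1 g2) (Ck_onM oD f2 g1)) => // z _; rewrite ImM.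
Qed.

Lemma smooth_onZ c f : smooth f -> smooth (fun z => c * f z).
Proof. by move=> sf; apply: smooth_onM => //; exact: smooth_on_cst. Qed.

Lemma smooth_on_sum I (s : seq I) (P : pred I) (F : I -> V -> R[i]) :
  (forall i, P i -> smooth (F i)) -> smooth (fun z => \sum_(i <- s | P i) F i z).
Proof.
move=> sF; elim: s => [|i s IHs].
  by apply: smooth_on_ext (smooth_on_cst 0) => z _; rewrite big_nil.
case Pi : (P i).
  by apply: smooth_on_ext (smooth_onD (sF _ Pi) IHs) => z _; rewrite big_cons Pi.
by apply: smooth_on_ext IHs => z _; rewrite big_cons Pi.
Qed.

Lemma smooth_on_prod I (s : seq I) (P : pred I) (F : I -> V -> R[i]) :
  (forall i, P i -> smooth (F i)) -> smooth (fun z => \prod_(i <- s | P i) F i z).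
Proof.
move=> sF; elim: s => [|i s IHs].
  by apply: smooth_on_ext (smooth_on_cst 1) => z _; rewrite big_nil.
case Pi : (P i).
  by apply: smooth_on_ext (smooth_onM (sF _ Pi) IHs) => z _; rewrite big_cons Pi.
by apply: smooth_on_ext IHs => z _; rewrite big_cons Pi.
Qed.

Lemma smooth_cderive v f : smooth f -> smooth (cderive v f).
Proof. by move=> sf k; have [[_ f1] [_ f2]] := sf k.+1; split; [apply: (f1 v).2|apply: (f2 v).2]. Qed.

Lemma smooth_on_cont f z : smooth f -> D z ->
  {for z, continuous (Re \o f)} /\ {for z, continuous (Im \o f)}.
Proof.
by move=> sf Dz; have [f1 f2] := sf 0%N; split; [exact: Ck_on_cont f1 Dz|exact: Ck_on_cont f2 Dz].
Qed.

Lemma smooth_on_derivable f v z : smooth f -> D z ->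
  derivable (Re \o f) z v /\ derivable (Im \o f) z v.
Proof.
by move=> sf Dz; have [f1 f2] := sf 1%N; split; [exact: Ck_on_derivable f1 Dz|exact: Ck_on_derivable f2 Dz].
Qed.

Lemma cderive_ext v f g z : (forall z, D z -> f z = g z) -> D z ->
  cderive v f z = cderive v g z.
Proof.
move=> fg Dz; rewrite /cderive; congr (_ +i* _); apply: near_eq_derive;
by apply: (@near_open _ _ _ oD) => // y Dy; rewrite fg.
Qed.

Lemma cderive_cst v c z : cderive v (fun=> c) z = 0.
Proof. by rewrite /cderive (derive_cst (Re c)) (derive_cst (Im c)). Qed.

Lemma cderiveD v f g z : smooth f -> smooth g -> D z ->
  cderive v (fun z => f z + g z) z = cderive v f z + cderive v g z.
Proof.
move=> sf sg Dz; have [f1 f2] := smooth_on_derivable v sf Dz.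
have [g1 g2] := smooth_on_derivable v sg Dz.
have e1 : Re (cderive v (fun z => f z + g z) z) = Re (cderive v f z) + Re (cderive v g z).
  rewrite /cderive /=; under [X in 'D_v X z]eq_fun do rewrite ReD.
  exact: (deriveD f1 g1).
have e2 : Im (cderive v (fun z => f z + g z) z) = Im (cderive v f z) + Im (cderive v g z).
  rewrite /cderive /=; under [X in 'D_v X z]eq_fun do rewrite ImD.
  exact: (deriveD f2 g2).
by apply: complex_eqP; rewrite ?e1 ?e2 ?ReD ?ImD.
Qed.

Lemma cderiveM v f g z : smooth f -> smooth g -> D z ->
  cderive v (fun z => f z * g z) z = cderive v f z * g z + f z * cderive v g z.
Proof.
move=> sf sg Dz; have [f1 f2] := smooth_on_derivable v sf Dz.
have [g1 g2] := smooth_on_derivable v sg Dz.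
have e1 : Re (cderive v (fun z => f z * g z) z) =
    (Re (f z) * Re (cderive v g z) + Re (g z) * Re (cderive v f z)) -
    (Im (f z) * Im (cderive v g z) + Im (g z) * Im (cderive v f z)).
  rewrite /cderive /=; under [X in 'D_v X z]eq_fun do rewrite ReM.
  exact: (derive_mulB f1 g1 f2 g2).
have e2 : Im (cderive v (fun z => f z * g z) z) =
    (Re (f z) * Im (cderive v g z) + Im (g z) * Re (cderive v f z)) +
    (Im (f z) * Re (cderive v g z) + Re (g z) * Im (cderive v f z)).
  rewrite /cderive /=; under [X in 'D_v X z]eq_fun do rewrite ImM.
  exact: (derive_mulD f1 g2 f2 g1).
apply: complex_eqP; [rewrite e1|rewrite e2]; move: (cderive v f z) (cderive v g z) => a b.
  by rewrite ReD !ReM; ring.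
by rewrite ImD !ImM; ring.
Qed.

Lemma cderiveZ v c f z : smooth f -> D z ->
  cderive v (fun z => c * f z) z = c * cderive v f z.
Proof.
move=> sf Dz; rewrite (@cderiveM v (fun=> c) f z (smooth_on_cst c) sf Dz).
by rewrite (cderive_cst v c z) mul0r add0r.
Qed.

Lemma cderive_sum v I (s : seq I) (P : pred I) (F : I -> V -> R[i]) z :
  (forall i, P i -> smooth (F i)) -> D z ->
  cderive v (fun z => \sum_(i <- s | P i) F i z) z = \sum_(i <- s | P i) cderive v (F i) z.
Proof.
move=> sF Dz; elim: s => [|i s IHs].
  rewrite big_nil -[RHS](cderive_cst v 0 z).
  by apply: cderive_ext => // y _; rewrite big_nil.
rewrite big_cons; case Pi : (P i).
  rewrite -IHs -cderiveD //; [|exact: sF|exact: smooth_on_sum].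
  by apply: cderive_ext => // y _; rewrite big_cons Pi.
by rewrite -IHs; apply: cderive_ext => // y _; rewrite big_cons Pi.
Qed.

Lemma cderive_coord f v z : smooth f -> D z ->
  cderive v f z = \sum_i (coord_xy v i)%:C * cderive (dir_xy R i) f z.
Proof.
move=> sf Dz; have [f1 f2] := sf 1%N.
have d1 := @derive_val _ _ _ _ _ _ _ (is_derive_coord oD v f1 Dz).
have d2 := @derive_val _ _ _ _ _ _ _ (is_derive_coord oD v f2 Dz).
apply: complex_eqP; rewrite ?Re_sum ?Im_sum /= ?d1 ?d2;
by apply: eq_bigr => i _; rewrite ?ReM ?ImM /= ?mul0r ?subr0 ?addr0.
Qed.

Lemma cderive_linear f v w (a b : R) z : smooth f -> D z ->
  cderive (a *: v + b *: w) f z = a%:C * cderive v f z + b%:C * cderive w f z.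
Proof.
move=> sf Dz; rewrite (cderive_coord (_ + _)) // (cderive_coord v)// (cderive_coord w)//.
rewrite !mulr_sumr -big_split; apply: eq_bigr => i _ /=.
have -> : coord_xy (a *: v + b *: w) i = a * coord_xy v i + b * coord_xy w i.
  by rewrite /coord_xy; case: fintype.split => j; rewrite !mxE.
by rewrite complexrD mulrDl !mulrA; congr (_ + _); congr (_ * _);
   apply: complex_eqP; rewrite ?ReM ?ImM /= ?mulr0 ?mul0r ?subr0 ?addr0.
Qed.

End ComplexSmooth.

Section ComplexFlowAverage.
Variables (R : realType) (n : nat).
Local Notation V := ('rV[R]_n * 'rV[R]_n)%type.
Local Notation Re := (@complex.Re R).
Local Notation Im := (@complex.Im R).
Variable D : set V.
Hypothesis oD : open D.
Implicit Types (f g : V -> R[i]) (v z : V) (c : R[i]) (kap : R -> R[i]).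
Local Notation smooth := (@smooth_on R n D).
Variables (l : 'I_n -> R) (e : V).
Hypothesis Dflow : forall x z, D z -> D (flow l e x z).
Local Notation phi := (flow l e).

Definition cavg kap f z : R[i] := cint (fun x => kap x * f (phi x z)).

Lemma cavg_icont kap f z : ccontinuous kap -> smooth f -> D z ->
  ccontinuous (fun x => kap x * f (phi x z)).
Proof.
move=> ck sf Dz; apply: ccontinuousM => //; have [f1 f2] := sf 0%N.
have H (h : V -> R) : Ck_on 0 D h -> continuous (fun x => h (phi x z)).
  move=> hk; apply: (@section_continuous _ _ (fun x z => h (phi x z))) => x.
  by apply: (flow_comp_continuous Dflow) => // y Dy; exact: Ck_on_cont hk Dy.
by split; [exact: (H (fun w => Re (f w)))|exact: (H (fun w => Im (f w)))].
Qed.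

Lemma Re_cavg kap f z : ccontinuous kap -> smooth f -> D z ->
  Re (cavg kap f z) = flow_avg l e (Re \o kap) (Re \o f) z
                      - flow_avg l e (Im \o kap) (Im \o f) z.
Proof.
move=> [k1 k2] sf Dz; have [[f1 _] [f2 _]] := sf 0%N.
rewrite /cavg /cint /= compReM int01B //.
  exact: (flow_avg_int_cont Dflow (kap := Re \o kap) (f := Re \o f)).
exact: (flow_avg_int_cont Dflow (kap := Im \o kap) (f := Im \o f)).
Qed.

Lemma Im_cavg kap f z : ccontinuous kap -> smooth f -> D z ->
  Im (cavg kap f z) = flow_avg l e (Re \o kap) (Im \o f) z
                      + flow_avg l e (Im \o kap) (Re \o f) z.
Proof.
move=> [k1 k2] sf Dz; have [[f1 _] [f2 _]] := sf 0%N.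
rewrite /cavg /cint /= compImM int01D //.
  exact: (flow_avg_int_cont Dflow (kap := Re \o kap) (f := Im \o f)).
exact: (flow_avg_int_cont Dflow (kap := Im \o kap) (f := Re \o f)).
Qed.

Lemma smooth_cavg kap f : ccontinuous kap -> smooth f -> smooth (cavg kap f).
Proof.
move=> ck sf k; have [k1 k2] := ck; have [f1 f2] := sf k.
have N := Ck_on_cst oD k (-1); have A := fun kp h => @Ck_on_flow_avg _ _ _ oD l e Dflow k kp h.
split.
  apply: Ck_on_ext (Ck_onD oD (A _ _ k1 f1) (Ck_onM oD N (A _ _ k2 f2))) => // z Dz.
  by rewrite Re_cavg// mulN1r.
by apply: Ck_on_ext (Ck_onD oD (A _ _ k1 f2) (A _ _ k2 f1)) => // z Dz; rewrite Im_cavg.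
Qed.

Lemma cavg_ext kap f g z : (forall z, D z -> f z = g z) -> D z ->
  cavg kap f z = cavg kap g z.
Proof. by move=> fg Dz; apply: eq_cint => x; rewrite fg//; exact: Dflow. Qed.

Lemma cavgD kap f g z : ccontinuous kap -> smooth f -> smooth g -> D z ->
  cavg kap (fun z => f z + g z) z = cavg kap f z + cavg kap g z.
Proof.
move=> ck sf sg Dz; rewrite /cavg -cintD; [|exact: cavg_icont..].
by apply: eq_cint => x; rewrite mulrDr.
Qed.

Lemma cavgZ kap c f z : ccontinuous kap -> smooth f -> D z ->
  cavg kap (fun z => c * f z) z = c * cavg kap f z.
Proof.
move=> ck sf Dz; rewrite /cavg -cintZ; last exact: cavg_icont.
by apply: eq_cint => x; rewrite mulrCA.
Qed.

Lemma cavg_sum kap I (s : seq I) (F : I -> V -> R[i]) z : ccontinuous kap ->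
  (forall i, smooth (F i)) -> D z ->
  cavg kap (fun z => \sum_(i <- s) F i z) z = \sum_(i <- s) cavg kap (F i) z.
Proof.
move=> ck sF Dz; rewrite /cavg -cint_sum => [|i]; last exact: cavg_icont.
by apply: eq_cint => x; rewrite mulr_sumr.
Qed.

Lemma coord_dir_xy (i j : 'I_(n + n)) : coord_xy (dir_xy R i) j = (j == i)%:R.
Proof.
rewrite -{2}(splitK i) -{2}(splitK j) /coord_xy /dir_xy.
case: (fintype.split i) => a; case: (fintype.split j) => b /=;
  rewrite mxE ?eqxx /=; rewrite -(inj_eq val_inj) /=.
- by [].
- by rewrite gtn_eqF// ltn_addr.
- by rewrite ltn_eqF// ltn_addr.
- by rewrite (inj_eq (@rshift_inj _ _)).
Qed.

Lemma derive_flow_avg_xy (kap : R -> R) (f : V -> R) i z : continuous kap ->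
  Ck_on 1 D f -> D z -> is_derive z (dir_xy R i) (flow_avg l e kap f)
  (flow_avg l e (fun x => kap x * flow_rate l i x) ('D_(dir_xy R i) f) z).
Proof.
move=> ck fk Dz; apply: is_derive_eq (is_derive_flow_avg oD Dflow (dir_xy R i) ck fk Dz) _.
rewrite (bigD1 i) //= coord_dir_xy eqxx mul1r big1 ?addr0// => j ji.
by rewrite coord_dir_xy (negbTE ji) mul0r.
Qed.

Lemma cderive_cavg_xy kap f i z : ccontinuous kap -> smooth f -> D z ->
  cderive (dir_xy R i) (cavg kap f) z =
  cavg (fun x => kap x * (flow_rate l i x)%:C) (cderive (dir_xy R i) f) z.
Proof.
move=> ck sf Dz; have [k1 k2] := ck; have [f1 f2] := sf 1%N.
have cr : ccontinuous (fun x => (flow_rate l i x)%:C).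
  by split => x; [exact: (@flow_rate_continuous _ _ l i)|exact: cvg_cst].
have ckr := ccontinuousM ck cr.
have sdf := smooth_cderive (dir_xy R i) sf.
have kR : Re \o (fun x => kap x * (flow_rate l i x)%:C) =
    (fun x => (Re \o kap) x * flow_rate l i x).
  by apply/funext => x /=; rewrite ReM /= mulr0 subr0.
have kI : Im \o (fun x => kap x * (flow_rate l i x)%:C) =
    (fun x => (Im \o kap) x * flow_rate l i x).
  by apply/funext => x /=; rewrite ImM /= mulr0 add0r.
have dd := fun kp h (ckp : continuous kp) (hk : Ck_on 1 D h) =>
  @derive_flow_avg_xy kp h i z ckp hk Dz.
apply: complex_eqP.
  rewrite (Re_cavg ckr sdf Dz) kR kI.
  have := is_deriveB (dd _ _ k1 f1) (dd _ _ k2 f2).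
  move=> /near_eq_is_derive H; apply: (@derive_val _ _ _ _ _ _ _ (H _ _)).
  apply: (@near_open _ _ _ oD (_ - _) (fun w => Re (cavg kap f w))) => // y Dy.
  by rewrite Re_cavg.
rewrite (Im_cavg ckr sdf Dz) kR kI.
have := is_deriveD (dd _ _ k1 f2) (dd _ _ k2 f1).
move=> /near_eq_is_derive H; apply: (@derive_val _ _ _ _ _ _ _ (H _ _)).
apply: (@near_open _ _ _ oD (_ + _) (fun w => Im (cavg kap f w))) => // y Dy.
by rewrite Im_cavg.
Qed.

End ComplexFlowAverage.

(** * Fourier modes along one period vector *)

Section Translations.
Variables (R : realType) (n : nat).
Local Notation V := ('rV[R]_n * 'rV[R]_n)%type.
Local Notation Re := (@complex.Re R).
Local Notation Im := (@complex.Im R).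
Variable D : set V.
Hypothesis oD : open D.
Implicit Types (f g : V -> R[i]) (v z e : V) (c : R[i]) (k : int).
Local Notation smooth := (@smooth_on R n D).

Lemma flow_translation e x z : flow (fun=> 0) e x z = z + x *: e.
Proof.
case: z e => [z1 z2] [e1 e2]; congr pair => /=; congr (_ + _).
by apply/rowP => j; rewrite !mxE mulr0 expR0 mul1r.
Qed.

Definition freq k : R := k%:~R * (pi *+ 2).

(** This is [exp (- 2 pi i k x)]. *)
Definition echar k (x : R) : R[i] := cos (freq k * x) -i* sin (freq k * x).

Lemma cos_freq k : cos (freq k) = 1 /\ sin (freq k) = 0.
Proof.
have H (m : nat) : cos (freq m) = 1 /\ sin (freq m) = 0.
  rewrite /freq -pmulrn mulr_natl -[_ *+ m]add0r.
  by rewrite (periodicn (@cosD2pi R)) (periodicn (@sinD2pi R)) cos0 sin0.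
case: k => m; first exact: H.
rewrite NegzE /freq mulrNz mulNr cosN sinN; have [-> ->] := H m.+1.
by rewrite oppr0.
Qed.

Lemma echar0 k : echar k 0 = 1.
Proof. by rewrite /echar mulr0 cos0 sin0 oppr0. Qed.

Lemma echar1 k : echar k 1 = 1.
Proof. by rewrite /echar mulr1; have [-> ->] := cos_freq k; rewrite oppr0. Qed.

Lemma is_derive_Re_echar k (x : R) :
  is_derive x 1 (fun x => cos (freq k * x)) (- sin (freq k * x) * freq k).
Proof.
by apply: (@is_derive1_comp _ cos ( *%R (freq k))); exact: is_derive_mull.
Qed.

Lemma is_derive_Im_echar k (x : R) :
  is_derive x 1 (fun x => - sin (freq k * x)) (- cos (freq k * x) * freq k).
Proof.
have H : is_derive x 1 (fun x => sin (freq k * x)) (cos (freq k * x) * freq k).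
  by apply: (@is_derive1_comp _ sin ( *%R (freq k))); exact: is_derive_mull.
by apply: is_derive_eq (is_deriveN H) _; rewrite mulNr.
Qed.

Lemma echar_continuous k : ccontinuous (echar k).
Proof.
split; first exact: (is_derive_continuous (@is_derive_Re_echar k)).
exact: (is_derive_continuous (@is_derive_Im_echar k)).
Qed.

(** The coefficient is taken with base point [z], which absorbs the exponential of Fourier
    synthesis: a smooth function with period [e] is the plain sum of its modes, and each mode is
    again a function on the same domain. *)
Definition fmode e k f z : R[i] := cint (fun x => echar k x * f (z + x *: e)).

Lemma fmodeE e k f : fmode e k f = cavg (fun=> 0) e (echar k) f.
Proof. by apply/funext => z; apply: eq_cint => x; rewrite flow_translation. Qed.

End Translations.

Section FourierModes.
Variables (R : realType) (n : nat).
Local Notation V := ('rV[R]_n * 'rV[R]_n)%type.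
Local Notation Re := (@complex.Re R).
Local Notation Im := (@complex.Im R).
Variable D : set V.
Hypothesis oD : open D.
Implicit Types (f g : V -> R[i]) (v w z : V) (c : R[i]) (k : int).
Local Notation smooth := (@smooth_on R n D).

Definition periodic_on f (e : V) := forall z, D z -> f (z + e) = f z.

Variable e : V.
Hypothesis De : forall x z, D z -> D (z + x *: e).

Let Dflow x z : D z -> D (flow (fun=> 0) e x z).
Proof. by move=> Dz; rewrite flow_translation; exact: De. Qed.

Lemma fmode_smooth k f : smooth f -> smooth (fmode e k f).
Proof. by move=> sf; rewrite fmodeE; apply: smooth_cavg => //; exact: echar_continuous. Qed.

Lemma fmode_ext k f g z : (forall z, D z -> f z = g z) -> D z ->
  fmode e k f z = fmode e k g z.
Proof. by move=> fg Dz; rewrite !fmodeE; exact: cavg_ext Dz. Qed.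

Lemma fmodeD k f g z : smooth f -> smooth g -> D z ->
  fmode e k (fun z => f z + g z) z = fmode e k f z + fmode e k g z.
Proof. by move=> *; rewrite !fmodeE (cavgD Dflow) //; exact: echar_continuous. Qed.

Lemma fmodeZ k c f z : smooth f -> D z ->
  fmode e k (fun z => c * f z) z = c * fmode e k f z.
Proof. by move=> *; rewrite !fmodeE (cavgZ Dflow) //; exact: echar_continuous. Qed.

Lemma fmode_sum k I (s : seq I) (F : I -> V -> R[i]) z :
  (forall i, smooth (F i)) -> D z ->
  fmode e k (fun z => \sum_(i <- s) F i z) z = \sum_(i <- s) fmode e k (F i) z.
Proof.
move=> sF Dz; rewrite !fmodeE (cavg_sum Dflow) //; last exact: echar_continuous.
by apply: eq_bigr => i _; rewrite fmodeE.
Qed.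

Lemma fmode_cderive k v f z : smooth f -> D z ->
  cderive v (fmode e k f) z = fmode e k (cderive v f) z.
Proof.
move=> sf Dz; have ce := @echar_continuous R k.
have sd i : smooth (fun z => (coord_xy v i)%:C * cderive (dir_xy R i) f z).
  by apply: smooth_onZ => //; exact: smooth_cderive.
rewrite (cderive_coord oD v (fmode_smooth k sf) Dz).
rewrite (@fmode_ext k _ (fun z => \sum_i (coord_xy v i)%:C * cderive (dir_xy R i) f z))//; last first.
  by move=> y Dy; rewrite (cderive_coord oD v sf Dy).
rewrite fmode_sum//; apply: eq_bigr => i _.
rewrite fmodeZ//; last exact: smooth_cderive.
congr (_ * _); rewrite fmodeE (cderive_cavg_xy oD Dflow i ce sf Dz) fmodeE.
apply: eq_cint => x; congr (_ * _); rewrite /flow_rate.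
by case: fintype.split => j; rewrite ?mulr0 ?expR0 mulr1.
Qed.

Lemma fmode_periodic k f e' : periodic_on f e' -> periodic_on (fmode e k f) e'.
Proof.
move=> pf z Dz; apply: eq_cint => x; rewrite addrAC pf//; exact: De.
Qed.

Lemma fmode_icont k f z : smooth f -> D z ->
  ccontinuous (fun x : R => echar k x * f (z + x *: e)).
Proof.
move=> sf Dz; rewrite (_ : (fun x => _) = fun x => echar k x * f (flow (fun=> 0) e x z)).
  exact: (cavg_icont Dflow (@echar_continuous R k) sf Dz).
by apply/funext => x; rewrite flow_translation.
Qed.

(** Integration by parts: the derivative of [echar k x * f (z + x *: e)] integrates to the
    difference of its end values, which is 0 by periodicity. *)
Lemma fmode_dir k f z : smooth f -> periodic_on f e -> D z ->
  fmode e k (cderive e f) z = (0 +i* freq R k) * fmode e k f z.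
Proof.
move=> sf pf Dz; have ce := @echar_continuous R k.
have sdf := smooth_cderive e sf.
have ic g : smooth g -> ccontinuous (fun x : R => echar k x * g (z + x *: e)).
  by move=> sg; exact: fmode_icont.
have icZ : ccontinuous (fun x => (0 -i* freq R k) * (echar k x * f (z + x *: e))).
  by apply: ccontinuousM; [exact: ccontinuous_cst|exact: ic].
have : cint (fun x => (0 -i* freq R k) * (echar k x * f (z + x *: e)) +
    echar k x * cderive e f (z + x *: e)) = 0.
  rewrite (@cint_FTC _ (fun x : R => echar k x * f (z + x *: e))); first last.
  - by apply: ccontinuousD => //; exact: ic.
  - move=> x; have Dx := De x Dz.
    have [f1 f2] := smooth_on_derivable e sf Dx.
    have l1 := is_derive_line (derivableP f1); have l2 := is_derive_line (derivableP f2).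
    have c1 := @is_derive_Re_echar R k x; have c2 := @is_derive_Im_echar R k x.
    split.
      rewrite compReM; apply: is_derive_eq (is_deriveB (is_deriveM c1 l1) (is_deriveM c2 l2)) _.
      rewrite ReD !ReM ImM /GRing.scale /=; ring.
    rewrite compImM; apply: is_derive_eq (is_deriveD (is_deriveM c1 l2) (is_deriveM c2 l1)) _.
    rewrite ImD !ImM ReM /GRing.scale /=; ring.
  by rewrite echar1 echar0 scale1r scale0r addr0 pf// subrr.
rewrite cintD//; last exact: ic.
rewrite cintZ; last exact: ic.
move/eqP; rewrite addr_eq0 => /eqP/esym/eqP; rewrite eqr_oppLR => /eqP E.
rewrite /fmode E -mulNr; congr (_ * _); apply: complex_eqP; rewrite ?ReN ?ImN /=.
  by rewrite oppr0.
by rewrite opprK.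
Qed.

Definition avg1 (g : V -> R) z := int01 (fun x => g (z + x *: e)).

Lemma avg1E (g : V -> R) : avg1 g = flow_avg (fun=> 0) e (fun=> 1) g.
Proof.
by apply/funext => z; apply: eq_int01 => x; rewrite mul1r flow_translation.
Qed.

Lemma avg1_cont (g : V -> R) : (forall z, D z -> {for z, continuous g}) ->
  forall z, D z -> {for z, continuous (avg1 g)}.
Proof.
move=> cg z Dz; rewrite avg1E; apply: (flow_avg_continuous oD Dflow) => // x.
exact: cvg_cst.
Qed.

Lemma line_cont (g : V -> R) z : (forall z, D z -> {for z, continuous g}) -> D z ->
  continuous (fun x : R => g (z + x *: e)).
Proof.
move=> cg Dz; have H : continuous (fun x : R => 1 * g (flow (fun=> 0) e x z)).
  by apply: (flow_avg_int_cont Dflow (kap := fun=> 1)) => // x; exact: cvg_cst.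
rewrite (_ : (fun x => _) = fun x : R => 1 * g (flow (fun=> 0) e x z)) //.
by apply/funext => x; rewrite mul1r flow_translation.
Qed.

Lemma le_avg1 (g h : V -> R) z : (forall z, D z -> {for z, continuous g}) ->
  (forall z, D z -> {for z, continuous h}) -> (forall z, D z -> g z <= h z) -> D z ->
  avg1 g z <= avg1 h z.
Proof.
move=> cg ch gh Dz; apply: le_int01 => [||x _]; [exact: line_cont|exact: line_cont|].
by apply: gh; exact: De.
Qed.

Lemma avg1Z (a : R) (g : V -> R) z : (forall z, D z -> {for z, continuous g}) ->
  D z -> avg1 (fun z => a * g z) z = a * avg1 g z.
Proof. by move=> cg Dz; rewrite /avg1 int01Z//; exact: line_cont. Qed.

Lemma smooth_norm1c_cont f : smooth f -> forall z, D z -> {for z, continuous (fun z => norm1c (f z))}.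
Proof.
move=> sf z Dz; have [f1 f2] := smooth_on_cont sf Dz.
by apply: cvgD; [exact: (cvg_norm f1)|exact: (cvg_norm f2)].
Qed.

Lemma norm1c_echar k (x : R) : norm1c (echar k x) <= 2.
Proof.
rewrite /norm1c /= normrN -[2]/(1 + 1) lerD// ler_norml ?cos_geN1 ?cos_le1 //.
by rewrite sin_geN1 sin_le1.
Qed.

(** One factor 2 bounds [norm1c] of the character, the other comes from integrating real and
    imaginary parts separately. *)
Lemma fmode_bound k f z : smooth f -> D z ->
  norm1c (fmode e k f z) <= 4 * avg1 (fun z => norm1c (f z)) z.
Proof.
move=> sf Dz; have ce := @echar_continuous R k.
have cn := @line_cont _ z (smooth_norm1c_cont sf) Dz.
have -> : 4 * avg1 (fun z => norm1c (f z)) z =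
    2 * int01 (fun x => 2 * norm1c (f (z + x *: e))).
  by rewrite int01Z// mulrA -natrM.
apply: norm1c_cint.
- exact: fmode_icont.
- by move=> x; apply: cvgM; [exact: cvg_cst|exact: cn].
- move=> x _; apply: le_trans (norm1cM _ _) _; apply: ler_wpM2r; last exact: norm1c_echar.
  exact: norm1c_ge0.
Qed.

(** The 4 is the constant of [fmode_bound]; the denominator bounds from below the factor
    [1 + freq k ^+ 2] by which [wop] multiplies the mode [k]. These weights are summable. *)
Definition mode_weight k : R := 4 / (1 + k%:~R ^+ 2).

(** The operator [1 - D_e^2]. Its symbol is at least 1, so the zero mode needs no separate
    treatment. *)
Definition wop f z : R[i] := f z - cderive e (cderive e f) z.

Lemma cderive_shift v f z w : cderive v (fun z => f (z + w)) z = cderive v f (z + w).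
Proof.
have H (h : V -> R) : 'D_v (fun z => h (z + w)) z = 'D_v h (z + w).
  rewrite /derive (_ : (fun x : R => _) = fun x : R => x^-1 *: ((h \o shift (z + w)) (x *: v) - h (z + w))) //.
  by apply/funext => x /=; rewrite addrA.
by apply: complex_eqP; exact: H.
Qed.

Lemma cderive_periodic v f e' : periodic_on f e' -> periodic_on (cderive v f) e'.
Proof.
move=> pf z Dz; rewrite -cderive_shift; exact: (@cderive_ext _ _ _ oD _ (fun y => f (y + e'))).
Qed.

Lemma smooth_wop f : smooth f -> smooth (wop f).
Proof.
move=> sf; apply: (@smooth_on_ext _ _ _ oD (fun z => f z + (-1) * cderive e (cderive e f) z)).
  by move=> z _; rewrite mulN1r.
by apply: smooth_onD => //; apply: smooth_onZ => //; do 2 apply: smooth_cderive.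
Qed.

Lemma fmode_wop k f z : smooth f -> periodic_on f e -> D z ->
  fmode e k (wop f) z = (1 + freq R k ^+ 2)%:C * fmode e k f z.
Proof.
move=> sf pf Dz; have s1 := smooth_cderive e sf; have s2 := smooth_cderive e s1.
have pdf := cderive_periodic e pf.
have -> : fmode e k (wop f) z = fmode e k (fun z => f z + (-1) * cderive e (cderive e f) z) z.
  by apply: fmode_ext => // y _; rewrite mulN1r.
rewrite fmodeD//; last exact: smooth_onZ.
rewrite fmodeZ// !fmode_dir// !mulrA -{1}[fmode e k f z]mul1r -mulrDl; congr (_ * _).
apply: complex_eqP; rewrite ?ReD ?ImD ?ReM ?ImM /= ?ReM ?ImM /=; ring.
Qed.

Lemma mode_weight_bound k f z : smooth f -> periodic_on f e -> D z ->
  norm1c (fmode e k f z) <= mode_weight k * avg1 (fun z => norm1c (wop f z)) z.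
Proof.
move=> sf pf Dz.
have := @fmode_bound k _ z (smooth_wop sf) Dz.
rewrite fmode_wop//; set A := avg1 _ _ => H.
have k2 : (k%:~R ^+ 2 : R) <= freq R k ^+ 2.
  rewrite /freq exprMn ler_peMr ?sqr_ge0// exprn_ege1//.
  by have := pi_ge2 R; rewrite mulr2n; lra.
have d0 : 0 < 1 + k%:~R ^+ 2 :> R by rewrite ltr_pwDl// sqr_ge0.
rewrite /mode_weight mulrAC ler_pdivlMr//; apply: le_trans H.
rewrite norm1cR; last by rewrite addr_ge0// sqr_ge0.
by rewrite mulrC ler_wpM2r ?norm1c_ge0// lerD2l.
Qed.

End FourierModes.

(** * Multiple Fourier series and multipliers *)

Section Fejer.
Variable R : realType.
Implicit Types (x t : R) (F : R -> R).

Definition dirichlet (M : nat) t : R := 1 + \sum_(j < M) 2 * cos (j.+1%:R * t).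

(** Not divided by [N]: its mean over a period is [N], and the normalisation appears in
    [fejer_mean]. *)
Definition fejer (N : nat) t : R := \sum_(M < N) dirichlet M t.

(** Each product [2 cos (j t) (1 - cos t)] is, up to sign, a second difference of cosines, so the
    sum telescopes. *)
Lemma dirichlet_cos M t :
  dirichlet M t * (1 - cos t) = cos (M%:R * t) - cos (M.+1%:R * t).
Proof.
rewrite /dirichlet; elim: M => [|M IHM].
  by rewrite big_ord0 addr0 mul0r cos0 mul1r mul1r.
rewrite big_ord_recr /= addrA mulrDl IHM.
have -> : M%:R * t = M.+1%:R * t - t by rewrite -natr1; ring.
have -> : M.+2%:R * t = M.+1%:R * t + t by rewrite -[in LHS]natr1; ring.
by rewrite cosB cosD; ring.
Qed.

Lemma fejer_cos N t : fejer N t * (1 - cos t) = 1 - cos (N%:R * t).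
Proof.
rewrite /fejer; elim: N => [|N IHN]; first by rewrite big_ord0 !mul0r cos0 subrr.
by rewrite big_ord_recr /= mulrDl IHN dirichlet_cos; ring.
Qed.

(** Divide [fejer_cos] by [1 - cos t]; where that vanishes, every [cos (j t)] equals 1 and the
    kernel is a sum of positive terms. *)
Lemma fejer_ge0 N t : 0 <= fejer N t.
Proof.
have [c1|c1] := eqVneq (cos t) 1.
  have s0 : sin t = 0.
    by have := cos2Dsin2 t; rewrite c1 expr1n -[RHS]addr0 => /addrI/eqP; rewrite sqrf_eq0 => /eqP.
  have cj j : cos (j%:R * t) = 1 /\ sin (j%:R * t) = 0.
    elim: j => [|j [IHc IHs]]; first by rewrite mul0r cos0 sin0.
    by rewrite -natr1 mulrDl mul1r cosD sinD IHc IHs c1 s0; split; ring.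
  apply: sumr_ge0 => M _; rewrite addr_ge0//; apply: sumr_ge0 => j _.
  by rewrite (cj _).1 mulr1.
have d0 : 0 < 1 - cos t by rewrite subr_gt0 lt_neqAle c1 cos_le1.
by rewrite -(pmulr_lge0 _ d0) fejer_cos subr_ge0 cos_le1.
Qed.

Lemma cos_scaled_continuous (a : R) : continuous (fun x => cos (a * x)).
Proof.
move=> x; apply: (cvg_comp ( *%R a) cos); last exact: continuous_cos.
by apply: cvgM; [exact: cvg_cst|exact: cvg_id].
Qed.

Lemma cos_harmonic_continuous (j : nat) : continuous (fun x => cos (j.+1%:R * (pi *+ 2 * x)) : R).
Proof.
rewrite (_ : (fun x => _) = fun x => cos (j.+1%:R * (pi *+ 2) * x)).
  exact: cos_scaled_continuous.
by apply/funext => x; rewrite mulrA.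
Qed.

Lemma dirichlet_continuous M : continuous (fun x => dirichlet M (pi *+ 2 * x)).
Proof.
move=> x; apply: cvgD; first exact: cvg_cst.
apply: cvg_sumr => j; apply: cvgM; first exact: cvg_cst.
exact: cos_harmonic_continuous.
Qed.

Lemma int01_cos (j : nat) : int01 (fun x => cos (j.+1%:R * (pi *+ 2 * x))) = 0 :> R.
Proof.
pose w : R := freq R j.+1.
have w0 : w != 0.
  rewrite /w /freq mulf_neq0 ?intr_eq0// mulrn_eq0/= gt_eqF//; exact: pi_gt0.
rewrite (_ : (fun x => _) = fun x => cos (w * x)); last first.
  by apply/funext => x; rewrite /w /freq mulrA.
have dF x : is_derive x 1 (fun x => w^-1 * sin (w * x)) (cos (w * x)).
  have H : is_derive x 1 (fun x => sin (w * x)) (cos (w * x) * w).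
    by apply: (@is_derive1_comp _ sin ( *%R w)); exact: is_derive_mull.
  by apply: is_derive_eq (is_deriveZ w^-1 H) _; rewrite /GRing.scale /= mulrC mulfK.
rewrite (int01_FTC dF); last exact: cos_scaled_continuous.
by rewrite mulr1 mulr0 (cos_freq R j.+1).2 sin0 mulr0 subrr.
Qed.

Lemma int01_dirichlet M : int01 (fun x => dirichlet M (pi *+ 2 * x)) = 1.
Proof.
have cc := cos_harmonic_continuous.
have c2 j : continuous (fun x : R => 2 * cos (j.+1%:R * (pi *+ 2 * x))).
  by move=> x; apply: cvgM; [exact: cvg_cst|exact: cc].
rewrite /dirichlet int01D; first last.
- by move=> x; apply: cvg_sumr => j; exact: c2.
- by move=> x; exact: cvg_cst.
rewrite int01_cst int01_sum; last by move=> j; exact: c2.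
by rewrite big1 ?addr0// => j _; rewrite int01Z ?int01_cos ?mulr0//; exact: cc.
Qed.

Lemma fejer_continuous N : continuous (fun x => fejer N (pi *+ 2 * x)).
Proof. by move=> x; apply: cvg_sumr => j; exact: dirichlet_continuous. Qed.

Lemma int01_fejer N : int01 (fun x => fejer N (pi *+ 2 * x)) = N%:R.
Proof.
rewrite /fejer int01_sum; last by move=> j; exact: dirichlet_continuous.
under eq_bigr do rewrite int01_dirichlet.
by rewrite sumr_const card_ord.
Qed.

Lemma cos_le_away (d x : R) : 0 < d -> d <= x <= 1 - d ->
  cos (pi *+ 2 * x) <= cos (pi *+ 2 * d).
Proof.
move=> d0 /andP[dx xd]; have p0 := pi_gt0 R.
have p2 : 0 < pi *+ 2 :> R by rewrite mulrn_wgt0.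
have H y : d <= y -> y <= 2^-1 -> cos (pi *+ 2 * y) <= cos (pi *+ 2 * d).
  move=> dy y2; rewrite leNgt ltr_cos ?(ltr_pM2l p2); first by rewrite -leNgt.
    by rewrite in_itv/= mulr2n; apply/andP; split; nra.
  by rewrite in_itv/= mulr2n; apply/andP; split; nra.
have [|x2] := lerP x 2^-1; first exact: H.
rewrite -cosN -(@cosD2pi R) (_ : _ + _ = pi *+ 2 * (1 - x)); last by ring.
by apply: H; lra.
Qed.

(** Close to the end points [F] is within [e] of [F 0]; elsewhere [1 - cos (2 pi x)] is bounded
    below. The shape of the bound is made for [fejer_cos]: multiplied by [fejer N], the second term
    becomes [C (1 - cos (2 pi N x))], which is bounded uniformly in [N]. *)
Lemma near_endpoints F e : continuous F -> F 1 = F 0 -> 0 < e ->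
  exists2 C : R, 0 <= C & forall x : R, 0 <= x <= 1 ->
    `|F x - F 0| <= e + C * (1 - cos (pi *+ 2 * x)).
Proof.
move=> cF F10 e0.
have /cvgrPdist_lt /(_ _ e0) /nbhs_ballP[d0 /= d00 bd0] := cF 0.
have /cvgrPdist_lt /(_ _ e0) /nbhs_ballP[d1 /= d10 bd1] := cF 1.
(* Halving the minimum makes the comparisons with [d0] and [d1] strict, and the cap [2^-1] gives
   [d <= 4^-1], so that [2 pi d] stays in the range where the cosine decreases. *)
pose d := Num.min (Num.min d0 d1) 2^-1 / 2.
have d_gt0 : 0 < d by rewrite divr_gt0// !lt_min d00 d10/= invr_gt0.
have dd0 : d < d0.
  by rewrite ltr_pdivrMr// (@le_lt_trans _ _ d0) ?ge_min ?lexx// ltr_pMr// ltr1n.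
have dd1 : d < d1.
  by rewrite ltr_pdivrMr// (@le_lt_trans _ _ d1) ?ge_min ?lexx ?orbT// ltr_pMr// ltr1n.
have d4 : d <= 4^-1.
  rewrite ler_pdivrMr// ge_min; apply/orP; right; lra.
have cG : {within `[0, 1], continuous (fun x => `|F x - F 0|)}.
  apply: continuous_subspaceT => x; apply: cvg_norm; apply: cvgB; [exact: cF|exact: cvg_cst].
have [c c01 Bc] := EVT_max (@ler01 R) cG.
pose m := 1 - cos (pi *+ 2 * d).
have m0 : 0 < m.
  have p0 := pi_gt0 R.
  rewrite subr_gt0 -[ltRHS]cos0 ltr_cos ?in_itv/= ?lexx ?pi_ge0//=.
    by rewrite mulr_gt0// mulrn_wgt0.
  by rewrite mulr2n; apply/andP; split; nra.
exists (`|F c - F 0| / m); first by rewrite divr_ge0// ltW.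
move=> x /andP[x0 x1].
have C0 : 0 <= `|F c - F 0| / m * (1 - cos (pi *+ 2 * x)).
  by rewrite mulr_ge0 ?divr_ge0 ?subr_ge0 ?cos_le1// ltW.
have [xd|dx] := ltrP x d.
  apply: (@le_trans _ _ e); last by rewrite lerDl.
  rewrite distrC ltW//; apply: bd0; rewrite -ball_normE /= sub0r normrN ger0_norm//.
  exact: lt_trans xd dd0.
have [xd|dx'] := ltrP (1 - d) x.
  apply: (@le_trans _ _ e); last by rewrite lerDl.
  rewrite distrC -F10 ltW//; apply: bd1; rewrite -ball_normE /= ger0_norm ?subr_ge0//.
  by apply: le_lt_trans dd1; lra.
apply: (@le_trans _ _ `|F c - F 0|); first by apply: Bc; rewrite in_itv/= x0.
apply: ler_wpDl; first exact: ltW.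
rewrite mulrAC ler_pdivlMr// ler_wpM2l// lerD2l lerN2.
by apply: cos_le_away => //; rewrite dx.
Qed.

(** Fejer's theorem at the end point: [near_endpoints] with [e / 2] bounds the error by
    [e / 2 + 2 C / (N + 1)]. *)
Lemma fejer_mean F : continuous F -> F 1 = F 0 ->
  (fun N => N.+1%:R^-1 * int01 (fun x => fejer N.+1 (pi *+ 2 * x) * F x)) @ \oo --> F 0.
Proof.
move=> cF F10; apply/cvgrPdist_le => e e0.
have e20 : 0 < e / 2 by rewrite divr_gt0.
have [C C0 bC] := near_endpoints cF F10 e20.
have [m _ Hm] : \forall N \near \oo, 2 * C * (2 / e) <= N%:R :> R by exact: nbhs_infty_ger.
near=> N.
have N0 : (0 : R) < N.+1%:R by rewrite ltr0n.
have cj := @fejer_continuous N.+1.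
have cjF (G : R -> R) : continuous G -> continuous (fun x => fejer N.+1 (pi *+ 2 * x) * G x).
  by move=> cG x; apply: cvgM; [exact: cj|exact: cG].
have cd : continuous (fun x => 1 - cos (pi *+ 2 * x)).
  by move=> x; apply: cvgB; [exact: cvg_cst|exact: cos_scaled_continuous].
have E : F 0 - N.+1%:R^-1 * int01 (fun x => fejer N.+1 (pi *+ 2 * x) * F x) =
    - (N.+1%:R^-1 * int01 (fun x => fejer N.+1 (pi *+ 2 * x) * (F x - F 0))).
  have -> : int01 (fun x => fejer N.+1 (pi *+ 2 * x) * (F x - F 0)) =
      int01 (fun x => fejer N.+1 (pi *+ 2 * x) * F x) - N.+1%:R * F 0.
    rewrite -int01_fejer mulrC -int01Z// -int01B; [|exact: cjF|].
      by apply: eq_int01 => x; ring.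
    by move=> x; apply: cvgM; [exact: cvg_cst|exact: cj].
  by rewrite mulrBr mulKf ?gt_eqF// opprB.
rewrite E normrN normrM ger0_norm ?invr_ge0 ?ler0n//.
rewrite -(ler_pM2l N0) mulrA divff ?gt_eqF// mul1r.
apply: (@le_trans _ _ (int01 (fun x => (e / 2) * fejer N.+1 (pi *+ 2 * x) + C * 2))).
  apply: ler_norm_int01.
  - by apply: cjF => x; apply: cvgB; [exact: cF|exact: cvg_cst].
  - by move=> x; apply: cvgD; [apply: cvgM; [exact: cvg_cst|exact: cj]|exact: cvg_cst].
  - move=> x x01; rewrite normrM ger0_norm ?fejer_ge0//.
    apply: (@le_trans _ _ (fejer N.+1 (pi *+ 2 * x) * (e / 2 + C * (1 - cos (pi *+ 2 * x))))).
      by rewrite ler_wpM2l ?fejer_ge0// bC.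
    rewrite mulrDr [_ * (e / 2)]mulrC lerD2l mulrCA fejer_cos ler_wpM2l//.
    by have := cos_geN1 (N.+1%:R * (pi *+ 2 * x)); lra.
rewrite int01D; first last.
- by move=> x; exact: cvg_cst.
- by move=> x; apply: cvgM; [exact: cvg_cst|exact: cj].
rewrite (int01Z (e / 2) cj) int01_fejer int01_cst.
have : 2 * C * (2 / e) <= N%:R by apply: Hm; near: N; exact: nbhs_infty_ge.
rewrite mulrA ler_pdivrMr// -[N.+1%:R]natr1 => H; nra.
Unshelve. all: by end_near. Qed.

End Fejer.

Section Boxes.
Variable R : realType.

(** The integers from [-M] to [M], ordered so that a larger [M] only appends terms; sums of
    nonnegative terms are then monotone in [M]. *)
Fixpoint freqs (M : nat) : seq int :=
  if M is M'.+1 then freqs M' ++ [:: M'.+1%:Z; - M'.+1%:Z] else [:: 0].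

Fixpoint box (m M : nat) : seq (seq int) :=
  if m is m'.+1 then [seq k :: s | k <- freqs M, s <- box m' M] else [:: [::]].

Lemma sum_box (W : zmodType) m M (G : seq int -> W) :
  \sum_(s <- box m.+1 M) G s = \sum_(k <- freqs M) \sum_(s <- box m M) G (k :: s).
Proof. by rewrite /= big_allpairs_dep. Qed.

Lemma le_sum_freqs M M' (G : int -> R) : (M <= M')%N -> (forall k, 0 <= G k) ->
  \sum_(k <- freqs M) G k <= \sum_(k <- freqs M') G k.
Proof.
move=> + G0; elim: M' => [|M' IHM']; first by rewrite leqn0 => /eqP ->.
rewrite leq_eqVlt => /predU1P[->//|/IHM' le1]; apply: le_trans le1 _.
by rewrite /= big_cat /= lerDl !big_cons big_nil addr0 addr_ge0.
Qed.

Lemma le_sum_box m M M' (G : seq int -> R) : (M <= M')%N -> (forall s, 0 <= G s) ->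
  \sum_(s <- box m M) G s <= \sum_(s <- box m M') G s.
Proof.
elim: m G => [|m IHm] G MM' G0; first by rewrite !big_seq1.
rewrite !sum_box; apply: (@le_trans _ _ (\sum_(k <- freqs M) \sum_(s <- box m M') G (k :: s))).
  by apply: ler_sum => k _; exact: IHm.
by apply: le_sum_freqs => // k; exact: sumr_ge0.
Qed.

Fixpoint weight (m : nat) (s : seq int) : R :=
  if m is m'.+1 then mode_weight R (head 0 s) * weight m' (behead s) else 1.

Lemma mode_weight_ge0 k : 0 <= mode_weight R k.
Proof. by rewrite divr_ge0// addr_ge0// sqr_ge0. Qed.

Lemma weight_ge0 m s : 0 <= weight m s.
Proof. by elim: m s => //= m IHm s; rewrite mulr_ge0 ?mode_weight_ge0. Qed.

(** A telescoping majorant: the two terms of absolute frequency [a = M + 1] add [8 / (1 + a^2)], at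
    most [16 / (a (a + 1)) = 16 / a - 16 / (a + 1)]. The weight 4 of frequency 0 gives
    [20 = 4 + 16]. *)
Lemma sum_mode_weight M : \sum_(k <- freqs M) mode_weight R k <= 20 - 16 / M.+1%:R.
Proof.
elim: M => [|M IHM]; first by rewrite big_seq1 /mode_weight expr0n/= addr0 !divr1; lra.
rewrite /= big_cat /= !big_cons big_nil addr0.
apply: le_trans (lerD IHM (lexx _)) _.
rewrite /mode_weight mulrNz sqrrN -pmulrn.
have -> : M.+2%:R = M.+1%:R + 1 :> R by rewrite natr1.
have a0 : (0 : R) < M.+1%:R by rewrite ltr0n.
move: (M.+1%:R : R) a0 => a a0.
have -> : 20 - 16 / (a + 1) = 20 - 16 / a + 16 / (a * (a + 1)).
  by field; rewrite !gt_eqF//; lra.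
rewrite lerD2l -mulrDl ler_pdivrMr; last by nra.
rewrite mulrAC ler_pdivlMr; last by nra.
by nra.
Qed.

Definition box_weight m M : R := \sum_(s <- box m M) weight m s.

Lemma box_weight_bound m M : box_weight m M <= 20 ^+ m.
Proof.
rewrite /box_weight; elim: m => [|m IHm]; first by rewrite big_seq1.
rewrite sum_box /=; under eq_bigr do rewrite -mulr_sumr.
rewrite -mulr_suml exprS; apply: ler_pM => //.
- by apply: sumr_ge0 => k _; exact: mode_weight_ge0.
- by apply: sumr_ge0 => s _; exact: weight_ge0.
- by apply: le_trans (sum_mode_weight M) _; rewrite lerBlDr lerDl divr_ge0.
Qed.

Lemma box_weight_cvg m : cvgn (box_weight m).
Proof.
apply: nondecreasing_is_cvgn.
  by move=> M M' MM'; apply: le_sum_box => // s; exact: weight_ge0.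
by exists (20 ^+ m) => _ [M _ <-]; exact: box_weight_bound.
Qed.

Lemma box_weight_tail m M : 0 <= limn (box_weight m) - box_weight m M.
Proof.
rewrite subr_ge0; apply: nondecreasing_cvgn_le; last exact: box_weight_cvg.
by move=> i j ij; apply: le_sum_box => // s; exact: weight_ge0.
Qed.

(** For a real sequence [F] bounded by [A * weight], both [A * weight + F] and [A * weight - F] are
    nonnegative, so their box sums increase with [M]. The factor 2 accounts for real and imaginary
    parts. *)
Lemma sum_box_diff m M M' (G : seq int -> R[i]) (A : R) : (M <= M')%N ->
  (forall s, norm1c (G s) <= A * weight m s) ->
  norm1c (\sum_(s <- box m M') G s - \sum_(s <- box m M) G s) <=
    2 * (A * (box_weight m M' - box_weight m M)).
Proof.
move=> MM' GA.
have H (F : seq int -> R) : (forall s, `|F s| <= A * weight m s) ->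
    `|\sum_(s <- box m M') F s - \sum_(s <- box m M) F s| <=
    A * (box_weight m M' - box_weight m M).
  move=> FA; rewrite mulrBr /box_weight !mulr_sumr.
  have h1 := @le_sum_box m M M' (fun s => A * weight m s - F s) MM'.
  have h2 := @le_sum_box m M M' (fun s => A * weight m s + F s) MM'.
  rewrite !sumrB in h1; rewrite !big_split /= in h2.
  rewrite ler_norml; apply/andP; split.
    have /h2 : forall s, 0 <= A * weight m s + F s.
      by move=> s; have := FA s; rewrite ler_norml => /andP[]; lra.
    by lra.
  have /h1 : forall s, 0 <= A * weight m s - F s.
    by move=> s; have := FA s; rewrite ler_norml => /andP[]; lra.
  by lra.
rewrite mulr_natl mulr2n /norm1c ReD ImD ReN ImN !Re_sum !Im_sum; apply: lerD; apply: H => s;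
  apply: le_trans (GA s); rewrite /norm1c.
  by rewrite lerDl.
by rewrite lerDr.
Qed.

End Boxes.

Section ComplexLimits.
Variable R : realType.
Local Notation Re := (@complex.Re R).
Local Notation Im := (@complex.Im R).
Implicit Types (u : nat -> R[i]) (b : nat -> R).

Definition clim u : R[i] := limn (Re \o u) +i* limn (Im \o u).

(** [u + b] is nondecreasing and bounded, hence converges, and so does [u = (u + b) - b]. *)
Lemma dominated_cvg (u b : nat -> R) : cvgn b ->
  (forall M M', (M <= M')%N -> `|u M' - u M| <= b M' - b M) ->
  cvgn u /\ forall M, `|limn u - u M| <= limn b - b M.
Proof.
move=> cb ub.
have ndb : {homo b : i j / (i <= j)%N >-> i <= j}.
  by move=> i j /ub H; rewrite -subr_ge0; apply: le_trans H.
have bB M : b M <= limn b by exact: nondecreasing_cvgn_le.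
have cub : cvgn (fun M => u M + b M).
  apply: nondecreasing_is_cvgn.
    by move=> i j /ub; rewrite ler_norml => /andP[]; lra.
  exists (u 0%N + (limn b - b 0%N) + limn b) => _ [M _ <-].
  have := ub 0%N M (leq0n _); rewrite ler_norml => /andP[_ H].
  by have := bB M; lra.
have cu : cvgn u.
  have -> : u = (fun M => (u M + b M) - b M) by apply/funext => M; rewrite addrK.
  exact: is_cvgB.
split=> // M.
have c1 : `|u M' - u M| @[M' --> \oo] --> `|limn u - u M|.
  by apply: cvg_norm; apply: cvgB; [exact: cu|exact: cvg_cst].
have c2 : b M' - b M @[M' --> \oo] --> limn b - b M.
  by apply: cvgB; [exact: cb|exact: cvg_cst].
rewrite -(cvg_lim _ c1)// -(cvg_lim _ c2)//; apply: ler_lim.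
- by apply/cvg_ex; eexists; exact: c1.
- by apply/cvg_ex; eexists; exact: c2.
- by exists M => // M' /= /ub.
Qed.

Lemma clim_dominated u b : cvgn b ->
  (forall M M', (M <= M')%N -> norm1c (u M' - u M) <= b M' - b M) ->
  [/\ cvgn (Re \o u), cvgn (Im \o u) &
    forall M, norm1c (clim u - u M) <= 2 * (limn b - b M)].
Proof.
move=> cb ub.
have [cR tR] : cvgn (Re \o u) /\ forall M, `|limn (Re \o u) - Re (u M)| <= limn b - b M.
  apply: (@dominated_cvg (Re \o u)) => // M M' MM'; apply: le_trans (ub _ _ MM').
  by rewrite /norm1c ReD ReN lerDl.
have [cI tI] : cvgn (Im \o u) /\ forall M, `|limn (Im \o u) - Im (u M)| <= limn b - b M.
  apply: (@dominated_cvg (Im \o u)) => // M M' MM'; apply: le_trans (ub _ _ MM').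
  by rewrite /norm1c ImD ImN lerDr.
by split=> // M; rewrite /norm1c ReD ImD ReN ImN mulr_natl mulr2n lerD.
Qed.

Lemma clim_eq u l : (Re \o u @ \oo --> Re l) -> (Im \o u @ \oo --> Im l) -> clim u = l.
Proof. by move=> uR uI; apply: complex_eqP; [exact: cvg_lim uR|exact: cvg_lim uI]. Qed.

Lemma clim_norm u l b : b @ \oo --> (0 : R) -> (forall M, norm1c (u M - l) <= b M) ->
  (Re \o u @ \oo --> Re l) /\ (Im \o u @ \oo --> Im l).
Proof.
move=> b0 ub.
have H (v : nat -> R) a : (forall M, `|v M - a| <= b M) -> v @ \oo --> a.
  move=> vb; apply/cvgrPdist_lt => e e0; move/cvgrPdist_lt : b0 => /(_ _ e0).
  apply: filterS => M; rewrite sub0r normrN => be; rewrite distrC.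
  by apply: le_lt_trans (vb M) _; apply: le_lt_trans be; exact: ler_norm.
split; apply: H => M; apply: le_trans (ub M); rewrite /norm1c ReD ImD ReN ImN /=.
  by rewrite lerDl.
by rewrite lerDr.
Qed.

End ComplexLimits.

Local Opaque cderive.

Section MultiFourier.
Variables (R : realType) (n : nat).
Local Notation V := ('rV[R]_n * 'rV[R]_n)%type.
Local Notation Re := (@complex.Re R).
Local Notation Im := (@complex.Im R).
Variable D : set V.
Hypothesis oD : open D.
Implicit Types (f g : V -> R[i]) (v w z e : V) (c : R[i]) (k : int).
Implicit Types (es : seq V) (s : seq int).
Local Notation smooth := (@smooth_on R n D).

Definition stable es := forall e, e \in es -> forall x z, D z -> D (z + x *: e).

Lemma stable_cons e es : stable (e :: es) ->
  (forall x z, D z -> D (z + x *: e)) /\ stable es.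
Proof.
move=> st; split=> [|e' e's]; first by apply: st; rewrite mem_head.
by apply: st; rewrite in_cons e's orbT.
Qed.

Definition lattice_smooth es f := smooth f /\ forall e, e \in es -> periodic_on D f e.

Lemma lattice_smooth_cons e es f : lattice_smooth (e :: es) f ->
  periodic_on D f e /\ lattice_smooth es f.
Proof.
move=> [sf pf]; split; first by apply: pf; rewrite mem_head.
by split=> // e' e's; apply: pf; rewrite in_cons e's orbT.
Qed.

Lemma lattice_smooth_cderive es v f : lattice_smooth es f -> lattice_smooth es (cderive v f).
Proof.
move=> [sf pf]; split; first exact: smooth_cderive.
by move=> e /pf; exact: cderive_periodic.
Qed.

(** The mode of frequency vector [s] for the torus spanned by [es]; missing entries of [s] count as
    frequency 0. *)
Fixpoint modes es s f : V -> R[i] :=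
  if es is e :: es' then modes es' (behead s) (fmode e (head 0 s) f) else f.

Lemma modes_smooth es s f : stable es -> smooth f -> smooth (modes es s f).
Proof.
elim: es s f => //= e es IHes s f /stable_cons[se ses] sf.
by apply: IHes => //; exact: fmode_smooth.
Qed.

Lemma modes_ext es s f g z : stable es -> (forall z, D z -> f z = g z) -> D z ->
  modes es s f z = modes es s g z.
Proof.
elim: es s f g => [|e es IHes] s f g /= st fg Dz; first exact: fg.
have [se ses] := stable_cons st.
by apply: IHes => // y Dy; exact: (fmode_ext se).
Qed.

Lemma modesD es s f g z : stable es -> smooth f -> smooth g -> D z ->
  modes es s (fun z => f z + g z) z = modes es s f z + modes es s g z.
Proof.
elim: es s f g => //= e es IHes s f g /stable_cons[se ses] sf sg Dz.
rewrite -IHes //; [|exact: fmode_smooth..].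
by apply: modes_ext => // y Dy; exact: (fmodeD se).
Qed.

Lemma modesZ es s c f z : stable es -> smooth f -> D z ->
  modes es s (fun z => c * f z) z = c * modes es s f z.
Proof.
elim: es s f => //= e es IHes s f /stable_cons[se ses] sf Dz.
rewrite -IHes //; last exact: fmode_smooth.
by apply: modes_ext => // y Dy; exact: (fmodeZ se).
Qed.

Lemma modes_sum es s I (r : seq I) (F : I -> V -> R[i]) z : stable es ->
  (forall i, smooth (F i)) -> D z ->
  modes es s (fun z => \sum_(i <- r) F i z) z = \sum_(i <- r) modes es s (F i) z.
Proof.
elim: es s F => //= e es IHes s F /stable_cons[se ses] sF Dz.
rewrite -IHes //; last by move=> i; exact: fmode_smooth.
by apply: modes_ext => // y Dy; exact: (fmode_sum se).
Qed.

Lemma modes_cderive es s v f z : stable es -> smooth f -> D z ->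
  cderive v (modes es s f) z = modes es s (cderive v f) z.
Proof.
elim: es s f => //= e es IHes s f /stable_cons[se ses] sf Dz.
rewrite IHes//; last exact: fmode_smooth.
by apply: modes_ext => // y Dy; exact: (fmode_cderive oD).
Qed.

Lemma modes_shift es s f w z :
  modes es s (fun z => f (z + w)) z = modes es s f (z + w).
Proof.
elim: es s f => //= e es IHes s f; rewrite -IHes; congr (modes _ _ _ _).
by apply/funext => y; apply: eq_cint => x; rewrite addrAC.
Qed.

Lemma modes_dir es s f i z : stable es -> lattice_smooth es f -> (i < size es)%N -> D z ->
  modes es s (cderive (nth 0 es i) f) z = (0 +i* freq R (nth 0 s i)) * modes es s f z.
Proof.
elim: es s f i => // e es IHes s f i st lf ie Dz /=.
have [se ses] := stable_cons st; have [pf [sf pfs]] := lattice_smooth_cons lf.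
case: i ie => [|i] ie /=.
  rewrite -modesZ //; last exact: fmode_smooth.
  apply: modes_ext => // y Dy; rewrite (fmode_dir se)//.
have -> : nth 0 s i.+1 = nth 0 (behead s) i by case: s => //=; rewrite nth_nil.
rewrite -IHes //; last first.
  by split; [exact: fmode_smooth|move=> e' /pfs; exact: (fmode_periodic se)].
by apply: modes_ext => // y Dy; rewrite (fmode_cderive oD se).
Qed.

Fixpoint wops es f : V -> R[i] := if es is e :: es' then wop e (wops es' f) else f.

Fixpoint avgs es (g : V -> R) : V -> R := if es is e :: es' then avgs es' (avg1 e g) else g.

Lemma smooth_wops es f : smooth f -> smooth (wops es f).
Proof. by move=> sf; elim: es => //= e es IHes; exact: smooth_wop. Qed.

Lemma wop_periodic e f e' : periodic_on D f e' -> periodic_on D (wop e f) e'.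
Proof.
move=> pf z Dz.
have p2 : periodic_on D (cderive e (cderive e f)) e' by do 2 apply: cderive_periodic => //.
by rewrite /wop (pf _ Dz) (p2 _ Dz).
Qed.

Lemma wops_periodic es f e : periodic_on D f e -> periodic_on D (wops es f) e.
Proof. by move=> pf; elim: es => [|e' es IHes]; [exact: pf|exact: (@wop_periodic e' _ _ IHes)]. Qed.

Lemma avgs_cont es (g : V -> R) : stable es -> (forall z, D z -> {for z, continuous g}) ->
  forall z, D z -> {for z, continuous (avgs es g)}.
Proof.
elim: es g => //= e es IHes g /stable_cons[se ses] cg.
by apply: IHes => //; exact: avg1_cont.
Qed.

Lemma le_avgs es (g h : V -> R) z : stable es -> (forall z, D z -> {for z, continuous g}) ->
  (forall z, D z -> {for z, continuous h}) -> (forall z, D z -> g z <= h z) -> D z ->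
  avgs es g z <= avgs es h z.
Proof.
elim: es g h => /= [|e es IHes] g h st cg ch gh Dz; first exact: gh.
have [se ses] := stable_cons st; apply: IHes => //; try exact: avg1_cont.
by move=> y Dy; exact: (le_avg1 se).
Qed.

Lemma avgsZ es (a : R) (g : V -> R) z : stable es -> (forall z, D z -> {for z, continuous g}) ->
  D z -> avgs es (fun z => a * g z) z = a * avgs es g z.
Proof.
elim: es g => //= e es IHes g /stable_cons[se ses] cg Dz.
have c1 := avg1_cont oD se cg.
have cc (h : V -> R) : (forall z, D z -> {for z, continuous h}) ->
    forall z, D z -> {for z, continuous (fun z => a * h z)}.
  by move=> ch y Dy; apply: cvgM; [exact: cvg_cst|exact: ch].
have ca : forall z, D z -> {for z, continuous (avg1 e (fun z => a * g z))}.
  exact: (avg1_cont oD se (cc _ cg)).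
have E y : D y -> avg1 e (fun z => a * g z) y = a * avg1 e g y by move=> Dy; exact: (avg1Z se).
rewrite -(IHes _ ses c1 Dz); apply/eqP; rewrite eq_le; apply/andP; split.
  by apply: (le_avgs ses ca (cc _ c1)) => // y Dy; rewrite E.
by apply: (le_avgs ses (cc _ c1) ca) => // y Dy; rewrite E.
Qed.

Lemma wops_fmode es e k f : stable (e :: es) -> smooth f ->
  forall z, D z -> wops es (fmode e k f) z = fmode e k (wops es f) z.
Proof.
move=> st sf; have [se ses] := stable_cons st.
elim: es {st ses} => //= e' es IHes z Dz.
have sw := smooth_wops es sf; have sd := smooth_cderive e' sw.
have sf1 := fmode_smooth oD se k sw.
rewrite {1}/wop IHes// (@cderive_ext _ _ _ oD e' _ (cderive e' (fmode e k (wops es f)))) //; last first.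
  by move=> y Dy; exact: (@cderive_ext _ _ _ oD e' _ _ y IHes Dy).
rewrite (@cderive_ext _ _ _ oD e' _ (fmode e k (cderive e' (wops es f)))) //; last first.
  by move=> y Dy; exact: (fmode_cderive oD se).
rewrite (fmode_cderive oD se)//.
rewrite [RHS](@fmode_ext _ _ _ _ se k _ (fun z => wops es f z + (-1) * cderive e' (cderive e' (wops es f)) z))//.
  rewrite (fmodeD se)//; last by apply: smooth_onZ => //; exact: smooth_cderive.
  by rewrite (fmodeZ se) ?mulN1r//; exact: smooth_cderive.
by move=> y Dy; rewrite mulN1r.
Qed.

(** A mean over the period parallelotope, not a supremum. It depends continuously on [z], which
    turns the bound on modes into a locally uniform one. *)
Definition sup_avg es f z := avgs es (fun z => norm1c (wops es f z)) z.

Lemma sup_avg_cont es f : stable es -> smooth f ->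
  forall z, D z -> {for z, continuous (sup_avg es f)}.
Proof.
move=> st sf; apply: avgs_cont => //; apply: smooth_norm1c_cont; exact: smooth_wops.
Qed.

(** Each direction contributes one factor of [weight] through [mode_weight_bound]; the induction
    goes through because [wops] of the remaining directions commutes with [fmode]. *)
Lemma modes_bound es s f z : stable es -> lattice_smooth es f -> D z ->
  norm1c (modes es s f z) <= weight R (size es) s * sup_avg es f z.
Proof.
rewrite /sup_avg; elim: es s f => [|e es IHes] s f st lf Dz /=; first by rewrite mul1r.
have [se ses] := stable_cons st; have [pf [sf pfs]] := lattice_smooth_cons lf.
have sF := fmode_smooth oD se (head 0 s) sf.
apply: le_trans (IHes (behead s) (fmode e (head 0 s) f) ses _ Dz) _.
  by split=> // e' /pfs; exact: (fmode_periodic se).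
rewrite [mode_weight _ _ * _]mulrC -mulrA ler_wpM2l ?weight_ge0// -avgsZ//; last first.
  by apply: avg1_cont => //; apply: smooth_norm1c_cont; apply: smooth_wop => //; exact: smooth_wops.
apply: le_avgs => //.
- by apply: smooth_norm1c_cont; exact: smooth_wops.
- move=> y Dy; apply: cvgM; first exact: cvg_cst.
  apply: (avg1_cont oD se) => //; apply: smooth_norm1c_cont; apply: smooth_wop => //.
  exact: smooth_wops.
- move=> y Dy; rewrite (wops_fmode _ st)//; apply: (mode_weight_bound oD se) => //.
    exact: smooth_wops.
  exact: wops_periodic.
Qed.

Lemma sum_echar M (x : R) :
  \sum_(k <- freqs M) echar k x = (dirichlet M (pi *+ 2 * x))%:C.
Proof.
rewrite /dirichlet; elim: M => [|M IHM].
  by rewrite big_seq1 big_ord0 addr0 /echar /freq mul0r mul0r cos0 sin0 oppr0.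
rewrite /= big_cat /= IHM !big_cons big_nil addr0 big_ord_recr /=.
rewrite /echar /freq mulrNz !mulNr cosN sinN -!pmulrn mulrA.
by apply: complex_eqP; rewrite ?ReD ?ImD /=; ring.
Qed.

(** [modes_bound] gives convergence but not the value of the limit. The partial sums are Dirichlet
    integrals, so their Cesaro means are Fejer means and tend to [f z]; a convergent sequence has
    the same limit as its means. *)
Lemma fmode_sum_cvg e f z : (forall x z, D z -> D (z + x *: e)) -> smooth f ->
  periodic_on D f e -> D z ->
  let u := fun M => \sum_(k <- freqs M) fmode e k f z in
  (Re \o u @ \oo --> Re (f z)) /\ (Im \o u @ \oo --> Im (f z)).
Proof.
move=> se sf pf Dz u.
have st : stable [:: e] by move=> e' /[!inE] /eqP ->.
have lf : lattice_smooth [:: e] f by split=> // e' /[!inE] /eqP ->.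
have uE M : u M = \sum_(s <- box 1 M) modes [:: e] s f z.
  by rewrite sum_box; apply: eq_bigr => k _; rewrite big_seq1.
have A0 : 0 <= sup_avg [:: e] f z.
  have := modes_bound [:: 0] st lf Dz; rewrite /= mulr1 => H.
  have := le_trans (norm1c_ge0 _) H; rewrite pmulr_rge0//.
  by rewrite /mode_weight expr0n/= addr0 divr1.
have [cR cI _] : [/\ cvgn (Re \o u), cvgn (Im \o u) &
    forall M, norm1c (clim u - u M) <= 2 * (limn (fun M => 2 * sup_avg [:: e] f z * box_weight R 1 M)
      - 2 * sup_avg [:: e] f z * box_weight R 1 M)].
  apply: clim_dominated; first by apply: is_cvgM; [exact: is_cvg_cst|exact: box_weight_cvg].
  move=> M M' MM'; rewrite !uE -mulrBr -mulrA; apply: sum_box_diff => // s.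
  by rewrite mulrC; exact: modes_bound.
have cf k := @fmode_icont _ _ _ _ se k f z sf Dz.
have U M : u M = cint (fun x => (dirichlet M (pi *+ 2 * x))%:C * f (z + x *: e)).
  rewrite /u -cint_sum //; apply: eq_cint => x.
  by rewrite -mulr_suml sum_echar.
have key (P : R[i] -> R) (F : R -> R) : F = (fun x => P (f (z + x *: e))) ->
    continuous F ->
    (forall M, P (u M) = int01 (fun x => dirichlet M (pi *+ 2 * x) * F x)) ->
    cvgn (P \o u) -> P \o u @ \oo --> P (f z).
  move=> FE cF PE cP.
  have F10 : F 1 = F 0 by rewrite FE scale1r scale0r addr0 pf.
  have := fejer_mean cF F10.
  have E : (fun N : nat => N.+1%:R^-1 * int01 (fun x => fejer N.+1 (pi *+ 2 * x) * F x))
      = arithmetic_mean (P \o u).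
    apply/funext => N; rewrite /arithmetic_mean /= ; congr (_ * _).
    rewrite /series /= big_mkord; under [RHS]eq_bigr do rewrite PE.
    rewrite -int01_sum; last first.
      by move=> M x; apply: cvgM; [exact: dirichlet_continuous|exact: cF].
    by apply: eq_int01 => x; rewrite /fejer mulr_suml.
  rewrite E => H1; have H2 := cesaro cP.
  have <- : limn (P \o u) = P (f z).
    have -> : limn (P \o u) = F 0 by exact: (cvg_unique _ H2 H1).
    by rewrite FE scale0r addr0.
  exact: cP.
have [c1 c2] : ccontinuous (fun x : R => f (z + x *: e)).
  by have := cf 0; rewrite (_ : (fun x => _) = fun x : R => f (z + x *: e))//;
   apply/funext => x; rewrite /echar /freq !mul0r cos0 sin0 oppr0 mul1r.
split.
  apply: (key Re (fun x => Re (f (z + x *: e)))) => // M.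
  by rewrite U /cint /=; apply: eq_int01 => x /=; rewrite ReM /= mul0r subr0.
apply: (key Im (fun x => Im (f (z + x *: e)))) => // M.
by rewrite U /cint /=; apply: eq_int01 => x /=; rewrite ImM /= mul0r addr0.
Qed.

End MultiFourier.

(** * Locally uniform limits and their derivatives *)

Section LocallyUniformLimits.
Variables (R : realType) (V : normedModType R) (D : set V).
Variables (F : nat -> V -> R) (F' : V -> R) (beta : V -> R) (tau : nat -> R).
Hypothesis oD : open D.
Hypothesis cbeta : forall z, D z -> {for z, continuous beta}.
Hypothesis tau0 : tau @ \oo --> (0 : R).
Hypothesis tau_ge0 : forall M, 0 <= tau M.
Hypothesis FF' : forall z M, D z -> `|F' z - F M z| <= beta z * tau M.

(** In this section [F'] is the limit of the [F M], not a derivative. The bound [beta z * tau M]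
    with [beta] continuous encodes locally uniform convergence without naming compact sets. *)
Lemma uniform_limit_cvg z : D z -> F M z @[M --> \oo] --> F' z.
Proof.
move=> Dz; apply/cvgrPdist_lt => e e0.
have : beta z * tau M @[M --> \oo] --> beta z * 0 by apply: cvgM; [exact: cvg_cst|].
rewrite mulr0 => /cvgrPdist_lt /(_ _ e0); apply: filterS => M; rewrite sub0r normrN => H.
by apply: le_lt_trans (FF' M Dz) _; apply: le_lt_trans H; exact: ler_norm.
Qed.

Lemma uniform_limit_cont z : (forall M, {for z, continuous (F M)}) -> D z ->
  {for z, continuous F'}.
Proof.
move=> cF Dz; apply/cvgrPdist_lt => e e0.
have e30 : 0 < e / 3 by rewrite divr_gt0.
have : (beta z + 1) * tau M @[M --> \oo] --> (beta z + 1) * 0.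
  by apply: cvgM; [exact: cvg_cst|].
rewrite mulr0 => /cvgrPdist_lt /(_ _ e30) [M _ HM].
have bM : (beta z + 1) * tau M < e / 3.
  by apply: le_lt_trans (ler_norm _) _; rewrite -normrN -sub0r; apply: (HM M) => /=.
have /cvgrPdist_lt /(_ _ ltr01) nb := cbeta Dz.
have /cvgrPdist_lt /(_ _ e30) nF := cF M.
near=> y.
have Dy : D y by near: y; exact: open_nbhs_nbhs.
have by1 : beta y <= beta z + 1.
  have : `|beta z - beta y| < 1 by near: y.
  by rewrite ltr_norml => /andP[]; lra.
have h1 := FF' M Dz; have h2 := FF' M Dy.
have h3 : `|F M z - F M y| < e / 3 by near: y.
have h4 : beta z * tau M <= (beta z + 1) * tau M by rewrite ler_wpM2r// lerDl.
have h5 : beta y * tau M <= (beta z + 1) * tau M by rewrite ler_wpM2r.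
have := ler_distD (F M z) (F' z) (F' y); have := ler_distD (F M y) (F M z) (F' y).
rewrite [`|F M y - F' y|]distrC; lra.
Unshelve. all: by end_near. Qed.

(** By the mean value theorem the difference quotient of [F M] is within
    [e / 2 + (gam z + 1) * tau M] of [G' z], for [h] in a neighbourhood independent of [M]. Letting
    [M] tend to infinity with [h] fixed transfers the estimate to [F']. *)
Lemma uniform_limit_derive (G : nat -> V -> R) (G' : V -> R) (gam : V -> R) v z :
  (forall z, D z -> {for z, continuous gam}) ->
  (forall z M, D z -> `|G' z - G M z| <= gam z * tau M) ->
  (forall M z, D z -> is_derive z v (F M) (G M z)) ->
  {for z, continuous G'} -> D z -> is_derive z v F' (G' z).
Proof.
move=> cgam GG' dF cG' Dz; apply/is_derive_quotP/cvgrPdist_lt => e e0.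
have e20 : 0 < e / 2 by rewrite divr_gt0.
have /cvgrPdist_lt /(_ _ ltr01) nb := cgam z Dz.
have /cvgrPdist_lt /(_ _ e20) nG := cG'.
have : \forall y \near z, [/\ D y, `|gam z - gam y| < 1 & `|G' z - G' y| < e / 2].
  near=> y; split; [|by near: y|by near: y].
  by near: y; exact: open_nbhs_nbhs.
move=> /nbhs_ballP[r /= r0 br].
have hv0 : \forall h \near (0 : R)^', `|0 - h *: v| < r.
  have : h *: v @[h --> (0 : R)^'] --> (0 : R) *: v.
    by apply: cvgZr_tmp; apply: cvg_within.
  by rewrite scale0r => /cvgrPdist_lt; apply.
near=> h.
have h0 : h != 0 by near: h; exact: nbhs_dnbhs_neq.
have bv (x : R) : 0 <= x <= 1 -> [/\ D (z + (x * h) *: v),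
   `|gam z - gam (z + (x * h) *: v)| < 1 & `|G' z - G' (z + (x * h) *: v)| < e / 2].
  move=> /andP[x0 x1]; apply: br; rewrite -ball_normE /= opprD addrA subrr.
  rewrite -scalerA sub0r normrN normrZ ger0_norm//.
  apply: (@le_lt_trans _ _ `|h *: v|).
    by rewrite -[leRHS]mul1r ler_pM.
  by rewrite -normrN -sub0r; near: h.
have Dzh : D (h *: v + z).
  by have [] := bv 1 _; rewrite ?mul1r 1?addrC// ler01 lexx.
have step M : `|G' z - h^-1 * (F M (h *: v + z) - F M z)| <= e / 2 + (gam z + 1) * tau M.
  have [y y01 ey] := @MVT_dir _ _ (F M) z v h
    (fun y y01 => let: And3 Dy _ _ := bv y y01 in @ex_derive _ _ _ _ _ _ _ (dF M _ Dy)).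
  have [Dy g1 g2] := bv y y01.
  rewrite [h *: v + z]addrC ey mulKf// (@derive_val _ _ _ _ _ _ _ (dF M _ Dy)).
  move: g1; rewrite ltr_norml => /andP[g1 _].
  have h1 := GG' _ M Dy.
  have h2 : gam (z + (y * h) *: v) * tau M <= (gam z + 1) * tau M.
    by rewrite ler_wpM2r//; lra.
  have := ler_distD (G' (z + (y * h) *: v)) (G' z) (G M (z + (y * h) *: v)).
  by lra.
apply: (@le_lt_trans _ _ (e / 2)); last by rewrite ltr_pdivrMr// ltr_pMr// ltr1n.
have c1 : `|G' z - h^-1 * (F M (h *: v + z) - F M z)| @[M --> \oo] -->
    `|G' z - h^-1 * (F' (h *: v + z) - F' z)|.
  apply: cvg_norm; apply: cvgB; first exact: cvg_cst.
  by apply: cvgM; [exact: cvg_cst|apply: cvgB; exact: uniform_limit_cvg].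
have c2 : e / 2 + (gam z + 1) * tau M @[M --> \oo] --> e / 2 + (gam z + 1) * 0.
  by apply: cvgD; [exact: cvg_cst|apply: cvgM; [exact: cvg_cst|]].
rewrite mulr0 addr0 in c2.
rewrite -(cvg_lim _ c1)// -(cvg_lim _ c2)//; apply: ler_lim.
- by apply/cvg_ex; eexists; exact: c1.
- by apply/cvg_ex; eexists; exact: c2.
- by exists 0%N => // M' _; exact: step.
Unshelve. all: by end_near. Qed.

End LocallyUniformLimits.

Section Inversion.
Variables (R : realType) (n : nat).
Local Notation V := ('rV[R]_n * 'rV[R]_n)%type.
Local Notation Re := (@complex.Re R).
Local Notation Im := (@complex.Im R).
Variable D : set V.
Hypothesis oD : open D.
Implicit Types (f g : V -> R[i]) (v w z e : V) (c : R[i]) (k : int).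
Implicit Types (es : seq V) (s : seq int).
Local Notation smooth := (@smooth_on R n D).

Definition tail (m M : nat) : R := limn (box_weight R m) - box_weight R m M.

Lemma tail_cvg m : tail m @ \oo --> (0 : R).
Proof.
rewrite -(subrr (limn (box_weight R m))); apply: cvgB; first exact: cvg_cst.
exact: box_weight_cvg.
Qed.

Lemma tail_ge0 m M : 0 <= tail m M.
Proof. exact: box_weight_tail. Qed.

Lemma box_sum_cvg m (G : seq int -> R[i]) (A : R) :
  (forall s, norm1c (G s) <= A * weight R m s) ->
  let u := fun M => \sum_(s <- box m M) G s in
  [/\ cvgn (Re \o u), cvgn (Im \o u) &
    forall M, norm1c (clim u - u M) <= 4 * A * tail m M].
Proof.
move=> GA u; have cb : cvgn (fun M => 2 * A * box_weight R m M).
  by apply: is_cvgM; [exact: is_cvg_cst|exact: box_weight_cvg].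
have [||c1 c2 H] := @clim_dominated _ u (fun M => 2 * A * box_weight R m M) => //.
  by move=> M M' MM'; rewrite -mulrBr -mulrA; exact: sum_box_diff.
split=> // M; apply: le_trans (H M) _.
have -> : limn (fun M => 2 * A * box_weight R m M) = 2 * A * limn (box_weight R m).
  apply: cvg_lim => //; apply: cvgM; [exact: cvg_cst|exact: box_weight_cvg].
by rewrite -mulrBr !mulrA -natrM.
Qed.

(** Induction on the directions. The box sum is compared with the partial sum over the first
    frequency alone: the inner sums approach [fmode e k f z] by induction, with an error
    proportional to [mode_weight k], hence summable over [k]. *)
Lemma modes_inversion es f z : stable D es -> lattice_smooth D es f -> D z ->
  let u := fun M => \sum_(s <- box (size es) M) modes es s f z in
  (Re \o u @ \oo --> Re (f z)) /\ (Im \o u @ \oo --> Im (f z)).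
Proof.
elim: es f => [|e es IHes] f st lf Dz /=.
  by split; apply: cvg_near_cst; near=> M; rewrite /= big_seq1.
have [se ses] := stable_cons st; have [pf [sf pfs]] := lattice_smooth_cons lf.
pose A := sup_avg (e :: es) f z.
have bA s : norm1c (modes (e :: es) s f z) <= weight R (size es).+1 s * A.
  exact: (modes_bound oD s st lf Dz).
have A0 : 0 <= A.
  have := le_trans (norm1c_ge0 _) (bA [::]); rewrite pmulr_rge0// -/(weight R (size es).+1 [::]).
  by elim: (size es).+1 => //= m; apply: mulr_gt0; rewrite /mode_weight /= expr0n addr0 divr1.
have lF k : lattice_smooth D es (fmode e k f).
  by split; [exact: fmode_smooth|move=> e' /pfs; exact: (fmode_periodic se)].
pose S M := \sum_(k <- freqs M) fmode e k f z.
pose u M := \sum_(s <- box (size es).+1 M) modes (e :: es) s f z.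
(* 80 is the bound 20 of [sum_mode_weight] times the 4 of [box_sum_cvg]. *)
have uS M : norm1c (u M - S M) <= 80 * A * tail (size es) M.
  rewrite /u sum_box /S -sumrB; apply: le_trans (norm1c_sum _ _) _.
  apply: (@le_trans _ _ (\sum_(k <- freqs M) mode_weight R k * (4 * A * tail (size es) M))).
    apply: ler_sum => k _.
    have [|_ _ H] := @box_sum_cvg (size es) (fun s => modes es s (fmode e k f) z) (mode_weight R k * A).
      by move=> s; have := bA (k :: s); rewrite /= => H; rewrite mulrAC.
    have [h1 h2] := IHes _ ses (lF k) Dz.
    have := H M; rewrite (clim_eq h1 h2) -norm1cN opprB => H'; apply: le_trans H' _.
    by rewrite le_eqVlt; apply/orP; left; apply/eqP; ring.
  rewrite -mulr_suml.
  have t0 := tail_ge0 (size es) M.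
  apply: (@le_trans _ _ (20 * (4 * A * tail (size es) M))); last first.
    by rewrite le_eqVlt; apply/orP; left; apply/eqP; ring.
  apply: ler_wpM2r; first by rewrite !mulr_ge0.
  by apply: le_trans (sum_mode_weight R M) _; rewrite lerBlDr lerDl divr_ge0.
have [SR SI] := fmode_sum_cvg oD se sf pf Dz.
have t0 : 80 * A * tail (size es) M @[M --> \oo] --> (0 : R).
  rewrite -(mulr0 (80 * A)); apply: cvgM; [exact: cvg_cst|exact: tail_cvg].
have [dR dI] : (Re \o (fun M => u M - S M) @ \oo --> Re 0) /\ (Im \o (fun M => u M - S M) @ \oo --> Im 0).
  by apply: (clim_norm t0) => M; rewrite subr0.
split.
  have -> : Re \o u = fun M => Re (u M - S M) + Re (S M).
    by apply/funext => M /=; rewrite -ReD subrK.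
  by rewrite -[Re (f z)]add0r; apply: cvgD.
have -> : Im \o u = fun M => Im (u M - S M) + Im (S M).
  by apply/funext => M /=; rewrite -ImD subrK.
by rewrite -[Im (f z)]add0r; apply: cvgD.
Unshelve. all: by end_near. Qed.

End Inversion.

Section Multiplier.
Variables (R : realType) (n : nat).
Local Notation V := ('rV[R]_n * 'rV[R]_n)%type.
Local Notation Re := (@complex.Re R).
Local Notation Im := (@complex.Im R).
Variable D : set V.
Hypothesis oD : open D.
Implicit Types (f g : V -> R[i]) (v w z e : V) (c : R[i]) (k : int) (s : seq int).
Local Notation smooth := (@smooth_on R n D).
Variable es : seq V.
Hypothesis st : stable D es.
Local Notation lsmooth := (lattice_smooth D es).

(** A multiplier of polynomial growth, expressed as a loss of derivatives. *)
Definition tame (a : seq int -> R[i]) := exists (Q : (V -> R[i]) -> V -> R[i]) (K : R),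
  0 <= K /\ forall f, lsmooth f -> lsmooth (Q f) /\
    forall s z, D z -> norm1c (a s * modes es s f z) <= K * norm1c (modes es s (Q f) z).

Definition multiplier (a : seq int -> R[i]) f z : R[i] :=
  clim (fun M => \sum_(s <- box (size es) M) a s * modes es s f z).

Variable a : seq int -> R[i].
Hypothesis ta : tame a.
Local Notation T := (multiplier a).
Let part f M z := \sum_(s <- box (size es) M) a s * modes es s f z.

Lemma multiplier_cvg f : lsmooth f -> exists2 beta : V -> R,
  (forall z, D z -> {for z, continuous beta}) &
  forall z, D z -> [/\ cvgn (Re \o part f ^~ z), cvgn (Im \o part f ^~ z) &
    forall M, norm1c (T f z - part f M z) <= beta z * tail R (size es) M].
Proof.
move=> lf; have [Q [K [K0 HQ]]] := ta; have [lQ bQ] := HQ _ lf.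
exists (fun z => 4 * (K * sup_avg es (Q f) z)).
  move=> z Dz; apply: cvgM; first exact: cvg_cst.
  by apply: cvgM; [exact: cvg_cst|apply: (sup_avg_cont oD st _ Dz); case: lQ].
move=> z Dz; apply: box_sum_cvg => s; apply: le_trans (bQ s z Dz) _.
by rewrite -mulrA ler_wpM2l// mulrC; exact: (modes_bound oD).
Qed.

Lemma part_smooth f M : lsmooth f -> smooth (part f M).
Proof.
move=> [sf _]; apply: smooth_on_sum => // s _; apply: smooth_onZ => //.
exact: modes_smooth.
Qed.

Lemma part_cderive f M v z : lsmooth f -> D z ->
  cderive v (part f M) z = part (cderive v f) M z.
Proof.
move=> [sf _] Dz; rewrite /part (cderive_sum oD) //; last first.
  by move=> s _; apply: smooth_onZ => //; exact: modes_smooth.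
apply: eq_bigr => s _; rewrite (cderiveZ oD) //; last exact: modes_smooth.
by rewrite (modes_cderive oD).
Qed.

Lemma Re_cderive v f z : Re (cderive v f z) = 'D_v (Re \o f) z.
Proof. by []. Qed.

Lemma Im_cderive v f z : Im (cderive v f z) = 'D_v (Im \o f) z.
Proof. by []. Qed.

Section RealCoordinates.
Variable pr : R[i] -> R.
Hypothesis prE : pr = Re \/ pr = Im.

Lemma coordinate_bound (x y : R[i]) (b : R) : norm1c (x - y) <= b -> `|pr x - pr y| <= b.
Proof.
apply: le_trans; rewrite /norm1c ReD ReN ImD ImN; case: prE => ->.
  by rewrite lerDl.
by rewrite lerDr.
Qed.

Lemma multiplier_cont f z : lsmooth f -> D z -> {for z, continuous (pr \o T f)}.
Proof.
move=> lf Dz; have [b cb Hb] := multiplier_cvg lf.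
apply: (@uniform_limit_cont _ _ D (fun M => pr \o part f M) _ b (tail R (size es))) => //.
- exact: tail_cvg.
- exact: tail_ge0.
- by move=> y M Dy; have [_ _ H] := Hb y Dy; exact: (coordinate_bound (H M)).
- by move=> M; have [] := smooth_on_cont (part_smooth M lf) Dz; case: prE => ->.
Qed.

(** Modes commute with derivatives and [cderive v f] is again smooth and periodic, so the
    differentiated series is itself a multiplier series and converges locally uniformly. *)
Lemma multiplier_is_derive f v z : lsmooth f -> D z ->
  is_derive z v (pr \o T f) (pr (T (cderive v f) z)).
Proof.
move=> lf Dz; have ldf := lattice_smooth_cderive oD v lf.
have [b cb Hb] := multiplier_cvg lf; have [b' cb' Hb'] := multiplier_cvg ldf.
have H1 y M : D y -> `|(pr \o T f) y - (pr \o part f M) y| <= b y * tail R (size es) M.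
  by move=> Dy; have [_ _ H] := Hb y Dy; exact: (coordinate_bound (H M)).
have H2 y M : D y -> `|(pr \o T (cderive v f)) y - (pr \o part (cderive v f) M) y|
    <= b' y * tail R (size es) M.
  by move=> Dy; have [_ _ H] := Hb' y Dy; exact: (coordinate_bound (H M)).
have H3 M y : D y -> is_derive y v (pr \o part f M) ((pr \o part (cderive v f) M) y).
  move=> Dy; have [d1 d2] := smooth_on_derivable v (part_smooth M lf) Dy.
  rewrite /= -(part_cderive M v lf Dy); case: prE => ->.
    by rewrite Re_cderive; exact: derivableP.
  by rewrite Im_cderive; exact: derivableP.
have := uniform_limit_derive oD (@tail_cvg R _) (@tail_ge0 R _) H1 cb' H2 H3.
by apply => //; exact: multiplier_cont.
Qed.

Lemma multiplier_Ck_on (k : nat) f : lsmooth f -> Ck_on k D (pr \o T f).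
Proof.
elim: k f => [|k IHk] f lf; first by split=> // z Dz; exact: multiplier_cont.
split=> [z Dz|v]; first exact: multiplier_cont.
split=> [z Dz|]; first exact: (@ex_derive _ _ _ _ _ _ _ (multiplier_is_derive v lf Dz)).
apply: (Ck_on_ext oD _ (IHk _ (lattice_smooth_cderive oD v lf))) => z Dz.
by rewrite (@derive_val _ _ _ _ _ _ _ (multiplier_is_derive v lf Dz)).
Qed.

End RealCoordinates.

Lemma multiplier_cderive f v z : lsmooth f -> D z ->
  cderive v (T f) z = T (cderive v f) z.
Proof.
move=> lf Dz.
have h1 := multiplier_is_derive (or_introl erefl) v lf Dz.
have h2 := multiplier_is_derive (or_intror erefl) v lf Dz.
by apply: complex_eqP; [exact: (@derive_val _ _ _ _ _ _ _ h1)|exact: (@derive_val _ _ _ _ _ _ _ h2)].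
Qed.

Lemma multiplier_smooth f : lsmooth f -> smooth (T f).
Proof.
move=> lf k; split; first exact: (multiplier_Ck_on (or_introl erefl) k lf).
exact: (multiplier_Ck_on (or_intror erefl) k lf).
Qed.

Lemma multiplier_ext f g z : (forall z, D z -> f z = g z) -> D z -> T f z = T g z.
Proof.
move=> fg Dz; congr clim; apply/funext => M; apply: eq_bigr => s _; congr (_ * _).
exact: (modes_ext s st fg Dz).
Qed.

Lemma multiplier_shift f w z : T (fun z => f (z + w)) z = T f (z + w).
Proof.
congr clim; apply/funext => M; apply: eq_bigr => s _; congr (_ * _).
exact: modes_shift.
Qed.

Lemma multiplier_periodic f w : periodic_on D f w -> periodic_on D (T f) w.
Proof. by move=> pf z Dz; rewrite -multiplier_shift; apply: multiplier_ext. Qed.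

Lemma clim_cst_add (u u' : nat -> R[i]) :
  cvgn (Re \o u) -> cvgn (Im \o u) -> cvgn (Re \o u') -> cvgn (Im \o u') ->
  clim (fun M => u M + u' M) = clim u + clim u'.
Proof.
move=> c1 c2 c3 c4; apply: clim_eq.
  by rewrite compReD ReD; apply: cvgD.
by rewrite compImD ImD; apply: cvgD.
Qed.

Lemma multiplierD f g z : lsmooth f -> lsmooth g -> D z ->
  T (fun z => f z + g z) z = T f z + T g z.
Proof.
move=> lf lg Dz; have [? _ /(_ _ Dz)[c1 c2 _]] := multiplier_cvg lf.
have [? _ /(_ _ Dz)[c3 c4 _]] := multiplier_cvg lg.
rewrite /multiplier -clim_cst_add//; congr clim; apply/funext => M.
rewrite -big_split; apply: eq_bigr => s _.
by rewrite (modesD oD s st lf.1 lg.1 Dz) mulrDr.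
Qed.

Lemma multiplierZ c f z : lsmooth f -> D z -> T (fun z => c * f z) z = c * T f z.
Proof.
move=> lf Dz; have [? _ /(_ _ Dz)[c1 c2 _]] := multiplier_cvg lf.
have E : (fun M => \sum_(s <- box (size es) M) a s * modes es s (fun z => c * f z) z)
    = (fun M => c * part f M z).
  apply/funext => M; rewrite mulr_sumr; apply: eq_bigr => s _.
  by rewrite (modesZ oD s c st lf.1 Dz) mulrCA.
rewrite /multiplier E; apply: clim_eq.
  have -> : Re \o (fun M => c * part f M z) =
      fun M => Re c * Re (part f M z) - Im c * Im (part f M z).
    by apply/funext => M /=; rewrite ReM.
  by rewrite ReM; apply: cvgB; apply: cvgM; [exact: cvg_cst|exact: c1|exact: cvg_cst|exact: c2].
have -> : Im \o (fun M => c * part f M z) =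
    fun M => Re c * Im (part f M z) + Im c * Re (part f M z).
  by apply/funext => M /=; rewrite ImM.
by rewrite ImM; apply: cvgD; apply: cvgM; [exact: cvg_cst|exact: c2|exact: cvg_cst|exact: c1].
Qed.

End Multiplier.

(** * Norms on the dual of a lattice of integers *)

Section Dedekind.
Variables (K L : fieldType) (I : eqType) (sigma : I -> {rmorphism K -> L}).
Hypothesis sigma_inj : forall i j, sigma i =1 sigma j -> i = j.

(** Dedekind's argument: subtracting [sigma i0 y] times the relation at [x] from the relation at
    [y * x] removes [i0] and multiplies [v j] by [sigma j y - sigma i0 y], which is nonzero for a
    suitable [y]. *)
Lemma embeddings_independent (r : seq I) (v : I -> L) : uniq r ->
  (forall x, \sum_(i <- r) v i * sigma i x = 0) -> forall i, i \in r -> v i = 0.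
Proof.
elim: r v => // i0 r IHr v /= /andP[i0r ur] vr.
have v0 j : j \in r -> v j = 0.
  move=> jr; have [y ny] : exists y, sigma j y != sigma i0 y.
    apply: contrapT => /forallNP H; move: i0r; rewrite (sigma_inj (i := i0) (j := j)) ?jr// => x.
    by apply/esym/eqP; have /negP := H x; rewrite negbK.
  have : v j * (sigma j y - sigma i0 y) = 0.
    apply: (IHr (fun i => v i * (sigma i y - sigma i0 y)) ur _ j jr) => x.
    have := vr (y * x); have := congr1 ( *%R (sigma i0 y)) (vr x).
    rewrite !big_cons mulr0 mulrDr mulr_sumr => e1 e2.
    rewrite (eq_bigr (fun i => v i * sigma i (y * x) - sigma i0 y * (v i * sigma i x))).
      rewrite sumrB; apply/eqP; rewrite subr_eq0; apply/eqP.
      apply: (@addrI _ (v i0 * sigma i0 (y * x))); transitivity (0 : L); first exact: e2.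
      by rewrite -[LHS]e1 rmorphM mulrCA.
    by move=> i _; rewrite rmorphM; ring.
  by move/eqP; rewrite mulf_eq0 subr_eq0 (negbTE ny) orbF => /eqP.
move=> i; rewrite inE => /predU1P[->|/v0//].
have := vr 1; rewrite big_cons rmorph1 mulr1 big_seq big1 ?addr0// => j /v0 ->.
by rewrite mul0r.
Qed.

End Dedekind.

Lemma common_denominator (I : finType) (F : I -> rat) :
  exists2 d : nat, (0 < d)%N & forall i, exists z : int, d%:R * F i = z%:~R.
Proof.
exists (\prod_i `|denq (F i)|)%N.
  by apply: prodn_gt0 => i; rewrite absz_gt0 denq_neq0.
move=> i; rewrite (bigD1 i) //= natrM.
exists ((\prod_(j | j != i) `|denq (F j)|)%N%:Z * numq (F i)).
rewrite rmorphM /= -pmulrn mulrAC mulrC; congr (_ * _).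
rewrite -{2}[F i]divq_num_den pmulrn abszE gtr0_norm ?denq_gt0//.
by rewrite mulrC divfK// intr_eq0 denq_neq0.
Qed.

Section Regular.
Variables (K : fieldExtType rat) (L : numFieldType).
Local Notation N := (\dim {:K}).
Local Notation b := (vbasis {:K}).

Definition regular_mx (x : K) : 'M[rat]_N := \matrix_(i, k) coord b k (x * b`_i).

Lemma regular_mxE (x : K) (i : 'I_N) : x * b`_i = \sum_k regular_mx x i k *: b`_k.
Proof.
rewrite {1}(coord_vbasis (memvf (x * b`_i))).
by apply: eq_bigr => k _; rewrite mxE.
Qed.

(** For a common denominator [d] of its matrix, multiplication by [d x] is given by an integer
    matrix, and [d x] is a root of the characteristic polynomial. *)
Lemma integral_multiple (x : K) : exists2 d : nat, (0 < d)%N & algebraic_integers (d%:R * x).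
Proof.
have [d d0 dz] := common_denominator (fun ij : 'I_N * 'I_N => regular_mx x ij.1 ij.2).
exists d => //.
have [A HA] : exists A : 'M[int]_N, forall i j, d%:R * regular_mx x i j = (A i j)%:~R.
  exists (\matrix_(i, j) projT1 (cid (dz (i, j)))) => i j.
  by rewrite mxE; case: cid.
exists (char_poly A^T); first exact: char_poly_monic.
rewrite map_char_poly /= -eigenvalue_root_char; apply/eigenvalueP.
(* The basis, read as a row with entries in [K], is an eigenvector with eigenvalue [d x]; it is
   nonzero because 1 is a combination of its entries. *)
exists (\row_i b`_i).
  apply/rowP => k; rewrite !mxE -mulrA regular_mxE mulr_sumr.
  apply: eq_bigr => j _; rewrite !mxE.
  have -> : (A k j)%:~R = (d%:R * regular_mx x k j)%:A :> K.
    by rewrite HA scaler_int.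
  by rewrite mulrC mulr_algl -scalerA scaler_nat mulr_natl mxE.
apply/eqP => /rowP H; have := oner_neq0 K; rewrite (coord_vbasis (memvf 1)) big1 ?eqxx// => i _.
by have := H i; rewrite !mxE => ->; rewrite scaler0.
Qed.

Variable sigma : 'I_N -> {rmorphism K -> L}.
Hypothesis sigma_inj : forall i j, sigma i =1 sigma j -> i = j.

Definition emb_mx : 'M[L]_N := \matrix_(i, j) sigma j b`_i.

(** A relation between the columns extends from the basis to all of [K] by rational linearity, and
    the embeddings are independent. *)
Lemma emb_mx_unit : emb_mx \in unitmx.
Proof.
rewrite -unitmx_tr -row_free_unit -kermx_eq0; apply/eqP/row_matrixP => i.
rewrite row0; set u := row i _.
have /rowP u0 : u *m emb_mx^T = 0 by apply/sub_kermxP; exact: row_sub.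
apply/rowP => j; rewrite [RHS]mxE; move: j.
suff H x : \sum_j u 0 j * sigma j x = 0.
  by move=> j; exact: (embeddings_independent sigma_inj (index_enum_uniq 'I_N) H (mem_index_enum j)). rewrite (coord_vbasis (memvf x)).
rewrite (eq_bigr (fun j => \sum_k ratr (coord b k x) * (u 0 j * sigma j b`_k))); last first.
  move=> l _; rewrite rmorph_sum mulr_sumr; apply: eq_bigr => k _.
  by rewrite rmorphZ_num mulrCA.
rewrite exchange_big big1 //= => k _; rewrite -mulr_sumr.
have := u0 k; rewrite !mxE => e; rewrite (eq_bigr (fun j => u 0 j * emb_mx^T j k)) ?e ?mulr0// => l _.
by rewrite !mxE.
Qed.

(** The embeddings diagonalise all multiplications simultaneously; norm and trace become product and
    sum of conjugates. *)
Lemma regular_emb x : map_mx ratr (regular_mx x) *m emb_mx =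
  emb_mx *m diag_mx (\row_j sigma j x).
Proof.
apply/matrixP => i j; rewrite mul_mx_diag !mxE -rmorphM mulrC regular_mxE rmorph_sum.
by apply: eq_bigr => k _; rewrite !mxE rmorphZ_num.
Qed.

Lemma det_regular x : ratr (\det (regular_mx x)) = \prod_j sigma j x.
Proof.
have := congr1 determinant (regular_emb x); rewrite !det_mulmx det_map_mx mulrC.
have d0 : \det emb_mx != 0 by rewrite -unitfE -unitmxE emb_mx_unit.
move/(mulfI d0) ->; rewrite det_diag; apply: eq_bigr => j _; by rewrite mxE.
Qed.

Lemma trace_regular x : ratr (\tr (regular_mx x)) = \sum_j sigma j x.
Proof.
rewrite -trace_map_mx.
have -> : map_mx ratr (regular_mx x) = emb_mx *m diag_mx (\row_j sigma j x) *m invmx emb_mx.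
  by rewrite -regular_emb mulmxK ?emb_mx_unit.
rewrite mxtrace_mulC mulmxA mulVmx ?emb_mx_unit// mul1mx mxtrace_diag.
by apply: eq_bigr => j _; rewrite mxE.
Qed.

Definition of_coords (u : 'cV[rat]_N) : K := \sum_i u i 0 *: b`_i.

Lemma regular_of_coords u : regular_mx (of_coords u) = \sum_k u k 0 *: regular_mx b`_k.
Proof.
apply/matrixP => i j; rewrite summxE !mxE /of_coords mulr_suml linear_sum.
by apply: eq_bigr => k _; rewrite !mxE -scalerAl linearZ.
Qed.

Definition trace_form : 'M[rat]_N := \matrix_(i, j) \tr (regular_mx (b`_i * b`_j)).

Lemma trace_formE : map_mx ratr trace_form = emb_mx *m emb_mx^T.
Proof.
apply/matrixP => i j; rewrite !mxE trace_regular; apply: eq_bigr => k _.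
by rewrite !mxE rmorphM.
Qed.

Lemma trace_form_unit : trace_form \in unitmx.
Proof. by rewrite -(map_unitmx (@ratr L)) trace_formE unitmx_mul unitmx_tr emb_mx_unit. Qed.

(** Since [trace_form] is [emb_mx *m emb_mx^T], the inverse of [emb_mx] is [emb_mx^T] times a
    rational matrix: its entries are the conjugates of the dual basis for the trace form. Applied to
    a rational vector it yields all conjugates of one element of [K], whose product is a norm. *)
Lemma emb_inv_mul (u : 'cV[rat]_N) (j : 'I_N) :
  (invmx emb_mx *m map_mx ratr u) j 0 = sigma j (of_coords (invmx trace_form *m u)).
Proof.
have -> : invmx emb_mx = emb_mx^T *m map_mx ratr (invmx trace_form).
  apply: (can_inj (mulKmx emb_mx_unit)); rewrite mulmxV ?emb_mx_unit// mulmxA -trace_formE.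
  by rewrite -map_mxM mulmxV ?trace_form_unit// map_mx1.
rewrite -mulmxA -map_mxM mxE /of_coords rmorph_sum; apply: eq_bigr => i _.
by rewrite rmorphZ_num !mxE mulrC.
Qed.

(** The product over all embeddings is the norm of a nonzero element of a
    fixed fractional ideal, hence a nonzero rational with bounded denominator. *)
Lemma emb_inv_norm : exists2 d : nat, (0 < d)%N & forall m : 'cV[int]_N, m != 0 ->
  exists2 k : int, k != 0 &
    d%:R * \prod_j (invmx emb_mx *m map_mx intr m) j 0 = k%:~R.
Proof.
pose B k := regular_mx (of_coords (invmx trace_form *m delta_mx k 0)).
have [d d0 dz] := common_denominator (fun t : 'I_N * 'I_N * 'I_N => B t.1.1 t.1.2 t.2).
have [A AE] : exists A : 'I_N -> 'M[int]_N, forall k i j, d%:R * B k i j = (A k i j)%:~R.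
  exists (fun k => \matrix_(i, j) projT1 (cid (dz (k, i, j)))) => k i j.
  by rewrite [in RHS]mxE; exact: (projT2 (cid (dz (k, i, j)))).
exists (d ^ N)%N; first by rewrite expn_gt0 d0.
move=> m m0; pose u : 'cV[rat]_N := map_mx intr m.
have uE : map_mx intr m = map_mx ratr u :> 'cV[L]_N.
  by apply/colP => i; rewrite !mxE ratr_int.
pose x := of_coords (invmx trace_form *m u).
have E : \prod_j (invmx emb_mx *m map_mx intr m) j 0 = ratr (\det (regular_mx x)).
  by rewrite det_regular; apply: eq_bigr => j _; rewrite uE emb_inv_mul.
have xE : d%:R *: regular_mx x = map_mx intr (\sum_k m k 0 *: A k).
  have -> : regular_mx x = \sum_k (m k 0)%:~R *: B k.
    rewrite /x regular_of_coords /B.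
    under [RHS]eq_bigr do rewrite regular_of_coords scaler_sumr.
    rewrite exchange_big; apply: eq_bigr => i _ /=.
    rewrite mxE scaler_suml; apply: eq_bigr => k _.
    rewrite !mxE scalerA (bigD1 k) //= big1 => [|l lk]; last first.
      by rewrite mxE (negbTE lk) mulr0.
    by rewrite mxE !eqxx mulr1 addr0 mulrC.
  apply/matrixP => i j; rewrite !mxE !summxE mulr_sumr rmorph_sum; apply: eq_bigr => k _.
  by rewrite [(_ *: B k) i j]mxE [(_ *: A k) i j]mxE mulrCA AE rmorphM.
have detE : (d ^ N)%N%:R * \prod_j (invmx emb_mx *m map_mx intr m) j 0 =
    (\det (\sum_k m k 0 *: A k))%:~R.
  rewrite E natrX -(rmorph_nat (@ratr L)) -rmorphXn -rmorphM -detZ xE det_map_mx.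
  exact: ratr_int.
exists (\det (\sum_k m k 0 *: A k)) => //.
(* A zero determinant makes some conjugate of [x] vanish, hence [x] itself, hence [m]. *)
apply: contra_neq m0 => det0.
have /eqP : \prod_j (invmx emb_mx *m map_mx intr m) j 0 = 0.
  by move/eqP: detE; rewrite det0 mulf_eq0 pnatr_eq0 expn_eq0 (gtn_eqF d0) /= => /eqP.
rewrite prodf_seq_eq0 => /hasP[j _ /= /eqP]; rewrite uE emb_inv_mul => /eqP.
rewrite fmorph_eq0 => /eqP x0.
have : invmx emb_mx *m map_mx ratr u = 0.
  by apply/colP => l; rewrite emb_inv_mul x0 rmorph0 mxE.
move/(congr1 (mulmx emb_mx)); rewrite mulKVmx ?emb_mx_unit// mulmx0 -uE => /colP H.
by apply/colP => l; have := H l; rewrite !mxE => /eqP; rewrite intr_eq0 => /eqP.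
Qed.

End Regular.

Lemma integral_natmul (K : fieldExtType rat) (d : nat) (x : K) :
  algebraic_integers x -> algebraic_integers (d%:R * x).
Proof. by move=> ix; apply: integral_mul => //; exact: integral_nat. Qed.

(** The [e i] form a rational basis of [K] consisting of integers; the lattice they span may be
    smaller than the full ring of integers. [P] inverts their matrix of conjugates, so the sums
    [\sum_i P j i * m i] are the conjugates of one element of the dual lattice. *)
Lemma integral_lattice (K : fieldExtType rat) (L : numFieldType) (n : nat)
    (sigma : 'I_n -> {rmorphism K -> L}) :
  \dim {:K} = n -> (forall i j, sigma i =1 sigma j -> i = j) ->
  exists (e : 'I_n -> K) (P : 'M[L]_n),
  [/\ forall i, algebraic_integers (e i),
      forall i j, \sum_k P i k * sigma j (e k) = (i == j)%:R &
      exists2 d : nat, (0 < d)%N & forall m : 'I_n -> int, (exists i, m i != 0) ->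
        exists2 k : int, k != 0 & d%:R * \prod_j \sum_i P j i * (m i)%:~R = k%:~R].
Proof.
move=> dimK; case: n / dimK sigma => sigma sigma_inj.
have [D D0 DP] : exists2 D : nat, (0 < D)%N &
    forall i : 'I_(\dim {:K}), algebraic_integers (D%:R * (vbasis {:K})`_i).
  exists (\prod_(i < \dim {:K}) s2val (cid2 (integral_multiple (vbasis {:K})`_i)))%N.
    by apply: prodn_gt0 => i; case: cid2.
  move=> i; rewrite (bigD1 i) //= mulnC natrM -mulrA; apply: integral_natmul.
  by case: cid2.
have Dn0 : D%:R != 0 :> L by rewrite pnatr_eq0 -lt0n.
exists (fun i => D%:R * (vbasis {:K})`_i), (D%:R^-1 *: invmx (emb_mx sigma)); split=> //.
  move=> i j; have /matrixP/(_ i j) := mulVmx (emb_mx_unit sigma_inj); rewrite !mxE => <-.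
  apply: eq_bigr => k _; rewrite !mxE rmorphM rmorph_nat mulrCA mulrA; congr (_ * _).
  by rewrite mulrA divff// mul1r.
have [d d0 Hd] := emb_inv_norm sigma_inj.
exists (d * D ^ (\dim {:K}))%N; first by rewrite muln_gt0 d0 expn_gt0 D0.
move=> m [i0 mi0]; have [|k k0 Hk] := Hd (\col_i m i).
  by apply: contra_neq mi0 => /colP/(_ i0); rewrite !mxE.
exists k => //; rewrite -Hk natrM -mulrA; congr (_ * _).
rewrite natrX -[X in _ ^+ X]card_ord -prodr_const -big_split; apply: eq_bigr => j _ /=.
rewrite mulr_sumr mxE; apply: eq_bigr => i _; rewrite !mxE.
by rewrite !mulrA divff// mul1r.
Qed.

(** * Solving along the fibres *)

Section Cover.
Variables (R : realType) (s t : nat) (K : fieldExtType rat).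
Variable sigma : 'I_(s + t + t) -> {rmorphism K -> R[i]}.
Hypothesis sigmaP : OT_embeddings sigma.
Local Notation n := (s + t)%N.
Local Notation V := ('rV[R]_n * 'rV[R]_n)%type.
Local Notation Re := (@complex.Re R).
Local Notation Im := (@complex.Im R).
Local Notation D := (@OT_cover R s t).
Implicit Types (f g : V -> R[i]) (v w z : V) (b : K).

Lemma OT_cover_open : open D.
Proof.
rewrite openE => z Dz; rewrite /interior /=.
apply: (@filter_forall _ _ (fun (i : 'I_s) (y : V) => 0 < y.2 0 (lshift t i)) (nbhs z)) => i.
have c : {for z, continuous (fun y : V => y.2 0 (lshift t i))}.
  exact: (cvg_comp snd (fun x : 'rV[R]_n => x 0 (lshift t i)) cvg_snd (@coord_continuous _ _ _ 0 _ z.2)).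
have := Dz i => /= z0; move/cvgrPdist_lt : c => /(_ _ z0); apply: filterS => y.
by rewrite ltr_norml => /andP[]; lra.
Qed.

(** Tangency to the fibres of [z |-> (Im w_1, ..., Im w_s)]. *)
Definition fibre_dir v := forall i : 'I_s, v.2 0 (lshift t i) = 0.

Lemma OT_cover_fibre v (x : R) z : fibre_dir v -> D z -> D (z + x *: v).
Proof. by move=> v0 Dz i; have := Dz i; rewrite /= !mxE v0 mulr0 addr0. Qed.

Definition tvec b : V := of_zeta (fun j => sig_coord sigma j b).

Lemma tvec_fibre b : fibre_dir (tvec b).
Proof. by move=> i; rewrite mxE; exact: (OT_real sigmaP). Qed.

Lemma OT_act_translation b z : OT_act sigma 1 b z = z + tvec b.
Proof.
by case: z => z1 z2; congr pair; apply/rowP => j; rewrite !mxE rmorph1 mul1r /zeta /=;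
  case: (sig_coord sigma j b).
Qed.

(** The components of a tangent vector along [d/dz_j], the last block being
    the conjugates. *)
Definition emb_comp v (J : 'I_(s + t + t)) : R[i] :=
  match fintype.split J with
  | inl j => zeta v j
  | inr k => (zeta v (rshift s k))^*
  end.

(** The derivations dual to [emb_comp] on fibre directions: [d/dx] at a real coordinate, whose [y]
    direction leaves the fibre, and the pair [d/dz_k], [d/dzbar_k] at a complex one. *)
Definition emb_deriv (J : 'I_(s + t + t)) f z : R[i] :=
  match fintype.split J with
  | inl j => match fintype.split j with
             | inl i => cderive (dir_x R (lshift t i)) f z
             | inr k => 2^-1 * (cderive (dir_x R (rshift s k)) f z
                                - 'i * cderive (dir_y R (rshift s k)) f z)
             end
  | inr k => d_zetabar (rshift s k) f z
  end.

Lemma emb_comp_tvec b J : emb_comp (tvec b) J = sigma J b.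
Proof.
rewrite -[in RHS](splitK J) /emb_comp; case: fintype.split => [j|k] /=.
  by rewrite /zeta !mxE; case: (sig_coord sigma j b).
rewrite /zeta !mxE -[sigma _]/(sig_conj sigma k).
have := OT_conjugate sigmaP k b; rewrite /sig_coord -/(sig_cplx sigma k) => ->.
by case: (sig_conj sigma k b) => x y; rewrite /= opprK.
Qed.

Lemma cderive_emb v f z : smooth_on D f -> fibre_dir v -> D z ->
  cderive v f z = \sum_J emb_comp v J * emb_deriv J f z.
Proof.
move=> sf v0 Dz; rewrite (cderive_coord OT_cover_open v sf Dz).
pose F a : R[i] := match a with
  | inl j => (v.1 0 j)%:C * cderive (dir_x R j) f z
  | inr j => (v.2 0 j)%:C * cderive (dir_y R j) f z end.
rewrite (eq_bigr (fun i => F (fintype.split i))); last first.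
  by move=> i _; rewrite /coord_xy /dir_xy /F; case: fintype.split.
rewrite sum_xy /F -big_split /= big_split_ord /= [RHS]big_split_ord /= [X in _ = X + _]big_split_ord /=.
rewrite -addrA -big_split /=; congr (_ + _); apply: eq_bigr => i _.
  rewrite /emb_comp /emb_deriv (unsplitK (inl _)) (unsplitK (inl _)).
  rewrite v0 mul0r addr0; congr (_ * _); apply: complex_eqP => //=.
rewrite /emb_comp /emb_deriv (unsplitK (inl _)) (unsplitK (inr _)) (unsplitK (inr _)).
rewrite /d_zetabar /zeta.
move: (cderive _ f z) (cderive _ f z) (v.1 _ _) (v.2 _ _) => c a x y.
have -> : x +i* y = x%:C + 'i * y%:C by apply: complex_eqP; rewrite ?ReD ?ImD ?ReM ?ImM /=; ring.
have -> : (x%:C + 'i * y%:C)^* = x%:C - 'i * y%:C.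
  by apply: complex_eqP; rewrite /= ?ReD ?ImD ?ReN ?ImN ?ReM ?ImM /=; ring.
have i2 : 'i * 'i = -1 :> R[i] by rewrite -expr2 sqr_i.
have E : x%:C * a + y%:C * c = 2^-1 * (2 * (x%:C * a) - ('i * 'i) * (2 * (y%:C * c))).
  rewrite i2 mulN1r opprK -mulrDr mulKf ?pnatr_eq0//.
rewrite E; move: (2^-1) ('i : R[i]) (x%:C) (y%:C) => h I X Y; ring.
Qed.

(** This inverts [cderive_emb] on the period vectors, whose components are the conjugates of the
    [e i]. Derivatives along periods act diagonally on Fourier modes, hence so does
    [emb_deriv J]. *)
Lemma emb_derivE (P : 'M[R[i]]_(s + t + t)) (e : 'I_(s + t + t) -> K) J f z :
  (forall i j, \sum_k P i k * sigma j (e k) = (i == j)%:R) ->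
  smooth_on D f -> D z ->
  emb_deriv J f z = \sum_i P J i * cderive (tvec (e i)) f z.
Proof.
move=> PE sf Dz.
under [RHS]eq_bigr => i _ do rewrite (cderive_emb sf (tvec_fibre _) Dz) mulr_sumr.
rewrite exchange_big /=.
under [RHS]eq_bigr => J' _ do under eq_bigr => i _ do rewrite emb_comp_tvec mulrA.
under [RHS]eq_bigr => J' _ do rewrite -mulr_suml PE.
by rewrite (bigD1 J) //= eqxx mul1r big1 ?addr0// => J' /negbTE JJ'; rewrite eq_sym JJ' mul0r.
Qed.

Definition OK_smooth f := smooth_on D f /\
  forall b, algebraic_integers b -> periodic_on D f (tvec b).

Lemma OK_smooth_cderive v f : OK_smooth f -> OK_smooth (cderive v f).
Proof.
move=> [sf pf]; split; first exact: smooth_cderive.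
by move=> b /pf; exact: (cderive_periodic OT_cover_open).
Qed.

End Cover.

Section Inverse.
Variables (R : realType) (s t : nat) (K : fieldExtType rat).
Variable sigma : 'I_(s + t + t) -> {rmorphism K -> R[i]}.
Hypothesis sigmaP : OT_embeddings sigma.
Local Notation n := (s + t)%N.
Local Notation N := (s + t + t)%N.
Local Notation V := ('rV[R]_n * 'rV[R]_n)%type.
Local Notation D := (@OT_cover R s t).
Local Notation oD := (@OT_cover_open R s t).
Implicit Types (f g : V -> R[i]) (v w z : V) (b : K) (m : seq int).
Variables (e : 'I_N -> K) (P : 'M[R[i]]_N) (d : nat).
Hypotheses (ie : forall i, algebraic_integers (e i))
  (PE : forall i j, \sum_k P i k * sigma j (e k) = (i == j)%:R)
  (d_gt0 : (0 < d)%N)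
  (dP : forall m : 'I_N -> int, (exists i, m i != 0) ->
     exists2 k : int, k != 0 & d%:R * \prod_j \sum_i P j i * (m i)%:~R = k%:~R).
Let es : seq V := [seq tvec sigma (e i) | i <- enum 'I_N].

Lemma size_es : size es = N.
Proof. by rewrite size_map size_enum_ord. Qed.

Lemma nth_es (i : 'I_N) : nth 0 es i = tvec sigma (e i).
Proof. by rewrite (nth_map i) ?size_enum_ord// nth_ord_enum. Qed.

Lemma stable_es : stable D es.
Proof.
move=> _ /mapP[i _ ->] x z Dz; apply: OT_cover_fibre => //; exact: tvec_fibre.
Qed.

Lemma OK_lattice f : OK_smooth sigma f -> lattice_smooth D es f.
Proof. by move=> [sf pf]; split=> // _ /mapP[i _ ->]; exact: pf. Qed.

(** The Fourier symbol of [emb_deriv J]: [2 pi i] times the conjugate under [sigma J] of the dual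
    lattice element with coordinates [m]. *)
Definition mult J m : R[i] := \sum_i P J i * (0 +i* freq R (nth 0 m i)).

Lemma smooth_emb_deriv J f : smooth_on D f -> smooth_on D (emb_deriv J f).
Proof.
move=> sf; apply: (smooth_on_ext oD (f := fun z => \sum_i P J i * cderive (tvec sigma (e i)) f z)).
  by move=> z Dz; rewrite -(emb_derivE sigmaP J PE sf Dz).
apply: smooth_on_sum oD _ _ _ _ _ => i _; apply: smooth_onZ oD _ _ _; exact: smooth_cderive.
Qed.

Lemma emb_deriv_periodic J f v : periodic_on D f v -> periodic_on D (emb_deriv J f) v.
Proof.
move=> pf z Dz; rewrite /emb_deriv /d_zetabar.
case: fintype.split => [j|k]; first case: fintype.split => [i|k].
all: by rewrite !(cderive_periodic oD _ pf Dz).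
Qed.

Lemma emb_deriv_lattice J f : lattice_smooth D es f -> lattice_smooth D es (emb_deriv J f).
Proof.
move=> [sf pf]; split; first exact: smooth_emb_deriv.
by move=> v /pf; exact: emb_deriv_periodic.
Qed.

Lemma modes_emb_deriv J m f z : lattice_smooth D es f -> D z ->
  modes es m (emb_deriv J f) z = mult J m * modes es m f z.
Proof.
move=> lf Dz; have [sf pf] := lf.
transitivity (modes es m (fun z => \sum_i P J i * cderive (tvec sigma (e i)) f z) z).
  by apply: (modes_ext m stable_es _ Dz) => y Dy; exact: emb_derivE.
rewrite (modes_sum oD) //; [|exact: stable_es|by move=> i; apply: (smooth_onZ oD); exact: smooth_cderive].
rewrite /mult mulr_suml; apply: eq_bigr => i _.
rewrite (modesZ oD) //; [|exact: stable_es|exact: smooth_cderive].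
by rewrite -nth_es (modes_dir oD) ?mulrA// ?size_es//; exact: stable_es.
Qed.

Lemma modes_fibre v m f z : lattice_smooth D es f -> fibre_dir v -> D z ->
  modes es m (cderive v f) z = (\sum_J emb_comp v J * mult J m) * modes es m f z.
Proof.
move=> lf v0 Dz; have [sf pf] := lf.
transitivity (modes es m (fun z => \sum_J emb_comp v J * emb_deriv J f z) z).
  by apply: (modes_ext m stable_es _ Dz) => y Dy; exact: cderive_emb.
rewrite (modes_sum oD) //; [|exact: stable_es|by move=> i; apply: (smooth_onZ oD); exact: smooth_emb_deriv].
rewrite mulr_suml; apply: eq_bigr => i _.
rewrite (modesZ oD) //; [|exact: stable_es|exact: smooth_emb_deriv].
by rewrite modes_emb_deriv ?mulrA.
Qed.

Lemma multE J m : mult J m = (0 +i* (pi *+ 2)) * \sum_i P J i * (nth 0 m i)%:~R.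
Proof.
rewrite /mult mulr_sumr; apply: eq_bigr => i _; rewrite mulrCA; congr (_ * _).
rewrite /freq -(rmorph_int (real_complex R)); by apply: complex_eqP; rewrite ?ReM ?ImM /=; ring.
Qed.

Lemma mult0 J m : (forall i : 'I_N, nth 0 m i = 0) -> mult J m = 0.
Proof. by move=> m0; rewrite multE big1 ?mulr0// => i _; rewrite m0 mulr0. Qed.

Lemma prod_mult m : (exists i : 'I_N, nth 0 m i != 0) ->
  exists2 k : int, k != 0 & d%:R * \prod_J mult J m = (0 +i* (pi *+ 2)) ^+ N * k%:~R.
Proof.
move=> /dP[k k0 kE]; exists k => //; rewrite -kE mulrCA; congr (_ * _).
rewrite (eq_bigr _ (fun J _ => multE J m)) big_split /= prodr_const card_ord.
by [].
Qed.

Lemma two_pi_i_neq0 : 0 +i* (pi *+ 2) != 0 :> R[i].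
Proof. by rewrite eq_complex /= eqxx /= mulrn_eq0 /= gt_eqF ?pi_gt0. Qed.

Lemma mult_neq0 J m : (exists i : 'I_N, nth 0 m i != 0) -> mult J m != 0.
Proof.
move=> /prod_mult[k k0 kE]; apply/eqP => J0; move/eqP: kE; rewrite (bigD1 J) //= J0 mul0r mulr0.
by rewrite eq_sym mulf_eq0 expf_eq0 (negbTE two_pi_i_neq0) andbF intr_eq0 (negbTE k0).
Qed.

(* Symmetry of second derivatives is read off the Fourier modes. *)
Lemma emb_deriv_cderive J v f z : OK_smooth sigma f -> D z ->
  emb_deriv J (cderive v f) z = cderive v (emb_deriv J f) z.
Proof.
move=> /OK_lattice lf Dz; have [sf _] := lf.
have l1 := emb_deriv_lattice J (lattice_smooth_cderive oD v lf).
have l2 := lattice_smooth_cderive oD v (emb_deriv_lattice J lf).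
have [/clim_eq h1 /h1 <-] := modes_inversion oD stable_es l1 Dz.
have [/clim_eq h2 /h2 <-] := modes_inversion oD stable_es l2 Dz.
congr clim; apply/funext => M; apply: eq_bigr => m _.
rewrite modes_emb_deriv//; last exact: (lattice_smooth_cderive oD).
rewrite -!(modes_cderive oD) //; [|exact: stable_es|exact: smooth_emb_deriv|exact: stable_es].
rewrite -(cderiveZ oD) //; last by apply: (modes_smooth oD) => //; exact: stable_es.
by apply: (cderive_ext oD) => // y Dy; rewrite modes_emb_deriv.
Qed.

Variable k0 : 'I_t.
Let J0 : 'I_N := rshift (s + t) k0.
Let nonzero m := [exists i : 'I_N, nth 0 m i != 0].
(** At the zero frequency, where the symbol vanishes, the value is 0: the multiplier kills the zero
    mode and inverts [emb_deriv J0] on the others. *)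
Let a m : R[i] := if nonzero m then (mult J0 m)^-1 else 0.

Definition emb_derivs (r : seq 'I_N) f := foldr (fun J g => emb_deriv J g) f r.

Lemma emb_derivs_lattice r f : lattice_smooth D es f -> lattice_smooth D es (emb_derivs r f).
Proof. by move=> lf; elim: r => //= J r IHr; exact: emb_deriv_lattice. Qed.

Lemma modes_emb_derivs r m f z : lattice_smooth D es f -> D z ->
  modes es m (emb_derivs r f) z = (\prod_(J <- r) mult J m) * modes es m f z.
Proof.
move=> lf Dz; elim: r => [|J r IHr]; first by rewrite big_nil mul1r.
by rewrite big_cons /= modes_emb_deriv ?IHr ?mulrA//; exact: emb_derivs_lattice.
Qed.

Lemma norm1c_inv_int (k : int) : k != 0 -> norm1c ((k%:~R)^-1 : R[i]) <= 1.
Proof.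
move=> nk; rewrite -(rmorph_int (real_complex R)) -fmorphV /norm1c /= normr0 addr0.
rewrite normfV invf_le1 ?normr_gt0 ?intr_eq0//.
by rewrite -intr_norm -[1]/(1%:~R) ler_int -gtz0_ge1 normr_gt0.
Qed.

(* The inverse of [mult J0 m] is the product of the other [mult J m] divided by an
   element bounded away from [0], so it costs finitely many derivatives. *)
Lemma tame_inverse : tame D es a.
Proof.
(* From [d * \prod_J mult J m = (2 pi i)^N * k] with a nonzero integer [k], the inverse of one
   factor is [c / k] times the product of the others, and [1 / k] has modulus at most 1. *)
pose c : R[i] := d%:R / (0 +i* (pi *+ 2)) ^+ N.
exists (emb_derivs [seq J <- enum 'I_N | J != J0]), (norm1c c); split; first exact: norm1c_ge0.
move=> f lf; split=> [|m z Dz]; first exact: emb_derivs_lattice.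
rewrite /a; case: ifPn => [/existsP nz|_]; last first.
  by rewrite mul0r {1}/norm1c /= normr0 addr0 mulr_ge0 ?norm1c_ge0.
have [k nk kE] := prod_mult nz.
have tp : (0 +i* (pi *+ 2)) ^+ N != 0 :> R[i] by rewrite expf_neq0 ?two_pi_i_neq0.
have dn : d%:R != 0 :> R[i] by rewrite pnatr_eq0 -lt0n.
have kn : k%:~R != 0 :> R[i] by rewrite intr_eq0.
rewrite modes_emb_derivs// big_filter big_enum_cond /=.
have := mult_neq0 J0 nz; move: kE; rewrite (bigD1 J0) //=.
move: (mult J0 m) (\prod_(J | J != J0) _) => x y kE xn.
have -> : x^-1 = c * (k%:~R^-1 * y).
  apply: (mulfI xn); rewrite mulfV// /c; move: kE tp dn kn.
  move: (_ ^+ N) (k%:~R) (d%:R) => p q d' kE pn dn kn.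
  apply: (mulfI pn); apply: (mulfI kn); transitivity (p * q); first by ring.
  by rewrite -kE; field; rewrite pn kn.
rewrite -[c * _ * _]mulrA -[_ * y * _]mulrA; apply: le_trans (norm1cM _ _) _; apply: ler_wpM2l; first exact: norm1c_ge0.
apply: le_trans (norm1cM _ _) _; rewrite -[leRHS]mul1r ler_wpM2r ?norm1c_ge0//.
exact: norm1c_inv_int.
Qed.

(** A derivative along the fibre acts on each mode by a combination of symbols, so it has no zero
    mode, and on such functions the multiplier is a true inverse. *)
Lemma multiplier_inverse f v z : OK_smooth sigma f -> fibre_dir v -> D z ->
  multiplier es a (d_zetabar (rshift s k0) (cderive v f)) z = cderive v f z.
Proof.
move=> /OK_lattice lf v0 Dz.
have lg := lattice_smooth_cderive oD v lf.
have [c1 c2] := modes_inversion oD stable_es lg Dz.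
transitivity (clim (fun M => \sum_(m <- box (size es) M) modes es m (cderive v f) z)).
  congr clim; apply/funext => M; apply: eq_bigr => m _.
  have -> : d_zetabar (rshift s k0) (cderive v f) = emb_deriv J0 (cderive v f).
    by rewrite /emb_deriv /J0 (unsplitK (inr _)).
  rewrite modes_emb_deriv// mulrA /a; case: ifPn => [/existsP nz|].
    by rewrite mulVf ?mul1r ?mult_neq0.
  move=> /existsPn m0; rewrite modes_fibre// !mul0r big1 ?mul0r// => J _.
  by rewrite mult0 ?mulr0// => i; apply/eqP; have := m0 i; rewrite negbK.
exact: clim_eq.
Qed.

End Inverse.

Section PrimitiveOperator.
Variables (R : realType) (s t : nat) (K : fieldExtType rat).
Variable sigma : 'I_(s + t + t) -> {rmorphism K -> R[i]}.
Local Notation n := (s + t)%N.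
Local Notation V := ('rV[R]_n * 'rV[R]_n)%type.
Local Notation D := (@OT_cover R s t).
Local Notation oD := (@OT_cover_open R s t).
Local Notation OK := (@OK_smooth R s t K sigma).

(** [T] inverts [P] on the Fourier modes that are not constant along the fibres. *)
Record fibre_inverse (P : (V -> R[i]) -> V -> R[i]) (T : (V -> R[i]) -> V -> R[i]) := {
  finv_OK : forall f, OK f -> OK (T f);
  finv_cderive : forall v f z, OK f -> D z -> cderive v (T f) z = T (cderive v f) z;
  finv_ext : forall f g z, (forall z, D z -> f z = g z) -> D z -> T f z = T g z;
  finvD : forall f g z, OK f -> OK g -> D z -> T (fun z => f z + g z) z = T f z + T g z;
  finvZ : forall c f z, OK f -> D z -> T (fun z => c * f z) z = c * T f z;
  finv_fibre : forall f v z, OK f -> fibre_dir v -> D z -> T (P (cderive v f)) z = cderive v f z;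
  finv_comm : forall f v z, OK f -> D z -> P (cderive v f) z = cderive v (P f) z
}.

Lemma exists_fibre_inverse (k : 'I_t) : OT_embeddings sigma ->
  exists T, fibre_inverse (@d_zetabar R n (rshift s k)) T.
Proof.
move=> sigmaP; have [e [P [ie PE [d d0 dP]]]] := integral_lattice (OT_degree sigmaP) (OT_distinct sigmaP).
have st := @stable_es _ _ _ _ _ sigmaP e; have ta := tame_inverse sigmaP PE d0 dP k.
have ol f (H : OK f) := OK_lattice ie H.
eexists; split.
- move=> f fOK; split; first exact: (multiplier_smooth oD st ta (ol _ fOK)).
  by case: fOK => _ pf b /pf; exact: multiplier_periodic.
- by move=> v f z fOK Dz; exact: (multiplier_cderive oD st ta v (ol _ fOK) Dz).
- by move=> f g z; exact: multiplier_ext.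
- by move=> f g z fOK gOK Dz; exact: (multiplierD oD st ta (ol _ fOK) (ol _ gOK) Dz).
- by move=> c f z fOK Dz; exact: (multiplierZ oD st ta c (ol _ fOK) Dz).
- by move=> f v z fOK v0 Dz; exact: (multiplier_inverse sigmaP ie PE dP).
- move=> f v z fOK Dz; have := emb_deriv_cderive sigmaP ie PE (rshift n k) v fOK Dz.
  by rewrite /emb_deriv (unsplitK (inr _)).
Qed.

End PrimitiveOperator.

Section Zetabar.
Variables (R : realType) (n : nat).
Local Notation V := ('rV[R]_n * 'rV[R]_n)%type.
Variable D : set V.
Hypothesis oD : open D.
Local Notation smooth := (@smooth_on R n D).
Implicit Types (f g : V -> R[i]) (v z : V) (j : 'I_n).

Lemma d_zetabar_ext j f g z : (forall z, D z -> f z = g z) -> D z ->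
  d_zetabar j f z = d_zetabar j g z.
Proof. by move=> fg Dz; rewrite /d_zetabar !(cderive_ext oD _ fg Dz). Qed.

Lemma d_zetabarD j f g z : smooth f -> smooth g -> D z ->
  d_zetabar j (fun z => f z + g z) z = d_zetabar j f z + d_zetabar j g z.
Proof.
move=> sf sg Dz; have E v := cderiveD v sf sg Dz; rewrite /d_zetabar !E;
  move: (cderive _ f z) (cderive _ f z) (cderive _ g z) (cderive _ g z) => a b c d; ring.
Qed.

Lemma d_zetabarZ j c f z : smooth f -> D z ->
  d_zetabar j (fun z => c * f z) z = c * d_zetabar j f z.
Proof. by move=> sf Dz; have E v := cderiveZ oD v c sf Dz; rewrite /d_zetabar !E;
  move: (cderive _ f z) (cderive _ f z) => a b; ring. Qed.

Lemma d_zetabarM j f g z : smooth f -> smooth g -> D z ->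
  d_zetabar j (fun z => f z * g z) z = d_zetabar j f z * g z + f z * d_zetabar j g z.
Proof.
by move=> sf sg Dz; have E v := cderiveM v sf sg Dz; rewrite /d_zetabar !E;
  move: (cderive _ f z) (cderive _ f z) (cderive _ g z) (cderive _ g z) => a b c d; ring.
Qed.

Lemma d_zetabarB j f g z : smooth f -> smooth g -> D z ->
  d_zetabar j (fun z => f z - g z) z = d_zetabar j f z - d_zetabar j g z.
Proof.
move=> sf sg Dz.
transitivity (d_zetabar j (fun z => f z + (-1) * g z) z).
  by apply: d_zetabar_ext => // y _; rewrite mulN1r.
by rewrite (d_zetabarD _ sf (smooth_onZ oD _ sg) Dz) (d_zetabarZ _ _ sg Dz) mulN1r.
Qed.

Lemma d_zetabar_cst j c z : d_zetabar j (fun=> c) z = 0.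
Proof. by rewrite /d_zetabar !cderive_cst mulr0 addr0 mulr0. Qed.

Lemma d_zetabar_sum j I (s : seq I) (P : pred I) (F : I -> V -> R[i]) z :
  (forall i, P i -> smooth (F i)) -> D z ->
  d_zetabar j (fun z => \sum_(i <- s | P i) F i z) z = \sum_(i <- s | P i) d_zetabar j (F i) z.
Proof.
move=> sF Dz; rewrite /d_zetabar !(cderive_sum oD _ _ sF Dz).
by rewrite [in LHS]mulr_sumr -big_split mulr_sumr.
Qed.

Lemma cderiveB v f g z : smooth f -> smooth g -> D z ->
  cderive v (fun z => f z - g z) z = cderive v f z - cderive v g z.
Proof.
move=> sf sg Dz; rewrite -mulN1r -(cderiveZ oD _ _ sg Dz) -(cderiveD (D := D)) //; last exact: smooth_onZ.
by apply: (cderive_ext oD) => // y _; rewrite mulN1r.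
Qed.

Lemma smooth_onB f g : smooth f -> smooth g -> smooth (fun z => f z - g z).
Proof.
move=> sf sg; apply: (smooth_on_ext oD (f := fun z => f z + (-1) * g z)).
  by move=> z _; rewrite mulN1r.
by apply: smooth_onD => //; exact: smooth_onZ.
Qed.

End Zetabar.

Section Reduction.
Variables (R : realType) (s t : nat) (K : fieldExtType rat).
Variable sigma : 'I_(s + t + t) -> {rmorphism K -> R[i]}.
Local Notation n := (s + t)%N.
Local Notation V := ('rV[R]_n * 'rV[R]_n)%type.
Local Notation Re := (@complex.Re R).
Local Notation Im := (@complex.Im R).
Local Notation D := (@OT_cover R s t).
Local Notation oD := (@OT_cover_open R s t).
Local Notation OK := (@OK_smooth R s t K sigma).
Implicit Types (f g F : V -> R[i]) (v z : V).

Definition fibre_const F := forall v z, fibre_dir v -> D z -> F (z + v) = F z.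

Lemma fibre_constP F : smooth_on D F ->
  (forall v z, fibre_dir v -> D z -> cderive v F z = 0) -> fibre_const F.
Proof.
move=> sF F0 v z v0 Dz.
have Dx (x : R) : D (z + (x * 1) *: v) by exact: OT_cover_fibre.
have d x := smooth_on_derivable v sF (Dx x).
have E x := F0 v _ v0 (Dx x).
rewrite -[v]scale1r; apply: complex_eqP; apply/eqP; rewrite -subr_eq0.
  have [x _ ->] := @MVT_dir _ _ (Re \o F) z v 1 (fun x _ => (d x).1).
  by rewrite -Re_cderive E mulr0.
have [x _ ->] := @MVT_dir _ _ (Im \o F) z v 1 (fun x _ => (d x).2).
by rewrite -Im_cderive E mulr0.
Qed.

Lemma cderive_indep v F z : (forall x : R, F (x *: v + z) = F z) -> cderive v F z = 0.
Proof.
move=> FE.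
have H (h : V -> R) : (forall x : R, h (x *: v + z) = h z) -> 'D_v h z = 0.
  move=> hE; rewrite /derive (_ : (fun _ => _) = cst 0) ?lim_cst//.
  by apply/funext => x /=; rewrite hE subrr scaler0.
by apply: complex_eqP; [rewrite Re_cderive H//= => x|rewrite Im_cderive H//= => x]; rewrite FE.
Qed.

Lemma fibre_const_cderive F v z : fibre_const F -> fibre_dir v -> D z -> cderive v F z = 0.
Proof.
move=> cF v0 Dz; apply: cderive_indep => x; rewrite addrC cF// => i.
by rewrite /= mxE v0 mulr0.
Qed.

Lemma fibre_dir_cplx (k : 'I_t) : fibre_dir (dir_x R (rshift s k)) /\ fibre_dir (dir_y R (rshift s k)).
Proof.
split=> i; rewrite !mxE //=.
by rewrite eq_lrshift.
Qed.

Lemma fibre_const_dzb F (k : 'I_t) z : fibre_const F -> D z -> d_zetabar (rshift s k) F z = 0.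
Proof.
move=> cF Dz; have [h1 h2] := fibre_dir_cplx k.
by rewrite /d_zetabar !fibre_const_cderive// mulr0 addr0 mulr0.
Qed.

Lemma OK_B f g : OK f -> OK g -> OK (fun z => f z - g z).
Proof.
move=> [sf pf] [sg pg]; split; first exact: (smooth_onB oD).
by move=> b ib z Dz; rewrite (pf b ib z Dz) (pg b ib z Dz).
Qed.

Lemma OK_Z c f : OK f -> OK (fun z => c * f z).
Proof.
move=> [sf pf]; split; first exact: (smooth_onZ oD).
by move=> b ib z Dz; rewrite (pf b ib z Dz).
Qed.

Lemma OK_D f g : OK f -> OK g -> OK (fun z => f z + g z).
Proof.
move=> [sf pf] [sg pg]; split; first exact: (smooth_onD oD).
by move=> b ib z Dz; rewrite (pf b ib z Dz) (pg b ib z Dz).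
Qed.

Lemma OK_dzb j f : OK f -> OK (d_zetabar j f).
Proof.
move=> fOK; apply: OK_Z; apply: OK_D; last apply: OK_Z; exact: OK_smooth_cderive.
Qed.

(** [red] is the projection onto the constant modes.  The normalisation [red_prim]
    determines the primitive [prim], which makes it equivariant. *)
Record reduction (P red prim : (V -> R[i]) -> V -> R[i]) := {
  red_OK : forall f, OK f -> OK (red f);
  red_cderive : forall f v z, OK f -> D z -> cderive v (red f) z = red (cderive v f) z;
  red_ext : forall f g z, (forall z, D z -> f z = g z) -> D z -> red f z = red g z;
  redD : forall f g z, OK f -> OK g -> D z -> red (fun z => f z + g z) z = red f z + red g z;
  redZ : forall c f z, OK f -> D z -> red (fun z => c * f z) z = c * red f z;
  red_const : forall f, OK f -> fibre_const (red f);
  red_id : forall f z, OK f -> fibre_const f -> D z -> red f z = f z;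
  prim_OK : forall f, OK f -> OK (prim f);
  prim_cderive : forall f v z, OK f -> D z -> cderive v (prim f) z = prim (cderive v f) z;
  prim_ext : forall f g z, (forall z, D z -> f z = g z) -> D z -> prim f z = prim g z;
  primD : forall f g z, OK f -> OK g -> D z -> prim (fun z => f z + g z) z = prim f z + prim g z;
  primZ : forall c f z, OK f -> D z -> prim (fun z => c * f z) z = c * prim f z;
  prim_dzb : forall f z, OK f -> D z -> P (prim f) z = f z - red f z;
  red_prim : forall f z, OK f -> D z -> red (prim f) z = 0
}.

(** [T P] projects onto the nonconstant modes, so [red f = f - T (P f)] is constant along the
    fibres: its derivative along a fibre direction is [cderive v f - T (P (cderive v f)) = 0]. As
    [P] kills such functions, subtracting [red (T f)] from [T f] keeps
    [P (prim f) = T (P f) = f - red f] and normalises the primitive. *)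
Lemma exists_reduction (k : 'I_t) : OT_embeddings sigma ->
  exists red prim, reduction (@d_zetabar R n (rshift s k)) red prim.
Proof.
move=> /(exists_fibre_inverse k)[T TP].
set P := d_zetabar (rshift s k) in TP *.
have TOK f : OK f -> OK (T f) := finv_OK TP (f := f).
have dOK v f : OK f -> OK (cderive v f) := @OK_smooth_cderive _ _ _ _ _ v f.
have POK f : OK f -> OK (P f) by exact: OK_dzb.
have PT f z : OK f -> D z -> P (T f) z = T (P f) z.
  move=> fO Dz; rewrite /P /d_zetabar (finvZ TP) ?(finvD TP) ?(finvZ TP) ?(finv_cderive TP)//.
  - exact: dOK.
  - exact: dOK.
  - by apply: OK_Z; exact: dOK.
  - by apply: OK_D; [|apply: OK_Z]; exact: dOK.
have T0 f z : OK f -> (forall z, D z -> f z = 0) -> D z -> T f z = 0.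
  move=> fO f0 Dz; transitivity (T (fun z => 0 * f z) z).
    by apply: (finv_ext TP) => // y Dy; rewrite mul0r f0.
  by rewrite (finvZ TP) ?mul0r.
pose red f z := f z - T (P f) z.
have rO f : OK f -> OK (red f) by move=> fO; apply: OK_B => //; exact/TOK/POK.
have rd f v z : OK f -> D z -> cderive v (red f) z = red (cderive v f) z.
  move=> fO Dz; have [sf _] := fO; have [sPf _] := TOK _ (POK _ fO).
  rewrite (cderiveB oD) // (finv_cderive TP) //; last exact: POK.
  by congr (_ - _); apply: (finv_ext TP) => // y Dy; rewrite (finv_comm TP).
have re f g z : (forall z, D z -> f z = g z) -> D z -> red f z = red g z.
  move=> fg Dz; congr (_ - _); first exact: fg.
  apply: (finv_ext TP) => // y Dy; exact: (d_zetabar_ext oD).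
have PD f g z : OK f -> OK g -> D z -> P (fun z => f z + g z) z = P f z + P g z.
  by move=> [sf _] [sg _]; exact: d_zetabarD.
have PZ c f z : OK f -> D z -> P (fun z => c * f z) z = c * P f z.
  by move=> [sf _]; exact: (d_zetabarZ oD).
have rD f g z : OK f -> OK g -> D z -> red (fun z => f z + g z) z = red f z + red g z.
  move=> fO gO Dz; 
  have E : T (P (fun z => f z + g z)) z = T (P f) z + T (P g) z.
    rewrite -(finvD TP) //; [|exact: POK..].
    by apply: (finv_ext TP) => // y Dy; exact: PD.
  by rewrite /red E opprD addrACA.
have rZ c f z : OK f -> D z -> red (fun z => c * f z) z = c * red f z.
  move=> fO Dz; rewrite /red mulrBr; congr (_ - _).
  rewrite -(finvZ TP) //; last exact: POK.
  by apply: (finv_ext TP) => // y Dy; exact: PZ.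
have rc f : OK f -> fibre_const (red f).
  move=> fO; apply: fibre_constP; first by case: (rO _ fO).
  move=> v z v0 Dz; rewrite rd// /red.
  by rewrite (finv_fibre TP) ?subrr.
have ri f z : OK f -> fibre_const f -> D z -> red f z = f z.
  move=> fO fc Dz; rewrite /red T0 ?subr0//; first exact: POK.
  by move=> y Dy; exact: fibre_const_dzb.
pose prim f z := T f z - red (T f) z.
exists red, prim; split.
- exact: rO.
- exact: rd.
- exact: re.
- exact: rD.
- exact: rZ.
- exact: rc.
- exact: ri.
- by move=> f fO; apply: OK_B; [|apply: rO]; exact: TOK.
- move=> f v z fO Dz; have [sf _] := TOK _ fO; have [srf _] := rO _ (TOK _ fO).
  rewrite /prim (cderiveB oD v sf srf Dz) (rd _ v z (TOK _ fO) Dz).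
  congr (_ - _); first exact: (finv_cderive TP).
  by apply: re Dz => y Dy; exact: (finv_cderive TP).
- move=> f g z fg Dz; congr (_ - _); first exact: (finv_ext TP).
  by apply: re Dz => y Dy; exact: (finv_ext TP).
- move=> f g z fO gO Dz; have E : red (T (fun z => f z + g z)) z = red (T f) z + red (T g) z.
    rewrite -(rD _ _ _ (TOK _ fO) (TOK _ gO) Dz).
    by apply: re Dz => y Dy; exact: (finvD TP).
  by rewrite /prim E (finvD TP fO gO Dz) opprD addrACA.
- move=> c f z fO Dz; rewrite /prim (finvZ TP _ fO Dz) mulrBr -(rZ _ _ _ (TOK _ fO) Dz).
  by congr (_ - _); apply: re Dz => y Dy; exact: (finvZ TP).
- move=> f z fO Dz; have [sf _] := TOK _ fO; have [srf _] := rO _ (TOK _ fO).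
  rewrite /P (d_zetabarB oD) // -/P PT// /red.
  rewrite [P (fun _ => _) z](fibre_const_dzb _ (rc _ (TOK _ fO))) // subr0; ring.
move=> f z fO Dz; rewrite /prim.
have -> : red (fun z => T f z - red (T f) z) z = red (T f) z - red (red (T f)) z.
  rewrite -mulN1r -rZ //; last by apply: rO; exact: TOK.
  rewrite -rD; [|exact: TOK| by apply: OK_Z; apply: rO; exact: TOK|by []].
  by apply: re => // y _; rewrite mulN1r.
by rewrite (ri (red (T f))) ?subrr//; [apply: rO; exact: TOK|apply: rc; exact: TOK].
Qed.

End Reduction.

(** The Cauchy-Riemann computation behind [d_zetabar_ulin]: precomposition with multiplication by
    [x + I * y] multiplies the antiholomorphic derivative by [x - I * y]. *)
Lemma rot_zetabar (L : comRingType) (h x y I p q : L) : I * I = -1 ->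
  h * (x * p + y * q + I * (- y * p + x * q)) = (x - I * y) * (h * (p + I * q)).
Proof.
move=> i2; apply/eqP; rewrite -subr_eq0; apply/eqP.
by transitivity (h * y * q * (1 + I * I)); [ring|rewrite i2 subrr mulr0].
Qed.

(** * Equivariance and the Koszul homotopy *)

Section Action.
Variables (R : realType) (s t : nat) (K : fieldExtType rat).
Variable sigma : 'I_(s + t + t) -> {rmorphism K -> R[i]}.
Hypothesis sigmaP : OT_embeddings sigma.
Local Notation n := (s + t)%N.
Local Notation V := ('rV[R]_n * 'rV[R]_n)%type.
Local Notation Re := (@complex.Re R).
Local Notation Im := (@complex.Im R).
Local Notation D := (@OT_cover R s t).
Local Notation oD := (@OT_cover_open R s t).
Local Notation OK := (@OK_smooth R s t K sigma).
Implicit Types (f g F : V -> R[i]) (v z : V).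

Definition ulin (a : K) v : V := of_zeta (fun j => sig_coord sigma j a * zeta v j).

Lemma OT_actE a b z : OT_act sigma a b z = ulin a z + tvec sigma b.
Proof. by congr pair; apply/rowP => j; rewrite !mxE (ReD, ImD). Qed.

Lemma ulinP a (x : R) z v : ulin a (x *: v + z) = x *: ulin a v + ulin a z.
Proof.
by congr pair; apply/rowP => j; rewrite !mxE /zeta /= ?mxE (ReM, ImM) /= (ReM, ImM) /= (ReM, ImM) /=; ring.
Qed.

Lemma ulin_tvec a b : ulin a (tvec sigma b) = tvec sigma (a * b).
Proof.
by congr pair; apply/rowP => j; rewrite !mxE rmorphM /zeta /= !mxE; case: (sig_coord sigma j b).
Qed.

Lemma ulinD a z w : ulin a (z + w) = ulin a z + ulin a w.
Proof. by rewrite -[z]scale1r ulinP !scale1r. Qed.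

Lemma derive_act (h : V -> R) a v z : 'D_v (h \o ulin a) z = 'D_(ulin a v) h (ulin a z).
Proof. by rewrite /derive (_ : (fun x : R => _) = fun x : R => x^-1 *: ((h \o shift (ulin a z)) (x *: ulin a v) - h (ulin a z))) //; apply/funext => x /=; rewrite ulinP. Qed.

Lemma derivable_act (h : V -> R) a v z : derivable h (ulin a z) (ulin a v) -> derivable (h \o ulin a) z v.
Proof.
rewrite /derivable [X in _ -> cvg (X @ _)](_ : _ = fun x : R => x^-1 *: ((h \o shift (ulin a z)) (x *: ulin a v) - h (ulin a z))) //.
by apply/funext => x /=; rewrite ulinP.
Qed.

Lemma cderive_act f a v z : cderive v (f \o ulin a) z = cderive (ulin a v) f (ulin a z).
Proof. by apply: complex_eqP; rewrite ?Re_cderive ?Im_cderive -derive_act. Qed.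

Lemma ulin_continuous a : continuous (ulin a).
Proof.
move=> z.
have c1 (j : 'I_n) : (y : V).1 0 j @[y --> z] --> z.1 0 j.
  exact: (cvg_comp _ (fun x : 'rV[R]_n => x 0 j) cvg_fst (@coord_continuous _ _ _ 0 j z.1)).
have c2 (j : 'I_n) : (y : V).2 0 j @[y --> z] --> z.2 0 j.
  exact: (cvg_comp _ (fun x : 'rV[R]_n => x 0 j) cvg_snd (@coord_continuous _ _ _ 0 j z.2)).
apply: (@cvg_pair _ _ _ (nbhs z) (nbhs _) (nbhs _)); apply: cvg_row => j.
  rewrite ReM (_ : (fun y : V => _) = fun y : V => Re (sig_coord sigma j a) * y.1 0 j
    - Im (sig_coord sigma j a) * y.2 0 j); last by apply/funext => y; rewrite ReM.
  by apply: cvgB; apply: cvgM => //; exact: cvg_cst.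
rewrite ImM (_ : (fun y : V => _) = fun y : V => Re (sig_coord sigma j a) * y.2 0 j
  + Im (sig_coord sigma j a) * y.1 0 j); last by apply/funext => y; rewrite ImM.
by apply: cvgD; apply: cvgM => //; exact: cvg_cst.
Qed.

Lemma Ck_on_act k (h : V -> R) a : (forall z, D z -> D (ulin a z)) -> Ck_on k D h ->
  Ck_on k D (h \o ulin a).
Proof.
move=> Da; elim: k h => [|k IHk] h [ch dh].
all: have c : forall z, D z -> {for z, continuous (h \o ulin a)}
  by move=> z Dz; apply: continuous_comp; [exact: ulin_continuous|exact/ch/Da].
  by [].
split=> // v; have [d1 d2] := dh (ulin a v); split.
  by move=> z Dz; apply: derivable_act; exact/d1/Da.
have -> : 'D_v (h \o ulin a) = 'D_(ulin a v) h \o ulin a by apply/funext => z; exact: derive_act.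
exact: IHk.
Qed.

Lemma smooth_act f a : (forall z, D z -> D (ulin a z)) -> smooth_on D f -> smooth_on D (f \o ulin a).
Proof. by move=> Da sf k; have [h1 h2] := sf k; split; [exact: (Ck_on_act Da h1)|exact: (Ck_on_act Da h2)]. Qed.

Lemma real_emb (i : 'I_s) a : sig_coord sigma (lshift t i) a = (Re (sig_real sigma i a))%:C.
Proof. by have := OT_real sigmaP i a; rewrite /sig_real /sig_coord; case: (sigma _ a) => x y /= ->. Qed.

Lemma conjcE (x : R[i]) : x^* = (Re x)%:C - 'i * (Im x)%:C.
Proof. by case: x => x y; apply: complex_eqP; rewrite ?ReD ?ImD ?ReN ?ImN ?ReM ?ImM /=; ring. Qed.

Lemma ulin_real (i : 'I_s) a v : (ulin a v).2 0 (lshift t i) = Re (sig_real sigma i a) * v.2 0 (lshift t i).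
Proof. by rewrite mxE real_emb ImM /=; ring. Qed.

Lemma fibre_dir_ulin a v : fibre_dir v -> fibre_dir (ulin a v).
Proof. by move=> v0 i; rewrite ulin_real v0 mulr0. Qed.

Variable a : K.
Hypothesis pa : @positive_units R s t K sigma a.

Lemma emb_gt0 i : 0 < Re (sig_real sigma i a).
Proof. by have [_ /(_ i)] := pa; rewrite ltcE => /andP[_]. Qed.

Lemma OT_cover_ulin z : D z -> D (ulin a z).
Proof. by move=> Dz i; rewrite /= ulin_real mulr_gt0 ?emb_gt0//; exact: Dz. Qed.

Lemma smooth_ulin f : smooth_on D f -> smooth_on D (f \o ulin a).
Proof. by apply: smooth_act; exact: OT_cover_ulin. Qed.

(** Translation by [b] becomes translation by [a * b], which is a period because [a] is integral. *)
Lemma OK_ulin f : OK f -> OK (f \o ulin a).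
Proof.
move=> [sf pf]; split; first exact: smooth_ulin.
move=> b ib z Dz /=; rewrite ulinD ulin_tvec pf//; last exact: OT_cover_ulin.
by case: pa => -[_ ia _] _; exact: integral_mul.
Qed.

Lemma fibre_const_ulin F : fibre_const F -> fibre_const (F \o ulin a).
Proof.
move=> cF v z v0 Dz /=; rewrite ulinD cF//; [exact: fibre_dir_ulin|exact: OT_cover_ulin].
Qed.

Lemma d_zetabar_ulin j f z : smooth_on D f -> D z ->
  d_zetabar j (f \o ulin a) z = (sig_coord sigma j a)^* * d_zetabar j f (ulin a z).
Proof.
move=> sf Dz; rewrite /d_zetabar !cderive_act.
set c := sig_coord sigma j a.
have -> : ulin a (dir_x R j) = Re c *: dir_x R j + Im c *: dir_y R j.
  congr pair; apply/rowP => i; rewrite !mxE ?mulr0 ?addr0 ?add0r /zeta /= !mxE !eqxx /=;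
  rewrite (ReM, ImM) /=; case: (i =P j) => [->|_] /=; rewrite -?/c; ring.
have -> : ulin a (dir_y R j) = (- Im c) *: dir_x R j + Re c *: dir_y R j.
  congr pair; apply/rowP => i; rewrite !mxE ?mulr0 ?addr0 ?add0r /zeta /= !mxE !eqxx /=;
  rewrite (ReM, ImM) /=; case: (i =P j) => [->|_] /=; rewrite -?/c; ring.
rewrite !(cderive_linear oD) //; try exact: OT_cover_ulin.
move: (cderive _ f _) (cderive _ f _) => p q.
have -> : (- Im c)%:C = - (Im c)%:C :> R[i] by rewrite rmorphN.
transitivity (((Re c)%:C - 'i * (Im c)%:C) * (2^-1 * (q + 'i * p))); last by rewrite -conjcE.
by apply: rot_zetabar; rewrite -expr2 sqr_i.
Qed.

Lemma ulin_neq0 j : (sig_coord sigma j a)^* != 0.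
Proof. by rewrite conjc_eq0 fmorph_eq0; case: pa => -[]. Qed.

Variables (k : 'I_t) (red prim : (V -> R[i]) -> V -> R[i]).
Local Notation j0 := (rshift s k : 'I_n).
Hypothesis rP : reduction sigma (@d_zetabar R n j0) red prim.

Lemma red_dzb j f z : OK f -> D z -> d_zetabar j (red f) z = red (d_zetabar j f) z.
Proof.
move=> fO Dz; have h v := red_cderive rP v fO Dz; rewrite /d_zetabar !h.
have dO v := OK_smooth_cderive v fO.
rewrite (redZ rP) //; last by apply: OK_D; [|apply: OK_Z]; exact: dO.
by rewrite (redD rP (dO _) (OK_Z _ (dO _)) Dz) (redZ rP _ (dO _) Dz).
Qed.

Lemma prim_dzbC j f z : OK f -> D z -> d_zetabar j (prim f) z = prim (d_zetabar j f) z.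
Proof.
move=> fO Dz; have h v := prim_cderive rP v fO Dz; rewrite /d_zetabar !h.
have dO v := OK_smooth_cderive v fO.
rewrite (primZ rP) //; last by apply: OK_D; [|apply: OK_Z]; exact: dO.
by rewrite (primD rP (dO _) (OK_Z _ (dO _)) Dz) (primZ rP _ (dO _) Dz).
Qed.

Lemma red0 f z : OK f -> (forall z, D z -> f z = 0) -> D z -> red f z = 0.
Proof.
move=> fO f0 Dz; transitivity (red (fun z => 0 * f z) z).
  by apply: (red_ext rP) => // y Dy; rewrite mul0r f0.
by rewrite (redZ rP) ?mul0r.
Qed.

Lemma prim0 f z : OK f -> (forall z, D z -> f z = 0) -> D z -> prim f z = 0.
Proof.
move=> fO f0 Dz; transitivity (prim (fun z => 0 * f z) z).
  by apply: (prim_ext rP) => // y Dy; rewrite mul0r f0.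
by rewrite (primZ rP) ?mul0r.
Qed.

Lemma red_dzb0 f z : OK f -> D z -> red (d_zetabar j0 f) z = 0.
Proof.
move=> fO Dz; rewrite -red_dzb// fibre_const_dzb//; exact: (red_const rP).
Qed.

(** Pulling back [f = red f + d_zetabar (prim f)] by [a] splits [f \o ulin a] into a function
    constant along the fibres, which [red] fixes, and a [d_zetabar] image, which it kills. *)
Lemma red_ulin f z : OK f -> D z -> red (f \o ulin a) z = red f (ulin a z).
Proof.
move=> fO Dz; have pO := prim_OK rP fO; have rO := red_OK rP fO.
have E y : D y -> (f \o ulin a) y =
    (red f \o ulin a) y + ((sig_coord sigma j0 a)^*)^-1 * d_zetabar j0 (prim f \o ulin a) y.
  move=> Dy /=; have [sp _] := pO; rewrite d_zetabar_ulin// mulKf ?ulin_neq0//.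
  rewrite (prim_dzb rP) //; last exact: OT_cover_ulin.
  by rewrite addrC subrK.
rewrite (red_ext rP E Dz) (redD rP) //; [|exact: OK_ulin|by apply: OK_Z; apply: OK_dzb; exact: OK_ulin].
rewrite (redZ rP) //; last by apply: OK_dzb; exact: OK_ulin.
rewrite red_dzb0 ?mulr0 ?addr0//; last exact: OK_ulin.
rewrite (red_id rP) //; first exact: OK_ulin.
by apply: fibre_const_ulin; exact: (red_const rP).
Qed.

Lemma prim_dzb_red f z : OK f -> D z -> f z = red f z + prim (d_zetabar j0 f) z.
Proof. by move=> fO Dz; rewrite -prim_dzbC// (prim_dzb rP) // addrC subrK. Qed.

(** Uniqueness of the normalised primitive: the difference [h] of the two sides satisfies
    [d_zetabar h = 0] and [red h = 0], and then [h = red h + prim (d_zetabar h) = 0]. *)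
Lemma prim_ulin f z : OK f -> D z ->
  prim (f \o ulin a) z = ((sig_coord sigma j0 a)^*)^-1 * prim f (ulin a z).
Proof.
move=> fO Dz; have pO := prim_OK rP fO; have kn := ulin_neq0 j0.
have fO' := OK_ulin fO; have pO' := OK_ulin pO.
set c := _^*^-1; pose h y := prim (f \o ulin a) y - c * (prim f \o ulin a) y.
have cO : OK (fun y => c * (prim f \o ulin a) y) by exact: OK_Z.
have ppO := prim_OK rP fO'.
have hO : OK h by exact: OK_B.
have h0 y : D y -> d_zetabar j0 h y = 0.
  move=> Dy; rewrite (d_zetabarB oD) //; [|by case: ppO|by case: cO].
  have [sp' _] := pO'; have [sp _] := pO; rewrite (d_zetabarZ oD)// d_zetabar_ulin//.
  rewrite (prim_dzb rP fO' Dy) (prim_dzb rP fO (OT_cover_ulin Dy)) red_ulin//.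
  by rewrite mulKf// subrr.
suff : h z = 0 by move/eqP; rewrite subr_eq0 => /eqP.
rewrite (prim_dzb_red hO Dz) (prim0 _ h0 Dz) ?addr0; last exact: OK_dzb.
have -> : red h z = red (prim (f \o ulin a)) z + (-1) * red (fun y => c * (prim f \o ulin a) y) z.
  rewrite -(redZ rP) // -(redD rP) //; last exact: OK_Z.
  by apply: (red_ext rP) => // y _; rewrite mulN1r.
rewrite (red_prim rP fO' Dz) (redZ rP) // red_ulin// (red_prim rP fO) ?mulr0 ?addr0//.
exact: OT_cover_ulin.
Qed.

End Action.

Section Koszul.
Variables (C : comRingType) (n a : nat).
Implicit Types (B : {set 'I_n}) (i j : 'I_n).

(** The sign in [dbar], with [a] for the number of [dzeta] factors. The section is abstract because
    it serves twice: for [d_zetabar] with [prim], and for [euler] with the averages [ypr]. *)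
Definition dsign B j : C := (-1) ^+ (a + #|[set b in B | (b < j)%N]|).

Lemma dsignK B j : dsign B j * dsign B j = 1.
Proof. by rewrite /dsign -exprD addnn -mul2n mulnC exprM sqrr_sign. Qed.

Lemma card_below_setU1 B i j : j \notin B ->
  #|[set b in j |: B | (b < i)%N]| = (#|[set b in B | (b < i)%N]| + (j < i))%N.
Proof.
move=> jB; rewrite (cardsD1 j) !inE eqxx /= addnC; congr (_ + _)%N.
apply: eq_card => b; rewrite !inE; case: eqVneq => //= ->.
by rewrite (negbTE jB).
Qed.

(** Wedging with [i] anticommutes with contracting [j]: exactly one of [i < j] and [j < i] holds,
    which accounts for one extra sign. *)
Lemma dsign_swap B i j : i \in B -> j \notin B ->
  dsign B i * dsign (j |: (B :\ i)) j = - (dsign (j |: B) j * dsign (j |: B) i).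
Proof.
move=> iB jB; have ij : i != j by apply: contraNneq jB => <-.
have jBi : j \notin B :\ i by rewrite !inE negb_and jB orbT.
rewrite /dsign !card_below_setU1// ltnn addn0.
have -> : #|[set b in B | (b < j)%N]| = (#|[set b in B :\ i | (b < j)%N]| + (i < j))%N.
  by rewrite -card_below_setU1 ?finset.setD1K// !inE eqxx.
have -> : (i < j)%N = ~~ (j < i)%N by move: ij; rewrite -val_eqE /=; case: ltngtP.
by case: (j < i)%N; rewrite /= ?addn0 !addnA ?addn1 -!exprD -?exprS; rewrite !(exprD, exprS, expr0); ring.
Qed.

Variables (V : Type) (D : set V) (S : (V -> C) -> Prop).
Implicit Types f g : V -> C.
Hypotheses (SD : forall f g, S f -> S g -> S (fun z => f z + g z))
  (SZ : forall c f, S f -> S (fun z => c * f z)) (S0 : S (fun=> 0)).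
Variables (d : 'I_n -> (V -> C) -> V -> C) (h : (V -> C) -> V -> C) (j : 'I_n).
Hypotheses (dS : forall i f, S f -> S (d i f))
  (hext : forall f g z, (forall z, D z -> f z = g z) -> D z -> h f z = h g z)
  (hD : forall f g z, S f -> S g -> D z -> h (fun z => f z + g z) z = h f z + h g z)
  (hZ : forall c f z, S f -> D z -> h (fun z => c * f z) z = c * h f z)
  (hd : forall i f z, S f -> D z -> d i (h f) z = h (d i f) z).

Lemma S_sum I (r : seq I) (F : I -> V -> C) : (forall k, S (F k)) ->
  S (fun z => \sum_(i <- r) F i z).
Proof.
move=> SF; elim: r => [|i r IHr].
  by rewrite (_ : (fun _ => _) = fun=> 0)//; apply/funext => z; rewrite big_nil.
rewrite (_ : (fun _ => _) = fun z => F i z + \sum_(i <- r) F i z); first exact: SD.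
by apply/funext => z; rewrite big_cons.
Qed.

Lemma h_sum I (r : seq I) (F : I -> V -> C) z : (forall k, S (F k)) -> D z ->
  h (fun z => \sum_(i <- r) F i z) z = \sum_(i <- r) h (F i) z.
Proof.
move=> SF Dz; elim: r => [|i r IHr].
  rewrite big_nil; transitivity (h (fun z => 0 * (0 : C)) z).
    by apply: hext => // y _; rewrite big_nil mul0r.
  by rewrite (hZ 0 S0 Dz) mul0r.
rewrite big_cons -IHr -hD//; last exact: S_sum.
by apply: hext => // y _; rewrite big_cons.
Qed.

Variable w : {set 'I_n} -> V -> C.
Hypothesis Sw : forall B, S (w B).

Definition koszul_d (u : {set 'I_n} -> V -> C) B z : C :=
  \sum_(i in B) dsign B i * d i (u (B :\ i)) z.

(** Contraction of the index [j], with [h] applied to the coefficients. *)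
Definition koszul_h (u : {set 'I_n} -> V -> C) B z : C :=
  if j \in B then 0 else dsign (j |: B) j * h (u (j |: B)) z.

(** Cartan's formula. If [j] is outside [B], the term [i = j] of the inner [koszul_d] gives
    [d j (h (w B))] and the terms with [i] in [B] cancel by [dsign_swap]; if [j] is in [B], only the
    term [i = j] of the outer [koszul_d] survives. *)
Lemma koszul_homotopy B z : D z ->
  (forall i c f, S f -> d i (fun z => c * h f z) z = c * d i (h f) z) ->
  (forall i, d i (fun=> 0) z = 0) ->
  koszul_d (koszul_h w) B z + koszul_h (koszul_d w) B z = d j (h (w B)) z.
Proof.
move=> Dz dZ d0; rewrite {1}/koszul_d /koszul_h.
case: ifPn => jB.
  rewrite (bigD1 j) //= big1 => [|i /andP[iB ij]]; last first.
    by rewrite !inE eq_sym ij jB /= d0 mulr0.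
  rewrite !addr0 !inE eqxx /= finset.setD1K// dZ//.
  by rewrite mulrA dsignK mul1r.
rewrite /koszul_d.
have -> : h (fun z => \sum_(i in j |: B) dsign (j |: B) i * d i (w ((j |: B) :\ i)) z) z =
    \sum_(i in j |: B) dsign (j |: B) i * h (d i (w ((j |: B) :\ i))) z.
  rewrite (hext (g := fun z => \sum_(i <- enum (j |: B)) dsign (j |: B) i * d i (w ((j |: B) :\ i)) z)) //;
    last by move=> y _; rewrite big_enum.
  rewrite h_sum //; last by move=> i; apply/SZ/dS.
  by rewrite big_enum /=; apply: eq_bigr => i _; rewrite hZ//; exact: dS.
rewrite big_setU1//= mulrDr mulrA dsignK mul1r finset.setU1K// addrCA mulr_sumr -big_split /=.
rewrite big1 ?addr0 ?hd// => i iB.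
have ij : j != i by apply: contraNneq jB => ->.
rewrite !inE (negbTE jB) andbF dZ// mulrA dsign_swap// mulrA hd// finset.setDUl.
suff -> : finset.set1 j :\ i = finset.set1 j by rewrite mulNr addNr.
by apply/finset.setP => b; rewrite !inE; case: eqVneq => //= ->; rewrite eq_sym (negbTE ij).
Qed.

End Koszul.

Lemma transport_scaling (R : realType) (c pA pB x y r e : R[i]) :
  c != 0 -> pA != 0 -> pB != 0 -> c^-1 * x = r / (pA * (c * pB)) * y ->
  e * x * pA * pB = r * (e * y).
Proof.
move=> c0 a0 b0 E; rewrite -(mulVKf c0 x) mulrC E; field.
by rewrite c0 a0 b0.
Qed.

(** * Equivariant forms and their reduction to coefficients constant along the fibres *)

Section Cochains.
Variables (R : realType) (s t : nat) (K : fieldExtType rat).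
Variable sigma : 'I_(s + t + t) -> {rmorphism K -> R[i]}.
Variables (U : set K) (rho : K -> R[i]).
Hypotheses (sigmaP : OT_embeddings sigma) (UP : OT_group sigma U) (rhoP : U_character U rho).
Local Notation n := (s + t)%N.
Local Notation V := ('rV[R]_n * 'rV[R]_n)%type.
Local Notation D := (@OT_cover R s t).
Local Notation oD := (@OT_cover_open R s t).
Local Notation OK := (@OK_smooth R s t K sigma).
Local Notation form := (cform R n).
Implicit Types (f g F : V -> R[i]) (z : V) (A B C : {set 'I_n}) (w v : form) (p q : nat).

Lemma rho1 : rho 1 = 1.
Proof.
have r0 := chi_neq0 rhoP (OT_one UP).
by apply: (mulfI r0); rewrite -(chi_mul rhoP (OT_one UP) (OT_one UP)) !mulr1.
Qed.

Lemma U_positive a : U a -> @positive_units R s t K sigma a.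
Proof. exact: (OT_sub UP). Qed.

(** The degree condition is a predicate so that [#|B|.+1 == q] can express degree [q - 1] for every
    [q], leaving only the zero form when [q = 0]. *)
Record cochain (dg : {set 'I_n} -> {set 'I_n} -> bool) (w : form) : Prop := {
  coch_OK : forall A B, OK (w A B);
  coch_equiv : forall a, U a -> forall A B z, D z ->
    w A B (ulin sigma a z) * (\prod_(j in A) sig_coord sigma j a) *
      (\prod_(j in B) (sig_coord sigma j a)^*) = rho a * w A B z;
  coch_degree : forall A B z, D z -> ~~ dg A B -> w A B z = 0
}.

Lemma tvec0 : tvec sigma 0 = 0.
Proof. by congr pair; apply/rowP => j; rewrite !mxE rmorph0. Qed.

(** The semidirect product is treated factor by factor: [a = 1] gives periodicity under the
    integers, [b = 0] the condition for the linear part. *)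
Lemma E_formP p q w : E_form sigma U rho p q w <->
  cochain (fun A B => (#|A| == p) && (#|B| == q)) w.
Proof.
split=> [[sw ew dw]|[ow ew dw]].
  split=> //.
    move=> A B; split=> // b ib z Dz; have := ew 1 b (OT_one UP) ib A B z Dz.
    rewrite OT_act_translation rho1 mul1r !big1 ?mulr1// => j _; rewrite rmorph1// rmorph1//.
  move=> a Ua A B z Dz; have := ew a 0 Ua (mxpoly.integral0 _) A B z Dz.
  by rewrite OT_actE tvec0 addr0.
split=> //; first by move=> A B; case: (ow A B).
move=> a b Ua ib A B z Dz; rewrite -ew// OT_actE; congr (_ * _ * _).
by case: (ow A B) => _ -> //; exact: (OT_cover_ulin sigmaP (U_positive Ua)).
Qed.

Lemma E_exact_of p q w v : cochain (fun A B => (#|A| == p) && (#|B|.+1 == q)) v ->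
  form_eq D w (dbar v) -> E_exact sigma U rho p q w.
Proof.
case: q => [|q] cv wv; last by exists v => //; apply/E_formP; case: cv => *; split.
(* For [q = 0] the coefficients of [v] vanish for degree reasons, so [w = dbar v] is zero, as
   [E_exact] asks in that degree. *)
move=> A B z Dz; rewrite wv// /dbar big1// => j _.
have v0 y : D y -> v A (B :\ j) y = (fun=> 0) y.
  by move=> Dy; apply: (coch_degree cv) => //; rewrite andbF.
by rewrite (d_zetabar_ext oD j v0 Dz) d_zetabar_cst mulr0.
Qed.

Lemma dbarE w A B z : dbar w A B z = koszul_d #|A| (@d_zetabar R n) (w A) B z.
Proof. by []. Qed.

Lemma dbarD v v' A B z : (forall A B, OK (v A B)) -> (forall A B, OK (v' A B)) -> D z ->
  dbar (fun A B z => v A B z + v' A B z) A B z = dbar v A B z + dbar v' A B z.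
Proof.
move=> ov ov' Dz; rewrite /dbar -big_split /=; apply: eq_bigr => j _.
have [sv _] := ov A (B :\ j); have [sv' _] := ov' A (B :\ j).
by rewrite (d_zetabarD j sv sv' Dz) mulrDr.
Qed.

Variables (k : 'I_t) (red prim : (V -> R[i]) -> V -> R[i]).
Local Notation j0 := (rshift s k : 'I_n).
Hypothesis rP : reduction sigma (@d_zetabar R n j0) red prim.

Lemma OK_cst c : OK (fun=> c).
Proof. by split; [exact: (smooth_on_cst oD)|]. Qed.

Lemma dbar_enum w A B : dbar w A B = fun z => \sum_(i <- enum B) dsign _ #|A| B i
  * d_zetabar i (w A (B :\ i)) z.
Proof. by apply/funext => z; rewrite /dbar big_enum. Qed.

Lemma OK_dbar w A B : (forall A B, OK (w A B)) -> OK (dbar w A B).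
Proof.
move=> ow; rewrite dbar_enum.
by apply: (@S_sum _ _ OK (@OK_D R s t K sigma) (OK_cst 0)) => i; exact/OK_Z/OK_dzb.
Qed.

Definition prim_form w : form := fun A B => koszul_h #|A| prim j0 (w A) B.
Definition red_form w : form := fun A B => red (w A B).

(** The factor in [prim_ulin] makes up for the [dzetabar] at [j0] that the contraction removes. *)
Lemma prim_form_cochain p q w : cochain (fun A B => (#|A| == p) && (#|B| == q)) w ->
  cochain (fun A B => (#|A| == p) && (#|B|.+1 == q)) (prim_form w).
Proof.
move=> [ow ew dw]; split.
- move=> A B; have [jB|/negbTE jB] := boolP (j0 \in B); rewrite /prim_form /koszul_h jB.
    exact: OK_cst.
  by apply: OK_Z; exact: (prim_OK rP).
- move=> a Ua A B z Dz; rewrite /prim_form /koszul_h; case: ifPn => jB.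
    by rewrite !mul0r mulr0.
  have pa := U_positive Ua; have on := ow A (j0 |: B).
  have := prim_ulin sigmaP pa rP on Dz.
  set c := _^*^-1 => E.
  have cn : (sig_coord sigma j0 a)^* != 0 := ulin_neq0 pa j0.
  have nA : \prod_(j in A) sig_coord sigma j a != 0.
    by apply/prodf_neq0 => j _; rewrite fmorph_eq0; case: pa => -[].
  have nB : \prod_(j in B) (sig_coord sigma j a)^* != 0.
    by apply/prodf_neq0 => j _; exact: (ulin_neq0 pa).
  have E2 : prim (w A (j0 |: B) \o ulin sigma a) z = (rho a / ((\prod_(j in A) sig_coord sigma j a) * (\prod_(j in j0 |: B) (sig_coord sigma j a)^*))) * prim (w A (j0 |: B)) z.
    rewrite -(primZ rP) //; apply: (prim_ext rP) => // y Dy.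
    rewrite mulrAC -(ew a Ua A (j0 |: B) y Dy) -mulrA mulfK//= mulf_neq0//.
    by apply/prodf_neq0 => j _; exact: (ulin_neq0 pa).
  refine (transport_scaling _ cn nA nB _).
  by move: E2; rewrite E big_setU1.
move=> A B z Dz nd; rewrite /prim_form /koszul_h; case: ifPn => // jB.
rewrite (prim0 rP (ow _ _)) ?mulr0// => y Dy; apply: dw => //.
by rewrite cardsU1 jB.
Qed.

Lemma red_form_cochain dg w : cochain dg w -> cochain dg (red_form w).
Proof.
move=> [ow ew dw]; split.
- by move=> A B; exact: (red_OK rP).
- move=> a Ua A B z Dz; have pa := U_positive Ua.
  rewrite /red_form -(red_ulin sigmaP pa rP (ow A B) Dz) mulrC mulrA mulrC mulrA.
  have oo := OK_ulin sigmaP pa (ow A B).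
  rewrite -(redZ rP) // -(redZ rP) //; apply: (red_ext rP) => // y Dy.
  by rewrite -ew//= mulrC mulrA.
by move=> A B z Dz nd; apply: (red0 rP (ow _ _)) => // y Dy; exact: dw.
Qed.

Lemma red_dbar w A B z : (forall A B, OK (w A B)) -> D z ->
  dbar (red_form w) A B z = red (dbar w A B) z.
Proof.
move=> ow Dz; symmetry.
rewrite dbar_enum.
rewrite (@h_sum _ _ D OK (@OK_D R s t K sigma) (OK_cst 0) red (red_ext rP) (redD rP) (redZ rP)) //; last first.
  by move=> i; apply/OK_Z/OK_dzb.
rewrite big_enum /=; apply: eq_bigr => i _; rewrite (redZ rP) //; last exact: OK_dzb.
by rewrite -(red_dzb rP).
Qed.

(** The Koszul formula with [d_zetabar (prim f) = f - red f] at the index [j0]; closedness removes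
    the term that contains [dbar w]. *)
Lemma prim_form_homotopy w : (forall A B, OK (w A B)) ->
  form_eq D (dbar w) (fun _ _ _ => 0) ->
  forall A B z, D z -> w A B z = red_form w A B z + dbar (prim_form w) A B z.
Proof.
move=> ow cw A B z Dz.
have H := @koszul_homotopy _ n #|A| _ D OK (@OK_D R s t K sigma) (@OK_Z R s t K sigma) (OK_cst 0) (@d_zetabar R n) prim j0
  (@OK_dzb R s t K sigma) (prim_ext rP) (primD rP) (primZ rP) _ (w A) (ow A) B z Dz.
have {H} := H (fun i f z fO Dz => prim_dzbC rP i fO Dz).
move=> H; have {H} : dbar (prim_form w) A B z + koszul_h #|A| prim j0 (koszul_d #|A| (@d_zetabar R n) (w A)) B z
    = d_zetabar j0 (prim (w A B)) z.
  apply: H; last by move=> i; exact: d_zetabar_cst.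
  by move=> i c f fO; have [sf _] := prim_OK rP fO; exact: (d_zetabarZ oD).
rewrite (prim_dzb rP) //.
have -> : koszul_h #|A| prim j0 (koszul_d #|A| (@d_zetabar R n) (w A)) B z = 0.
  rewrite /koszul_h; case: ifP => // _; rewrite (prim0 rP) ?mulr0//.
    exact: (OK_dbar A (j0 |: B) ow).
  by move=> y Dy; exact: cw.
by rewrite addr0 => ->; rewrite addrC subrK.
Qed.

End Cochains.

Lemma is_derive_shift0 (R : realType) (f : R -> R) (x d : R) :
  is_derive (0 : R) 1 (fun h => f (x + h)) d -> is_derive x 1 f d.
Proof.
move=> H; have E : f = (fun h => f (x + h)) \o (fun y => y - x).
  by apply/funext => y /=; rewrite addrC subrK.
rewrite E; have H2 : is_derive x 1 (fun y : R => y - x) (1 - 0).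
  exact: (@is_deriveB _ _ _ _ _ _ _ _ _ (is_derive_id x 1) (is_derive_cst x x 1)).
have H' : is_derive (x - x) 1 (fun h => f (x + h)) d by rewrite subrr.
by have := @is_derive1_comp _ (fun h => f (x + h)) (fun y => y - x) _ _ _ H' H2; rewrite subr0 mulr1.
Qed.

(** * Forms constant along the fibres *)

Section ScalingFlow.
Variables (R : realType) (s t : nat).
Local Notation n := (s + t)%N.
Local Notation V := ('rV[R]_n * 'rV[R]_n)%type.
Local Notation Re := (@complex.Re R).
Local Notation Im := (@complex.Im R).
Local Notation D := (@OT_cover R s t).
Local Notation oD := (@OT_cover_open R s t).
Implicit Types (f g F : V -> R[i]) (z v : V).

(** Smooth functions of the [Im w_i] alone, kept as functions on the cover. *)
Definition zero_mode F := smooth_on D F /\ fibre_const F.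

Lemma zero_mode_cst c : zero_mode (fun=> c).
Proof. by split; [exact: (smooth_on_cst oD)|]. Qed.

Lemma zero_modeD f g : zero_mode f -> zero_mode g -> zero_mode (fun z => f z + g z).
Proof.
move=> [sf cf] [sg cg]; split; first exact: (smooth_onD oD).
by move=> v z v0 Dz; rewrite cf// cg.
Qed.

Lemma zero_modeM f g : zero_mode f -> zero_mode g -> zero_mode (fun z => f z * g z).
Proof.
move=> [sf cf] [sg cg]; split; first exact: (smooth_onM oD).
by move=> v z v0 Dz; rewrite cf// cg.
Qed.

Lemma zero_modeZ c f : zero_mode f -> zero_mode (fun z => c * f z).
Proof. by apply: zero_modeM; exact: zero_mode_cst. Qed.

Lemma zero_mode_sum I (r : seq I) (P : pred I) (F : I -> V -> R[i]) :
  (forall i, P i -> zero_mode (F i)) -> zero_mode (fun z => \sum_(i <- r | P i) F i z).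
Proof.
move=> zF; split; first by apply: (smooth_on_sum oD) => i /zF[].
by move=> v z v0 Dz; apply: eq_bigr => i /zF[_ ->].
Qed.

Lemma zero_mode_prod I (r : seq I) (P : pred I) (F : I -> V -> R[i]) :
  (forall i, P i -> zero_mode (F i)) -> zero_mode (fun z => \prod_(i <- r | P i) F i z).
Proof.
move=> zF; split; first by apply: (smooth_on_prod oD) => i /zF[].
by move=> v z v0 Dz; apply: eq_bigr => i /zF[_ ->].
Qed.

Lemma zero_mode_cderive v f : zero_mode f -> zero_mode (cderive v f).
Proof.
move=> [sf cf]; split; first exact: smooth_cderive.
move=> w z w0 Dz; rewrite -cderive_shift; apply: (cderive_ext oD) => // y Dy.
exact: cf.
Qed.

Lemma zero_mode_dzb j f : zero_mode f -> zero_mode (d_zetabar j f).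
Proof.
move=> zf; apply/zero_modeZ/zero_modeD; last apply/zero_modeZ; exact: zero_mode_cderive.
Qed.

(** [Im w_i] at a real index; the value 1 at complex indices allows products over arbitrary index
    sets. *)
Definition yfac (j : 'I_n) z : R[i] :=
  match fintype.split j with inl _ => (z.2 0 j)%:C | inr _ => 1 end.

Lemma yfac_real (i : 'I_s) z : yfac (lshift t i) z = (z.2 0 (lshift t i))%:C.
Proof. by rewrite /yfac (unsplitK (inl _)). Qed.

Lemma yfac_cplx (k : 'I_t) z : yfac (rshift s k) z = 1.
Proof. by rewrite /yfac (unsplitK (inr _)). Qed.

Lemma ord_sumP (P : 'I_n -> Prop) : (forall i, P (lshift t i)) -> (forall k, P (rshift s k)) ->
  forall j, P j.
Proof. by move=> h1 h2 j; rewrite -(splitK j); case: fintype.split. Qed.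

Lemma smooth_on_real (h : V -> R) : (forall k, Ck_on k D h) -> smooth_on D (fun z => (h z)%:C).
Proof. by move=> ch k; split; [exact: ch|exact: (Ck_on_cst oD)]. Qed.

Lemma zero_mode_yfac j : zero_mode (yfac j).
Proof.
move: j; apply: ord_sumP => [i|k].
  rewrite (_ : yfac _ = fun z => (z.2 0 (lshift t i))%:C); last by apply/funext => z; exact: yfac_real.
  split; first by apply: smooth_on_real => k; exact: (Ck_on_y oD).
  by move=> v z v0 Dz; rewrite /= !mxE v0 addr0.
rewrite (_ : yfac _ = fun=> 1); last by apply/funext => z; exact: yfac_cplx.
exact: zero_mode_cst.
Qed.

Lemma zero_mode_yfacV j : zero_mode (fun z => (yfac j z)^-1).
Proof.
move: j; apply: ord_sumP => [i|k].
  rewrite (_ : (fun _ => _) = fun z : V => ((z.2 0 (lshift t i))^-1)%:C); last first.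
    by apply/funext => z; rewrite yfac_real fmorphV.
  split.
    apply: smooth_on_real => k; apply: (Ck_onV oD) => [z Dz|]; last exact: (Ck_on_y oD).
    by rewrite gt_eqF//; exact: Dz.
  by move=> v z v0 Dz; rewrite /= !mxE v0 addr0.
rewrite (_ : (fun _ => _) = fun=> 1); last by apply/funext => z; rewrite yfac_cplx invr1.
exact: zero_mode_cst.
Qed.

Lemma yfac_neq0 j z : D z -> yfac j z != 0.
Proof.
move: j; apply: ord_sumP => [i|k] Dz; last by rewrite yfac_cplx oner_eq0.
by rewrite yfac_real fmorph_eq0 gt_eqF//; exact: Dz.
Qed.

Lemma dzb_cplx (k : 'I_t) F z : zero_mode F -> D z -> d_zetabar (rshift s k) F z = 0.
Proof. by move=> [_ cF]; exact: fibre_const_dzb. Qed.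

Lemma dzb_real (i : 'I_s) F z : zero_mode F -> D z ->
  d_zetabar (lshift t i) F z = 2^-1 * 'i * cderive (dir_y R (lshift t i)) F z.
Proof.
move=> [_ cF] Dz; rewrite /d_zetabar fibre_const_cderive ?add0r ?mulrA// => j.
by rewrite /= mxE.
Qed.

(** [d_zetabar] becomes [euler] when the coefficient of [dzetabar_B] is multiplied by
    [Yp B]. *)
Definition euler j F z : R[i] := yfac j z * d_zetabar j F z.

Lemma zero_mode_euler j F : zero_mode F -> zero_mode (euler j F).
Proof. by move=> zF; apply: zero_modeM; [exact: zero_mode_yfac|exact: zero_mode_dzb]. Qed.

Lemma eulerZ j c f z : zero_mode f -> D z -> euler j (fun z => c * f z) z = c * euler j f z.
Proof. by move=> [sf _] Dz; rewrite /euler (d_zetabarZ oD j c sf Dz) mulrCA. Qed.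

Lemma euler_cplx (k : 'I_t) F z : zero_mode F -> D z -> euler (rshift s k) F z = 0.
Proof. by move=> zF Dz; rewrite /euler dzb_cplx// mulr0. Qed.

Variable l : 'I_n -> R.
Hypothesis l_cplx : forall k : 'I_t, l (rshift s k) = 0.
Local Notation phi := (flow l (0 : V)).

Lemma flow2 x z j : (phi x z).2 0 j = expR (x * l j) * z.2 0 j.
Proof. by rewrite /= !mxE mulr0 addr0. Qed.

Lemma flow1 x z : (phi x z).1 = z.1.
Proof. by rewrite /= scaler0 addr0. Qed.

Lemma flow0 z : phi 0 z = z.
Proof.
case: z => z1 z2; congr pair => /=; first by rewrite scale0r addr0.
by apply/rowP => j; rewrite !mxE !mul0r expR0 mul1r addr0.
Qed.

Lemma OT_cover_flow x z : D z -> D (phi x z).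
Proof. by move=> Dz i; rewrite /zeta [complex.Im _]flow2 mulr_gt0 ?expR_gt0//; exact: Dz. Qed.

(** In the coordinates [log y], the mean over the segment from [log y] to [log y + l]. *)
Definition yavg F := cavg l (0 : V) (fun=> 1) F.
Local Notation c1 := (@ccontinuous_cst R 1).

Lemma flow_fibre x z v : fibre_dir v -> exists2 v', fibre_dir v' & phi x (z + v) = phi x z + v'.
Proof.
move=> v0; exists (flow_tan l x v) => [i|]; first by rewrite /= mxE v0 mulr0.
congr pair; rewrite /= ?scaler0 ?addr0//.
by apply/rowP => j; rewrite !mxE mulrDr.
Qed.

Lemma zero_mode_yavg F : zero_mode F -> zero_mode (yavg F).
Proof.
move=> [sF cF]; split; first exact: (smooth_cavg oD OT_cover_flow c1 sF).
move=> v z v0 Dz; apply: eq_cint => x; have [v' v'0 ->] := flow_fibre x z v0.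
by rewrite cF//; exact: OT_cover_flow.
Qed.

Lemma yavg_cderive_y j F z : smooth_on D F -> D z ->
  cderive (dir_y R j) (yavg F) z = cavg l (0 : V) (fun x => (expR (x * l j))%:C) (cderive (dir_y R j) F) z.
Proof.
move=> sF Dz; have := cderive_cavg_xy oD OT_cover_flow (rshift n j) c1 sF Dz.
rewrite /dir_xy (unsplitK (inr _)) => ->; apply: eq_cint => x.
by rewrite /flow_rate (unsplitK (inr _)) mul1r.
Qed.

Lemma expR_ccont (b : R) : ccontinuous (fun x => (expR (x * b))%:C).
Proof.
split; last by move=> x; exact: cvg_cst.
move=> x; apply: (cvg_comp _ expR); last exact: continuous_expR.
by apply: cvgM; [exact: cvg_id|exact: cvg_cst].
Qed.

(** [y d/dy] is invariant under scaling of [y]: the factor [expR (x * l j)] produced by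
    differentiation is absorbed by [yfac] at the flowed point. *)
Lemma euler_yavg j F z : zero_mode F -> D z -> euler j (yavg F) z = yavg (euler j F) z.
Proof.
move=> zF Dz; move: j; apply: ord_sumP => [i|k]; last first.
  rewrite euler_cplx//; last exact: zero_mode_yavg.
  rewrite /yavg /cavg (eq_cint (g := fun=> 0)) ?cint_cst// => x.
  by rewrite euler_cplx ?mulr0//; exact: OT_cover_flow.
have [sF cF] := zF; have sdF := smooth_cderive (dir_y R (lshift t i)) sF.
rewrite /euler dzb_real ?yavg_cderive_y//; last exact: zero_mode_yavg.
have ce := expR_ccont (l (lshift t i)).
rewrite mulrA -(cavgZ OT_cover_flow _ ce sdF Dz); apply: eq_cint => x.
rewrite dzb_real//; last exact: OT_cover_flow.
rewrite !yfac_real flow2 rmorphM; move: (cderive _ _ _) => a; ring.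
Qed.

(* With [d_zetabar] acting as [(i/2) d/dy] on zero modes, this is the derivative of
   [F] along the flow integrated over [[0, 1]]. *)
Lemma yavg_euler F z : zero_mode F -> D z ->
  \sum_j (- 2 * 'i) * (l j)%:C * yavg (euler j F) z = F (phi 1 z) - F z.
Proof.
move=> zF Dz; have [sF cF] := zF.
pose G z := \sum_j (- 2 * 'i) * (l j)%:C * euler j F z.
have zG : zero_mode G by apply: zero_mode_sum => j _; apply/zero_modeZ/zero_mode_euler.
have GE y : D y -> G y = \sum_j (l j * y.2 0 j)%:C * cderive (dir_y R j) F y.
  move=> Dy; apply: eq_bigr => j _; move: j; apply: ord_sumP => [i|k]; last first.
    by rewrite l_cplx mulr0 mul0r mul0r mul0r.
  rewrite /euler dzb_real// yfac_real rmorphM.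
  have i2 : 'i * 'i = -1 :> R[i] by rewrite -expr2 sqr_i.
  move: (cderive _ _ _) => a.
  transitivity ((2 * 2^-1) * (- ('i * 'i)) * ((l (lshift t i))%:C * (y.2 0 (lshift t i))%:C * a)).
    move: ('i : R[i]) => I; ring.
  by rewrite i2 opprK mulr1 mulfV ?mul1r ?pnatr_eq0.
transitivity (cint (fun x => G (phi x z))).
  transitivity (yavg G z); last by apply: eq_cint => x; rewrite mul1r.
  rewrite /G /yavg (cavg_sum OT_cover_flow _ c1) //; last by move=> j; have [] := zero_modeZ ((- 2 * 'i) * (l j)%:C) (zero_mode_euler j zF).
  apply: eq_bigr => j _; rewrite (cavgZ OT_cover_flow _ c1) //.
  by have [] := zero_mode_euler j zF.
have ccG : ccontinuous (fun x => G (phi x z)).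
  rewrite (_ : (fun _ => _) = fun x => 1 * G (phi x z)); last by apply/funext => x; rewrite mul1r.
  by apply: (cavg_icont OT_cover_flow c1) => //; case: zG.
rewrite (@cint_FTC _ (fun x : R => F (phi x z))) //.
  by rewrite flow0.
move=> x.
have H (h : V -> R) : Ck_on 1 D h ->
    is_derive x 1 (fun x => h (phi x z)) (\sum_j (l j * (phi x z).2 0 j) * 'D_(dir_y R j) h (phi x z)).
  move=> ch; apply: is_derive_shift0.
  (* Coordinates of the displacement [phi (x + y) z - phi x z], so that the chain rule
     [is_derive_xy] applies at [phi x z]. *)
  pose c (i : 'I_(n + n)) (y : R) : R := match fintype.split i with inl _ => 0
    | inr j => (phi x z).2 0 j * (expR (y * l j) - 1) end.
  pose c' (i : 'I_(n + n)) : R := match fintype.split i with inl _ => 0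
    | inr j => l j * (phi x z).2 0 j end.
  have := @is_derive_xy R n D oD h (phi x z) c c' ch (OT_cover_flow x Dz).
  have cE y i : c i y = coord_xy (phi (x + y) z - phi x z) i.
    rewrite /c /coord_xy; case: fintype.split => j.
      have -> : (phi (x + y) z - phi x z).1 = (phi (x + y) z).1 - (phi x z).1 by [].
      by rewrite !flow1 subrr mxE.
    have -> : (phi (x + y) z - phi x z).2 0 j = (phi (x + y) z).2 0 j - (phi x z).2 0 j.
      rewrite [LHS]mxE; congr (_ + _); exact: mxE.
    rewrite !flow2 mulrDl expRD; ring.
  have E y : phi x z + \sum_i c i y *: dir_xy R i = phi (x + y) z.
    by rewrite (eq_bigr _ (fun i _ => congr1 (fun a => a *: dir_xy R i) (cE y i))) -dir_xy_sum addrC subrK.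
  have -> : \sum_i c' i * 'D_(dir_xy R i) h (phi x z) = \sum_j l j * (phi x z).2 0 j * 'D_(dir_y R j) h (phi x z).
    pose T (a : 'I_n + 'I_n) := match a with inl _ => 0 | inr j => l j * (phi x z).2 0 j * 'D_(dir_y R j) h (phi x z) end.
    rewrite (eq_bigr (fun i => T (fintype.split i))); last first.
      by move=> i _; rewrite /c' /T /dir_xy; case: fintype.split => j //; rewrite mul0r.
    by rewrite sum_xy /T big1 ?add0r.
  rewrite (_ : (fun h0 => _) = fun y => h (phi (x + y) z)); last by apply/funext => y; rewrite E.
  apply=> i.
    by rewrite /c; case: fintype.split => // j; rewrite mul0r expR0 subrr mulr0.
  rewrite /c /c'; case: fintype.split => j; first exact: is_derive_cst.
  have d1 : is_derive (0 : R) 1 (fun y => y * l j) (l j).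
    rewrite (_ : (fun y => _) = *%R (l j)); last by apply/funext => y; rewrite mulrC.
    exact: is_derive_mull.
  have d2 := @is_derive1_comp _ expR (fun y => y * l j) 0 _ _ (is_derive_expR _) d1.
  have d3 := is_deriveZ ((phi x z).2 0 j) (is_deriveB d2 (is_derive_cst (1 : R) (0 : R) (1 : R))).
  apply: is_derive_eq d3 _.
  by rewrite mul0r expR0 mul1r subr0 [LHS]mulrC.
have [/H h1 /H h2] := sF 1; have Dx := OT_cover_flow x Dz; split.
  apply: is_derive_eq h1 _; rewrite (GE _ Dx) Re_sum; apply: eq_bigr => j _.
  by rewrite ReM mul0r subr0 Re_cderive.
apply: is_derive_eq h2 _; rewrite (GE _ Dx) Im_sum; apply: eq_bigr => j _.
by rewrite ImM mul0r addr0 Im_cderive.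
Qed.

End ScalingFlow.

Section ZeroModeHomotopy.
Variables (R : realType) (s t : nat).
Local Notation n := (s + t)%N.
Local Notation V := ('rV[R]_n * 'rV[R]_n)%type.
Local Notation D := (@OT_cover R s t).
Local Notation oD := (@OT_cover_open R s t).
Local Notation zmode := (@zero_mode R s t).
Implicit Types (F : V -> R[i]) (z v : V) (B C : {set 'I_n}) (W : {set 'I_n} -> V -> R[i]).

Definition Yp C z : R[i] := \prod_(j in C) yfac j z.

Lemma zero_mode_Yp C : zmode (Yp C).
Proof. by apply: zero_mode_prod => j _; exact: zero_mode_yfac. Qed.

Lemma zero_mode_YpV C : zmode (fun z => (Yp C z)^-1).
Proof.
rewrite (_ : (fun _ => _) = fun z => \prod_(j in C) (yfac j z)^-1).
  by apply: zero_mode_prod => j _; exact: zero_mode_yfacV.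
by apply/funext => z; rewrite /Yp prodfV.
Qed.

Lemma Yp_neq0 C z : D z -> Yp C z != 0.
Proof. by move=> Dz; apply/prodf_neq0 => j _; exact: yfac_neq0. Qed.

Lemma Yp_indep C i (x : R) z : i \notin C ->
  Yp C (x *: dir_x R i + z) = Yp C z /\ Yp C (x *: dir_y R i + z) = Yp C z.
Proof.
move=> iC; split; apply: eq_bigr => j jC; rewrite /yfac; case: fintype.split => // _;
  congr (_%:C); rewrite /= !mxE.
  by rewrite mulr0 add0r.
have ij : j != i by apply: contraNneq iC => <-.
by rewrite (negbTE ij) andbF mulr0 add0r.
Qed.

Lemma dzb_Yp C i F z : i \notin C -> zmode F -> D z ->
  d_zetabar i (fun z => Yp C z * F z) z = Yp C z * d_zetabar i F z.
Proof.
move=> iC [sF _] Dz; have [sY _] := zero_mode_Yp C.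
rewrite (d_zetabarM i sY sF Dz) {1}/d_zetabar !cderive_indep ?mulr0 ?addr0 ?mulr0 ?mul0r ?add0r//.
  by move=> x; case: (Yp_indep x z iC).
by move=> x; case: (Yp_indep x z iC).
Qed.

Lemma dzb_YpV C i F z : i \notin C -> zmode F -> D z ->
  d_zetabar i (fun z => (Yp C z)^-1 * F z) z = (Yp C z)^-1 * d_zetabar i F z.
Proof.
move=> iC [sF _] Dz; have [sY _] := zero_mode_YpV C.
rewrite (d_zetabarM i sY sF Dz) {1}/d_zetabar !cderive_indep ?mulr0 ?addr0 ?mulr0 ?mul0r ?add0r//.
  by move=> x; case: (Yp_indep x z iC) => _ ->.
by move=> x; case: (Yp_indep x z iC) => -> _.
Qed.

Lemma euler_cderiv0 i z : euler i (fun=> 0 : R[i]) z = 0.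
Proof. by rewrite /euler d_zetabar_cst mulr0. Qed.

(** [Yp (B :\ i)] does not involve coordinate [i], so it passes through [d_zetabar i], and the
    factor [yfac i] in [euler] completes it to [Yp B]. *)
Lemma koszul_euler a W B z : (forall B, zmode (W B)) -> D z ->
  koszul_d a (@euler R s t) (fun B z => Yp B z * W B z) B z =
  Yp B z * koszul_d a (@d_zetabar R n) W B z.
Proof.
move=> zW Dz; rewrite /koszul_d mulr_sumr; apply: eq_bigr => i iB.
rewrite /euler dzb_Yp ?inE ?eqxx// [RHS]mulrCA; congr (_ * _).
by rewrite mulrA /Yp (big_setD1 i iB).
Qed.

Lemma koszul_eulerV a W B z : (forall B, zmode (W B)) -> D z ->
  koszul_d a (@d_zetabar R n) (fun B z => (Yp B z)^-1 * W B z) B z =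
  (Yp B z)^-1 * koszul_d a (@euler R s t) W B z.
Proof.
move=> zW Dz; rewrite /koszul_d mulr_sumr; apply: eq_bigr => i iB.
rewrite /euler dzb_YpV ?inE ?eqxx// [RHS]mulrCA; congr (_ * _).
have -> : Yp B z = yfac i z * Yp (B :\ i) z by rewrite {1}/Yp (big_setD1 i iB).
by rewrite invfM mulrACA mulVf ?mul1r// yfac_neq0.
Qed.

Variables (l : 'I_n -> R) (c : R[i]).
Hypothesis l_cplx : forall k : 'I_t, l (rshift s k) = 0.
Local Notation phi := (flow l (0 : V)).

(** The weights are those of [yavg_euler], so that the Koszul homotopies of all [j] add up to [c]
    times the variation of [W] over time one of the flow. In the application [c] is the inverse of
    [chi u - 1]. *)
Definition ypr j F z : R[i] := (c * (- 2 * 'i) * (l j)%:C) * yavg l F z.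

Lemma zero_mode_ypr j F : zmode F -> zmode (ypr j F).
Proof. by move=> zF; apply: zero_modeZ; exact: zero_mode_yavg. Qed.

Lemma ypr_ext j F G z : (forall z, D z -> F z = G z) -> D z -> ypr j F z = ypr j G z.
Proof.
move=> FG Dz; congr (_ * _); exact: (cavg_ext (@OT_cover_flow R s t l)).
Qed.

Lemma yprD j F G z : zmode F -> zmode G -> D z ->
  ypr j (fun z => F z + G z) z = ypr j F z + ypr j G z.
Proof.
move=> [sF _] [sG _] Dz; rewrite /ypr /yavg (cavgD (@OT_cover_flow R s t l) (@ccontinuous_cst R 1) sF sG Dz).
exact: mulrDr.
Qed.

Lemma yprZ j b F z : zmode F -> D z -> ypr j (fun z => b * F z) z = b * ypr j F z.
Proof.
move=> [sF _] Dz; rewrite /ypr /yavg (cavgZ (@OT_cover_flow R s t l) b (@ccontinuous_cst R 1) sF Dz).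
exact: mulrCA.
Qed.

Lemma ypr0 j F z : (forall z, D z -> F z = 0) -> D z -> ypr j F z = 0.
Proof.
move=> F0 Dz; transitivity (ypr j (fun z => 0 * 0) z).
  by apply: ypr_ext => // y Dy; rewrite mul0r F0.
by rewrite yprZ ?mul0r//; exact: zero_mode_cst.
Qed.

Lemma euler_ypr i j F z : zmode F -> D z -> euler i (ypr j F) z = ypr j (euler i F) z.
Proof.
move=> zF Dz; rewrite eulerZ//; last exact: zero_mode_yavg.
by rewrite euler_yavg.
Qed.

Lemma zero_mode_homotopy a W B z : (forall B, zmode (W B)) -> D z ->
  \sum_j (koszul_d a (@euler R s t) (koszul_h a (ypr j) j W) B z +
          koszul_h a (ypr j) j (koszul_d a (@euler R s t) W) B z) =
  c * (W B (phi 1 z) - W B z).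
Proof.
move=> zW Dz; rewrite -(yavg_euler l_cplx (zW B) Dz) mulr_sumr; apply: eq_bigr => j _.
rewrite (@koszul_homotopy _ n a _ D zmode (@zero_modeD R s t) (@zero_modeZ R s t) (zero_mode_cst s t 0)
  (@euler R s t) (ypr j) j (@zero_mode_euler R s t) (ypr_ext j) (yprD j) (yprZ j)
  (fun i f z zf Dz => @euler_ypr i j f z zf Dz) W zW B z Dz).
- rewrite euler_ypr// /ypr !mulrA; congr (_ * _); ring.
- by move=> i b F zF; apply: eulerZ => //; exact: zero_mode_ypr.
- by move=> i; exact: euler_cderiv0.
Qed.

Definition ypr_sum a W C z : R[i] := \sum_j koszul_h a (ypr j) j W C z.

Lemma zero_mode_ypr_sum a W C : (forall B, zmode (W B)) -> zmode (ypr_sum a W C).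
Proof.
move=> zW; apply: zero_mode_sum => j _; rewrite /koszul_h.
case: (j \in C); first exact: zero_mode_cst.
by apply: zero_modeZ; exact: zero_mode_ypr.
Qed.

Lemma ypr_sum_primitive a W B z : (forall B, zmode (W B)) ->
  (forall B z, D z -> koszul_d a (@euler R s t) W B z = 0) -> D z ->
  koszul_d a (@euler R s t) (ypr_sum a W) B z = c * (W B (phi 1 z) - W B z).
Proof.
move=> zW cW Dz; rewrite -(zero_mode_homotopy a B zW Dz).
rewrite big_split /= [X in _ = _ + X]big1 ?addr0; last first.
  move=> j _; rewrite /koszul_h; case: ifP => // _; rewrite ypr0 ?mulr0// => y Dy.
  exact: cW.
rewrite /koszul_d exchange_big /=; apply: eq_bigr => i iB.
rewrite -mulr_sumr; congr (_ * _); rewrite /euler -mulr_sumr; congr (_ * _).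
apply: (d_zetabar_sum oD) => // j _.
rewrite /koszul_h; case: (j \in B :\ i); first by case: (zero_mode_cst s t (0 : R[i])).
by have [] := zero_modeZ (dsign _ a (j |: B :\ i) j) (zero_mode_ypr j (zW (j |: B :\ i))).
Qed.

End ZeroModeHomotopy.

Section ZeroModeCohomology.
Variables (R : realType) (s t : nat) (K : fieldExtType rat).
Variable sigma : 'I_(s + t + t) -> {rmorphism K -> R[i]}.
Variables (U : set K) (rho : K -> R[i]).
Hypotheses (sigmaP : OT_embeddings sigma) (UP : OT_group sigma U) (rhoP : U_character U rho).
Local Notation n := (s + t)%N.
Local Notation V := ('rV[R]_n * 'rV[R]_n)%type.
Local Notation Re := (@complex.Re R).
Local Notation D := (@OT_cover R s t).
Local Notation zmode := (@zero_mode R s t).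
Local Notation form := (cform R n).
Implicit Types (F : V -> R[i]) (z : V) (A B C : {set 'I_n}) (w : form) (p q : nat) (a u : K).

Definition cpx C : {set 'I_t} := finset.finset (fun k => rshift s k \in C).

Definition logu u (j : 'I_n) : R :=
  match fintype.split j with inl i => ln (Re (sig_real sigma i u)) | inr _ => 0 end.

Lemma logu_cplx u (k : 'I_t) : logu u (rshift s k) = 0.
Proof. by rewrite /logu (unsplitK (inr _)). Qed.

Definition cplx_norm C u : R[i] := \prod_(k in cpx C) (sig_coord sigma (rshift s k) u)^*.

(** The character by which [u] acts on [Yp C] times the coefficient at [(A, C)]. The real embeddings
    belonging to [C] are absorbed by [Yp C], so only [cpx C] enters, and adding or removing a real
    index leaves [chi] unchanged. *)
Definition chi A C u : R[i] := rho u / ((\prod_(j in A) sig_coord sigma j u) * cplx_norm C u).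

Lemma cpx_setU1 C (i : 'I_s) : cpx (lshift t i |: C) = cpx C.
Proof. by apply/finset.setP => k; rewrite !inE eq_rlshift. Qed.

Lemma cpx_setD1 C (i : 'I_s) : cpx (C :\ lshift t i) = cpx C.
Proof. by apply/finset.setP => k; rewrite !inE eq_rlshift. Qed.

Lemma chi_cpx A B C u : cpx B = cpx C -> chi A B u = chi A C u.
Proof. by rewrite /chi /cplx_norm => ->. Qed.

Lemma prod_ord_set (F : 'I_n -> R[i]) C : \prod_(j in C) F j =
  (\prod_(i : 'I_s | lshift t i \in C) F (lshift t i)) * \prod_(k in cpx C) F (rshift s k).
Proof.
rewrite big_mkcond big_split_ord -!big_mkcond /=; congr (_ * _).
by apply: eq_bigl => k; rewrite inE.
Qed.

Lemma conj_real (i : 'I_s) u : (sig_coord sigma (lshift t i) u)^* = (Re (sig_real sigma i u))%:C.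
Proof. by rewrite (real_emb sigmaP); apply: complex_eqP => //=; rewrite oppr0. Qed.

Lemma Yp_ulin C a z : Yp C (ulin sigma a z) * cplx_norm C a =
  Yp C z * \prod_(j in C) (sig_coord sigma j a)^*.
Proof.
rewrite /Yp !(prod_ord_set _ C) /cplx_norm.
have -> : \prod_(i : 'I_s | lshift t i \in C) yfac (lshift t i) (ulin sigma a z) =
    (\prod_(i : 'I_s | lshift t i \in C) (sig_coord sigma (lshift t i) a)^*) *
    \prod_(i : 'I_s | lshift t i \in C) yfac (lshift t i) z.
  rewrite -big_split; apply: eq_bigr => i _ /=.
  rewrite !yfac_real (ulin_real sigmaP) rmorphM; congr (_ * _); symmetry; exact: conj_real.
have E y : \prod_(k in cpx C) yfac (rshift s k) y = 1 :> R[i].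
  by apply: big1 => k _; rewrite yfac_cplx.
rewrite !E; move: (\prod_(i | _) _) (\prod_(i | _) _) (\prod_(k in _) _) => x y c; ring.
Qed.

(** On real coordinates both maps scale by real numbers; on complex ones the flow is the
    identity. *)
Lemma flow_ulin u a (x : R) z :
  flow (logu u) (0 : V) x (ulin sigma a z) = ulin sigma a (flow (logu u) (0 : V) x z).
Proof.
have pairE (p q : V) : p.1 = q.1 -> p.2 = q.2 -> p = q by case: p q => [? ?] [? ?] /= -> ->.
have zE y j : zeta (flow (logu u) (0 : V) x y) j = y.1 0 j +i* (expR (x * logu u j) * y.2 0 j).
  by rewrite /zeta flow1 flow2.
apply: pairE; apply/rowP => j; rewrite ?flow1 ?flow2 !mxE !zE /zeta; move: j; apply: ord_sumP => [i|k].
- by rewrite !ReM (real_emb sigmaP) /=; ring.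
- by rewrite logu_cplx mulr0 expR0 mul1r.
- by rewrite !ImM (real_emb sigmaP) /=; ring.
by rewrite logu_cplx mulr0 expR0 !mul1r.
Qed.

(** The time-one flow of [logu u] and the action of [u] have the same effect on every [Im w_i], so
    their values differ by a fibre direction. *)
Lemma flow1_ulin u F z : U u -> zmode F -> D z ->
  F (flow (logu u) (0 : V) 1 z) = F (ulin sigma u z).
Proof.
move=> Uu [_ cF] Dz; set p := flow _ _ _ _.
rewrite -(subrK p (ulin sigma u z)) addrC cF//; last exact: OT_cover_flow.
move=> i; have -> : (ulin sigma u z - p).2 0 (lshift t i) = (ulin sigma u z).2 0 (lshift t i) - p.2 0 (lshift t i).
  by rewrite [LHS]mxE; congr (_ + _); exact: mxE.
rewrite (ulin_real sigmaP) flow2 mul1r /logu (unsplitK (inl _)) lnK ?subrr//.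
exact: (emb_gt0 (OT_sub UP Uu)).
Qed.

Lemma emb_prod_neq0 A a : U a -> \prod_(j in A) sig_coord sigma j a != 0.
Proof. by move=> /(OT_sub UP)[[a0 _ _] _]; apply/prodf_neq0 => j _; rewrite fmorph_eq0. Qed.

Lemma cplx_norm_neq0 C a : U a -> cplx_norm C a != 0.
Proof. by move=> /(OT_sub UP) pa; apply/prodf_neq0 => j _; exact: (ulin_neq0 pa). Qed.

Lemma equiv_cancel (y y' c g g' pA r : R[i]) : y != 0 -> y' != 0 -> c != 0 -> pA != 0 ->
  forall pB, y' * c = y * pB ->
  (g' * pA * pB = r * g <-> y' * g' = r / (pA * c) * (y * g)).
Proof.
move=> y0 y'0 c0 A0 pB E; have -> : pB = y' * c / y by rewrite E mulrAC mulfV ?mul1r.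
split=> [H|H].
  have -> : r / (pA * c) * (y * g) = (r * g) * y / (pA * c) by ring.
  by rewrite -H; field; rewrite y0 A0 c0.
have -> : g' * pA * (y' * c / y) = (y' * g') * pA * c / y by ring.
by rewrite H; field; rewrite y0 A0 c0.
Qed.

Lemma equivariant_Yp A B (f : V -> R[i]) a z : U a -> D z ->
  f (ulin sigma a z) * (\prod_(j in A) sig_coord sigma j a) * (\prod_(j in B) (sig_coord sigma j a)^*)
    = rho a * f z <->
  Yp B (ulin sigma a z) * f (ulin sigma a z) = chi A B a * (Yp B z * f z).
Proof.
move=> Ua Dz; apply: equiv_cancel.
- exact: Yp_neq0.
- by apply: Yp_neq0; exact: (OT_cover_ulin sigmaP (OT_sub UP Ua)).
- exact: cplx_norm_neq0.
- exact: emb_prod_neq0.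
- exact: Yp_ulin.
Qed.

(** When [chi] is trivial this is [1], and the coefficient [(chi - 1)^-1] below is
    [0^-1 = 0]. *)
Definition pick_unit A C : K := xget 1 [set u | U u /\ chi A C u != 1].

Lemma pick_unitU A C : U (pick_unit A C).
Proof. by rewrite /pick_unit; case: xgetP => [u _ []//|_]; exact: (OT_one UP). Qed.

Lemma pick_unitP A C : (exists2 u, U u & chi A C u != 1) -> chi A C (pick_unit A C) != 1.
Proof. by move=> [u Uu cu]; rewrite /pick_unit; case: xgetP => [v _ []//|/(_ u)[]]. Qed.

Definition Yform w A B z : R[i] := Yp B z * w A B z.

(** Under the time-one flow [Yform w] is multiplied by [chi], so the averaged homotopy produces the
    factor [chi - 1], which the constant cancels; dividing by [Yp] returns to coefficients of
    [dzetabar]. *)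
Definition zero_mode_prim w : form := fun A C z =>
  (Yp C z)^-1 * ypr_sum (logu (pick_unit A C)) ((chi A C (pick_unit A C) - 1)^-1)
    #|A| (Yform w A) C z.

Lemma zero_mode_Yform w A B : zmode (w A B) -> zmode (Yform w A B).
Proof. by move=> zw; apply: zero_modeM => //; exact: zero_mode_Yp. Qed.

Lemma zero_mode_OK F : zmode F -> OK_smooth sigma F.
Proof.
by move=> [sF cF]; split=> // b _ z Dz; apply: cF => //; exact: (tvec_fibre sigmaP).
Qed.

Lemma zero_mode_zero_mode_prim w A C : (forall A B, zmode (w A B)) -> zmode (zero_mode_prim w A C).
Proof.
move=> zw; apply: zero_modeM; first exact: zero_mode_YpV.
by apply: zero_mode_ypr_sum => B; exact: zero_mode_Yform.
Qed.

Lemma pick_unit_cpx A B C : cpx B = cpx C -> pick_unit A B = pick_unit A C.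
Proof.
move=> BC; rewrite /pick_unit; congr xget; apply/funext => u.
by rewrite /= (chi_cpx A u BC).
Qed.

Lemma zero_mode_prim_cochain p q w : cochain sigma U rho (fun A B => (#|A| == p) && (#|B| == q)) w ->
  (forall A B, zmode (w A B)) ->
  cochain sigma U rho (fun A B => (#|A| == p) && (#|B|.+1 == q)) (zero_mode_prim w).
Proof.
move=> [ow ew dw] zw; split.
- by move=> A B; apply: zero_mode_OK; exact: zero_mode_zero_mode_prim.
- move=> a Ua A C z Dz; have Da := OT_cover_ulin sigmaP (OT_sub UP Ua) Dz.
  apply/equivariant_Yp => //; rewrite /zero_mode_prim !mulVKf ?Yp_neq0//.
  set u := pick_unit _ _; set c := _^-1; rewrite /ypr_sum mulr_sumr; apply: eq_bigr => j _.
  rewrite /koszul_h; case: ifPn => [_|]; first by rewrite mulr0.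
  (* Complex indices contribute nothing because [logu] vanishes there; adding a real index preserves
     [chi]. *)
  move: j; apply: ord_sumP => [i jC|k jC]; last first.
    by rewrite /ypr logu_cplx !mulr0 !mul0r !mulr0.
  rewrite [RHS]mulrCA; congr (_ * _); rewrite /ypr [RHS]mulrCA; congr (_ * _).
  have zW := zero_mode_Yform (zw A (lshift t i |: C)).
  rewrite /yavg -(cavgZ (@OT_cover_flow R s t _) _ (@ccontinuous_cst R 1) _ Dz); last by case: zW.
  apply: eq_cint => x; congr (_ * _); rewrite flow_ulin.
  have Dx := OT_cover_flow (logu u) x Dz.
  have /(equivariant_Yp _ _ _ Ua Dx) := ew a Ua A (lshift t i |: C) _ Dx.
  by rewrite (chi_cpx A a (cpx_setU1 C i)).
move=> A C z Dz nd; rewrite /zero_mode_prim /ypr_sum big1 ?mulr0// => j _.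
rewrite /koszul_h; case: ifPn => // jC; rewrite ypr0 ?mulr0// => y Dy.
by rewrite /Yform dw ?mulr0// cardsU1 jC.
Qed.

Lemma zero_mode_primP w : 
  (forall a, U a -> forall A B z, D z ->
    w A B (ulin sigma a z) * (\prod_(j in A) sig_coord sigma j a) *
      (\prod_(j in B) (sig_coord sigma j a)^*) = rho a * w A B z) ->
  (forall A B, zmode (w A B)) -> form_eq D (dbar w) (fun _ _ _ => 0) ->
  (forall A B, (exists2 u, U u & chi A B u != 1) \/ (forall z, D z -> w A B z = 0)) ->
  form_eq D w (dbar (zero_mode_prim w)).
Proof.
move=> ew zw cw xw A B z Dz.
set u := pick_unit A B; set c := (chi A B u - 1)^-1.
have zW C : zmode (Yform w A C) by exact: zero_mode_Yform.
have zG C := zero_mode_ypr_sum (logu u) c #|A| C zW.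
have -> : dbar (zero_mode_prim w) A B z =
    koszul_d #|A| (@d_zetabar R n) (fun C z => (Yp C z)^-1 * ypr_sum (logu u) c #|A| (Yform w A) C z) B z.
  (* The coefficient at [B :\ j] comes with its own unit. For real [j] that unit is the one of [B];
     for complex [j] both derivatives vanish, the functions being constant along the fibres. *)
  rewrite dbarE /koszul_d; apply: eq_bigr => j jB; apply: congr1.
  move: j jB; apply: ord_sumP => [i|k] jB; last first.
    have z1 := zero_mode_zero_mode_prim A (B :\ rshift s k) zw.
    have z2 := zero_modeM (zero_mode_YpV R (B :\ rshift s k)) (zG (B :\ rshift s k)).
    transitivity (0 : R[i]); first exact: (dzb_cplx k z1 Dz).
    symmetry; exact: (dzb_cplx k z2 Dz).
  apply: (congr1 (fun f => d_zetabar (lshift t i) f z)).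
  by rewrite /zero_mode_prim (pick_unit_cpx A (cpx_setD1 B i)) (chi_cpx A _ (cpx_setD1 B i)).
rewrite koszul_eulerV// ypr_sum_primitive//; first last.
- move=> C y Dy; rewrite koszul_euler//.
  by have := cw A C y Dy; rewrite dbarE => ->; rewrite mulr0.
- exact: logu_cplx.
rewrite (flow1_ulin (pick_unitU A B) (zW B) Dz).
have /(equivariant_Yp _ _ _ (pick_unitU A B) Dz) E := ew _ (pick_unitU A B) A B z Dz.
rewrite [Yform w A B (ulin _ _ _)]E -/u -/(Yform w A B z).
have [/pick_unitP cu|w0] := xw A B; last by rewrite /Yform w0// !mulr0 subrr !mulr0.
rewrite -[X in _ - X]mul1r -mulrBl mulKf ?subr_eq0//.
by rewrite /Yform mulKf// Yp_neq0.
Qed.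

End ZeroModeCohomology.

(** * Vanishing of the cohomology and the necessary condition on the character *)

Section Vanishing.
Variables (R : realType) (s t : nat) (K : fieldExtType rat).
Variable sigma : 'I_(s + t + t) -> {rmorphism K -> R[i]}.
Variables (U : set K) (rho : K -> R[i]).
Hypotheses (sigmaP : OT_embeddings sigma) (UP : OT_group sigma U) (rhoP : U_character U rho).
Local Notation n := (s + t)%N.
Local Notation V := ('rV[R]_n * 'rV[R]_n)%type.
Local Notation D := (@OT_cover R s t).
Local Notation zmode := (@zero_mode R s t).
Local Notation form := (cform R n).
Implicit Types (A B C : {set 'I_n}) (w : form) (p q : nat) (u : K).

Definition rpart A : {set 'I_s} := finset.finset (fun i => lshift t i \in A).

Definition cat_set (I : {set 'I_s}) (M : {set 'I_t}) : {set 'I_n} :=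
  finset.finset (fun j => match fintype.split j with inl i => i \in I | inr k => k \in M end).

Lemma rpart_cat I M : rpart (cat_set I M) = I.
Proof. by apply/finset.setP => i; rewrite !inE (unsplitK (inl _)). Qed.

Lemma cpx_cat I M : cpx (cat_set I M) = M.
Proof. by apply/finset.setP => i; rewrite !inE (unsplitK (inr _)). Qed.

Lemma card_parts A : #|A| = (#|rpart A| + #|cpx A|)%N.
Proof.
rewrite -!sum1_card [LHS]big_mkcond big_split_ord -!big_mkcond /=.
by congr (_ + _)%N; apply: eq_bigl => i; rewrite inE.
Qed.

Lemma sig_conjE (k : 'I_t) u : (sig_coord sigma (rshift s k) u)^* = sig_conj sigma k u.
Proof.
have := OT_conjugate sigmaP k u; rewrite /sig_coord -/(sig_cplx sigma k) => ->.
by case: (sig_conj sigma k u) => x y; rewrite /= opprK.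
Qed.

Lemma chi_eq1 A B u : U u -> (chi sigma rho A B u == 1) =
  (rho u == (\prod_(i in rpart A) sig_real sigma i u) *
            (\prod_(k in cpx A) sig_cplx sigma k u) *
            (\prod_(l in cpx B) sig_conj sigma l u)).
Proof.
move=> Uu.
have -> : (\prod_(i in rpart A) sig_real sigma i u) * (\prod_(k in cpx A) sig_cplx sigma k u)
    = \prod_(j in A) sig_coord sigma j u.
  by rewrite (prod_ord_set _ A); congr (_ * _); apply: eq_bigl => i; rewrite inE.
have -> : \prod_(l in cpx B) sig_conj sigma l u = cplx_norm sigma B u.
  by apply: eq_bigr => k _; rewrite -sig_conjE.
rewrite /chi; have d0 := mulf_neq0 (emb_prod_neq0 UP A Uu) (cplx_norm_neq0 UP B Uu).
by rewrite -(inj_eq (mulIf d0)) mulfVK// mul1r.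
Qed.

Lemma chi_formula A B : (forall u, U u -> chi sigma rho A B u = 1) <->
  rho_formula sigma U rho (rpart A) (cpx A) (cpx B).
Proof.
by split=> H u Uu; apply/eqP; [rewrite -chi_eq1// H|rewrite chi_eq1// H].
Qed.

Lemma cochainD dg v v' : cochain sigma U rho dg v -> cochain sigma U rho dg v' ->
  cochain sigma U rho dg (fun A B z => v A B z + v' A B z).
Proof.
move=> [ov ev dv] [ov' ev' dv']; split.
- by move=> A B; exact: OK_D.
- by move=> a Ua A B z Dz; rewrite !mulrDl ev// ev'// mulrDr.
by move=> A B z Dz nd; rewrite dv// dv'// addr0.
Qed.

Lemma red_form_zero_mode red prim (k : 'I_t) w A B :
  reduction sigma (@d_zetabar R n (rshift s k)) red prim ->
  (forall A B, OK_smooth sigma (w A B)) -> zmode (red_form red w A B).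
Proof.
move=> rP ow; split; last exact: (red_const rP).
by have [] := red_OK rP (ow A B).
Qed.

(** Two primitives are added: [prim_form] accounts for [w - red_form w], and [zero_mode_prim] for
    the closed form [red_form w]. *)
Lemma closed_exact p q w (k : 'I_t) : E_closed sigma U rho p q w ->
  (forall A B, #|A| = p -> #|B| = q -> exists2 u, U u & chi sigma rho A B u != 1) ->
  E_exact sigma U rho p q w.
Proof.
move=> [/(E_formP sigmaP UP rhoP) cw dw] xw.
have [red [prim rP]] := exists_reduction k sigmaP.
have ow := coch_OK cw.
have crw := red_form_cochain sigmaP UP rP cw.
have zrw A B := red_form_zero_mode A B rP ow.
have drw : form_eq D (dbar (red_form red w)) (fun _ _ _ => 0).
  move=> A B z Dz; rewrite (red_dbar rP)//; apply: (red0 rP) Dz => [|y Dy]; last exact: dw.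
  exact: OK_dbar.
have xrw A B : (exists2 u, U u & chi sigma rho A B u != 1) \/ (forall z, D z -> red_form red w A B z = 0).
  have [/andP[/eqP Ap /eqP Bq]|nd] := boolP ((#|A| == p) && (#|B| == q)); first by left; exact: xw.
  by right=> z Dz; exact: (coch_degree crw).
apply: (E_exact_of sigmaP UP rhoP (v := fun A B z => prim_form k prim w A B z +
  zero_mode_prim sigma U rho (red_form red w) A B z)).
  apply: cochainD; first exact: (prim_form_cochain sigmaP UP rP cw).
  exact: (zero_mode_prim_cochain sigmaP UP crw zrw).
have op := coch_OK (prim_form_cochain sigmaP UP rP cw).
have oz := coch_OK (zero_mode_prim_cochain sigmaP UP crw zrw).
move=> A B z Dz; rewrite (dbarD A B op oz Dz) (prim_form_homotopy rP ow dw A B Dz) addrC; congr (_ + _).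
exact: (zero_mode_primP sigmaP UP (coch_equiv crw) zrw drw xrw).
Qed.

(** Otherwise every pair [(A, B)] of the right degree has a unit with [chi != 1], and [closed_exact]
    applies. The triple is read off [A] and [B]; [q <= #|L| + s] holds because [B] has at most [s]
    real indices. *)
Lemma nonvanishing_formula p q (t_gt0 : (0 < t)%N) : Hpq_neq0 sigma U rho p q ->
  exists (I : {set 'I_s}) (M L : {set 'I_t}),
    [/\ (#|I| + #|M|)%N = p, (#|L| <= q <= #|L| + s)%N & rho_formula sigma U rho I M L].
Proof.
move=> [w [cw nw]]; apply: contrapT => nE; apply: nw.
apply: (closed_exact (Ordinal t_gt0) cw) => A B Ap Bq; apply: contrapT => nu.
apply: nE; exists (rpart A), (cpx A), (cpx B); split; first by rewrite -card_parts.
  rewrite -Bq (card_parts B) leq_addl /= addnC leq_add2l.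
  by rewrite -[X in (_ <= X)%N]card_ord; exact: max_card.
apply/chi_formula => u Uu; apply/eqP; apply/negPn/negP => c1.
by apply: nu; exists u.
Qed.

End Vanishing.

(** * Independence of the standard forms *)

Section Averages.
Variables (R : realType) (s t : nat) (K : fieldExtType rat).
Variable sigma : 'I_(s + t + t) -> {rmorphism K -> R[i]}.
Variables (U : set K).
Hypotheses (sigmaP : OT_embeddings sigma) (UP : OT_group sigma U).
Local Notation n := (s + t)%N.
Local Notation V := ('rV[R]_n * 'rV[R]_n)%type.
Local Notation D := (@OT_cover R s t).
Local Notation oD := (@OT_cover_open R s t).
Local Notation zmode := (@zero_mode R s t).
Local Notation logu := (@logu R s t K sigma).
Implicit Types (F G : V -> R[i]) (z : V) (u : K) (us : seq K).
Local Notation c1 := (@ccontinuous_cst R 1).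

Definition U_invariant F := forall u, U u -> forall z, D z -> F (ulin sigma u z) = F z.

(** For units whose log vectors are a basis of the lattice, this is the mean over a fundamental
    parallelotope. *)
Definition yavgs us F := foldr (fun u => yavg (logu u)) F us.

Lemma zero_mode_yavgs us F : zmode F -> zmode (yavgs us F).
Proof. by move=> zF; elim: us => //= u us IHus; exact: zero_mode_yavg. Qed.

Lemma yavg_ext u F G z : (forall z, D z -> F z = G z) -> D z -> yavg (logu u) F z = yavg (logu u) G z.
Proof. by move=> FG Dz; exact: (cavg_ext (@OT_cover_flow R s t (logu u))). Qed.

Lemma yavgs_ext us F G z : (forall z, D z -> F z = G z) -> D z -> yavgs us F z = yavgs us G z.
Proof.
move=> FG; elim: us z => [|u us IHus] z Dz /=; first exact: FG.
by apply: yavg_ext => // y Dy; exact: IHus.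
Qed.

Lemma yavg_sum u I (r : seq I) (c : I -> R[i]) (F : I -> V -> R[i]) z : (forall i, zmode (F i)) -> D z ->
  yavg (logu u) (fun z => \sum_(i <- r) c i * F i z) z = \sum_(i <- r) c i * yavg (logu u) (F i) z.
Proof.
move=> zF Dz; rewrite /yavg (cavg_sum (@OT_cover_flow R s t (logu u)) _ c1) //; last first.
  by move=> i; have [] := zero_modeZ (c i) (zF i).
apply: eq_bigr => i _; rewrite (cavgZ (@OT_cover_flow R s t (logu u)) _ c1) //.
by case: (zF i).
Qed.

Lemma yavgs_sum us I (r : seq I) (c : I -> R[i]) (F : I -> V -> R[i]) z : (forall i, zmode (F i)) -> D z ->
  yavgs us (fun z => \sum_(i <- r) c i * F i z) z = \sum_(i <- r) c i * yavgs us (F i) z.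
Proof.
move=> zF; elim: us z => //= u us IHus z Dz.
rewrite -yavg_sum//; last by move=> i; exact: zero_mode_yavgs.
by apply: yavg_ext => // y Dy; exact: IHus.
Qed.

Lemma yavgs_euler us j F z : zmode F -> D z -> euler j (yavgs us F) z = yavgs us (euler j F) z.
Proof.
move=> zF; elim: us z => //= u us IHus z Dz.
rewrite euler_yavg//; last exact: zero_mode_yavgs.
by apply: yavg_ext => // y Dy; exact: IHus.
Qed.

Lemma yavgs_cst us (c : R[i]) z : yavgs us (fun=> c) z = c.
Proof.
elim: us z => //= u us IHus z; rewrite /yavg /cavg (eq_cint (g := fun=> c)) ?cint_cst// => x.
by rewrite mul1r.
Qed.

Lemma U_invariant_yavg u F : zmode F -> U_invariant F -> U_invariant (yavg (logu u) F).
Proof.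
move=> zF iF v Uv z Dz; apply: eq_cint => x; congr (_ * _).
by rewrite (flow_ulin sigmaP) iF//; exact: OT_cover_flow.
Qed.

Lemma U_invariant_yavgs us F : zmode F -> U_invariant F -> U_invariant (yavgs us F).
Proof.
move=> zF iF; elim: us => //= u us IHus; apply: U_invariant_yavg => //.
exact: zero_mode_yavgs.
Qed.

(** The integral of the derivative along [logu u] is [F (ulin u z) - F z] up to a constant, and
    invariance makes it 0. *)
Lemma yavg_log_derivative u F z : U u -> zmode F -> U_invariant F -> D z ->
  \sum_j (logu u j)%:C * euler j (yavg (logu u) F) z = 0.
Proof.
move=> Uu zF iF Dz; have n2 : - 2 * 'i != 0 :> R[i].
  by rewrite mulf_neq0 ?oppr_eq0 ?pnatr_eq0 ?neq0Ci.
apply: (mulfI n2); rewrite mulr0 mulr_sumr.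
have := yavg_euler (logu_cplx sigma u) zF Dz.
rewrite (flow1_ulin sigmaP UP Uu zF Dz) iF// subrr => E; rewrite -[RHS]E.
by apply: eq_bigr => j _; rewrite euler_yavg// mulrA.
Qed.

(** The outermost average deals with its own unit, since the inner function is still invariant; for
    the other units the vanishing survives because [yavg] commutes with [euler]. *)
Lemma yavgs_log_derivative us F u z : (forall u, u \in us -> U u) -> zmode F -> U_invariant F ->
  u \in us -> D z -> \sum_j (logu u j)%:C * euler j (yavgs us F) z = 0.
Proof.
move=> Uus zF iF; elim: us Uus z => //= v us IHus Uus z.
have Uv : U v by apply: Uus; rewrite mem_head.
have {}IHus := IHus (fun w wus => Uus w (mem_behead (s := v :: us) wus)).
have zG := zero_mode_yavgs us zF.
rewrite in_cons => /predU1P[->|uus] Dz.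
  by apply: yavg_log_derivative => //; exact: U_invariant_yavgs.
transitivity (yavg (logu v) (fun z => \sum_j (logu u j)%:C * euler j (yavgs us F) z) z).
  rewrite yavg_sum//; last by move=> j; exact: zero_mode_euler.
  by apply: eq_bigr => j _; rewrite euler_yavg//.
transitivity (yavg (logu v) (fun=> 0) z); first by apply: yavg_ext => // y Dy; exact: IHus.
exact: (yavgs_cst [:: v]).
Qed.

Lemma lattice_units : exists2 us : 'I_s -> K, (forall i, U (us i)) &
  (\matrix_(i, j) (logu (us i) (lshift t j))) \in unitmx.
Proof.
have [B uB UB] := OT_lattice UP.
have H i : exists u, U u /\ log_vector sigma u = row i B.
  have : [set log_vector sigma u | u in U] (row i B).
    by rewrite UB; exists (delta_mx 0 i); rewrite // map_delta_mx -rowE.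
  by move=> [u Uu uE]; exists u.
have [us usP] := choice H; exists us; first by move=> i; case: (usP i).
rewrite (_ : \matrix_(_, _) _ = B)//; apply/matrixP => i j; rewrite mxE /logu (unsplitK (inl _)).
by have [_ /rowP/(_ j)] := usP i; rewrite !mxE.
Qed.

(* An invariant zero mode descends to a function on a real torus, and integrating over
   that torus kills derivatives. *)
Lemma exists_mean : exists us, (forall u, u \in us -> U u) /\
  forall F j z, zmode F -> U_invariant F -> D z -> yavgs us (euler j F) z = 0.
Proof.
have [us Uus uM] := lattice_units.
exists [seq us i | i <- enum 'I_s]; split=> [_ /mapP[i _ ->]//|F j z zF iF Dz].
have Ur u : u \in [seq us i | i <- enum 'I_s] -> U u by move=> /mapP[i _ ->].
set r := [seq _ | _ <- _] in Ur *.
rewrite -yavgs_euler//; have zr := zero_mode_yavgs r zF.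
move: j; apply: ord_sumP => [j|k]; last exact: euler_cplx.
(* The log vectors form an invertible matrix, so the [s] vanishing combinations of [euler]
   derivatives force each of them to vanish. *)
set M := \matrix_(_, _) _ in uM; pose x : 'cV[R[i]]_s := \col_i euler (lshift t i) (yavgs r F) z.
have Mx : map_mx (real_complex R) M *m x = 0.
  apply/colP => i; rewrite !mxE.
  have ur : us i \in r by apply: map_f; rewrite mem_enum.
  have := yavgs_log_derivative Ur zF iF ur Dz; rewrite big_split_ord /= [X in _ + X]big1 ?addr0.
    by move=> E; rewrite -[RHS]E; apply: eq_bigr => l _; rewrite !mxE.
  by move=> k _; rewrite logu_cplx mul0r.
have : x = 0.
  have uM' : map_mx (real_complex R) M \in unitmx by rewrite map_unitmx.
  by rewrite -(mulKmx uM' x) Mx mulmx0.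
by move/colP/(_ j); rewrite !mxE.
Qed.

End Averages.

Section DimensionBound.
Variables (R : realType) (s t : nat) (K : fieldExtType rat).
Variable sigma : 'I_(s + t + t) -> {rmorphism K -> R[i]}.
Variables (U : set K) (rho : K -> R[i]).
Hypotheses (sigmaP : OT_embeddings sigma) (UP : OT_group sigma U) (rhoP : U_character U rho).
Local Notation n := (s + t)%N.
Local Notation V := ('rV[R]_n * 'rV[R]_n)%type.
Local Notation D := (@OT_cover R s t).
Local Notation zmode := (@zero_mode R s t).
Local Notation form := (cform R n).
Implicit Types (A B C : {set 'I_n}) (w v : form) (u : K) (J : {set 'I_s}).
Variables (I : {set 'I_s}) (M L : {set 'I_t}) (q : nat).
Hypotheses (Lq : (#|L| <= q)%N) (rhoE : rho_formula sigma U rho I M L).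
Local Notation p := (#|I| + #|M|)%N.
Local Notation A0 := (cat_set I M).

Lemma chi_cat J u : U u -> chi sigma rho A0 (cat_set J L) u = 1.
Proof.
move=> Uu; have : rho_formula sigma U rho (rpart A0) (cpx A0) (cpx (cat_set J L)).
  by rewrite rpart_cat !cpx_cat.
by move/(chi_formula rho sigmaP UP) => /(_ u Uu).
Qed.

(* The form [dw_I dz_M dzbar_L] times the product of the [dwbar_j / Im w_j], [j \in J]. *)
Definition std_form J : form := fun A B z =>
  (Yp B z)^-1 * ((A == A0) && (B == cat_set J L))%:R.

Lemma std_form_zero_mode J A B : zmode (std_form J A B).
Proof. by apply: zero_modeM; [exact: zero_mode_YpV|exact: zero_mode_cst]. Qed.

Lemma std_form_closed J : #|J| = (q - #|L|)%N -> E_closed sigma U rho p q (std_form J).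
Proof.
move=> Jq; split.
  apply/(E_formP sigmaP UP rhoP); split.
  - by move=> A B; apply: (zero_mode_OK sigmaP); exact: std_form_zero_mode.
  - move=> a Ua A B z Dz; have Da := OT_cover_ulin sigmaP (OT_sub UP Ua) Dz.
    apply/(equivariant_Yp rho sigmaP UP A B (std_form J A B) Ua Dz); rewrite /std_form !mulVKf ?Yp_neq0//.
    case: andP => [[/eqP -> /eqP ->]|_]; last by rewrite mulr0.
    by rewrite chi_cat// mulr1.
  - move=> A B z Dz; rewrite /std_form.
    have [/andP[/eqP -> /eqP ->]|_] := boolP ((A == A0) && (B == cat_set J L)); last by rewrite mulr0.
    by rewrite !card_parts !rpart_cat !cpx_cat Jq subnK// !eqxx.
move=> A B z Dz; rewrite dbarE koszul_eulerV//; last by move=> C; exact: zero_mode_cst.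
rewrite /koszul_d big1 ?mulr0// => i _; by rewrite /euler d_zetabar_cst !mulr0.
Qed.

(** At the coefficient [(A0, cat_set (Js k) L)], reduction to constant modes and multiplication by
    [Yp] express the constant [c k] as a signed sum of [euler] derivatives, the real ones of
    invariant functions and the complex ones zero. Its mean is 0, while the mean of a constant is
    that constant. *)
Lemma std_form_free N (Js : 'I_N -> {set 'I_s}) (c : 'I_N -> R[i]) (k0 : 'I_t) : injective Js ->
  E_exact sigma U rho p q (form_lincomb c (fun k => std_form (Js k))) -> forall k, c k = 0.
Proof.
move=> Jsi ex k; set B := cat_set (Js k) L.
have cE z : form_lincomb c (fun k => std_form (Js k)) A0 B z = c k * (Yp B z)^-1.
  rewrite /form_lincomb (bigD1 k) //= big1 ?addr0.
    by rewrite /std_form !eqxx mulr1.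
  move=> k' kk'; rewrite /std_form eqxx /=; case: eqP => [BE|]; last by rewrite !mulr0.
  by have := congr1 (@rpart s t) BE; rewrite !rpart_cat => /Jsi kE; rewrite kE eqxx in kk'.
pose z0 : V := (0, const_mx 1).
have D0 : D z0 by move=> i; rewrite /= mxE ltr01.
(* For [q = 0] exact means zero, and [c k] is read off the coefficient directly. *)
case: q ex => [ex|q' [v /(E_formP sigmaP UP rhoP) cv ve]].
  by have /eqP := ex A0 B z0 D0; rewrite cE mulf_eq0 invr_eq0 (negbTE (Yp_neq0 _ D0)) orbF => /eqP.
have [red [prim rP]] := exists_reduction k0 sigmaP.
have ov := coch_OK cv; have crv := red_form_cochain sigmaP UP rP cv.
have zrv C := red_form_zero_mode A0 C rP ov.
pose F C z := Yp C z * red_form red v A0 C z.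
have zF C : zmode (F C) by apply: zero_modeM => //; exact: zero_mode_Yp.
have ckE z : D z -> koszul_d #|A0| (@euler R s t) F B z = c k.
  move=> Dz; rewrite koszul_euler// -dbarE (red_dbar rP)//.
  (* This side of the relation is already constant along the fibres, so [red] leaves it
     unchanged. *)
  pose w z := c k * (Yp B z)^-1.
  have zw : zmode w by apply/zero_modeZ/zero_mode_YpV.
  rewrite (red_ext rP (g := w)) //; last by move=> y Dy; rewrite -ve// cE.
  rewrite (red_id rP (zero_mode_OK sigmaP zw)) //; last by case: zw.
  by rewrite /w mulrCA mulfV ?mulr1// Yp_neq0.
have [us [Uus mean]] := exists_mean sigmaP UP.
rewrite -(yavgs_cst sigma us (c k) z0) -(yavgs_ext sigma us ckE D0).
have -> : koszul_d #|A0| (@euler R s t) F B =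
    fun z => \sum_(i <- enum B) dsign _ #|A0| B i * euler i (F (B :\ i)) z.
  by apply/funext => z; rewrite /koszul_d big_enum.
rewrite yavgs_sum//; last by move=> i; exact: zero_mode_euler.
rewrite big1_seq// => i _.
suff -> : yavgs sigma us (euler i (F (B :\ i))) z0 = 0 by rewrite mulr0.
move: i; apply: ord_sumP => [i|i]; last first.
  rewrite -[RHS](yavgs_cst sigma us 0 z0); apply: yavgs_ext => // y Dy.
  exact: euler_cplx.
apply: mean => // u Uu z Dz.
(* [chi] is trivial at [B], and removing the real index [i] does not change it, so [F (B :\ i)] is
   invariant. *)
have /(equivariant_Yp rho sigmaP UP _ _ _ Uu Dz) := coch_equiv crv Uu A0 (B :\ lshift t i) Dz.
by rewrite (chi_cpx sigma rho A0 u (cpx_setD1 B i)) chi_cat// mul1r.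
Qed.

(** There is one standard form for each set [J] of [q - #|L|] real indices. *)
Lemma Hpq_dimension_bound (t_gt0 : (0 < t)%N) : Hpq_dim_ge sigma U rho p q 'C(s, q - #|L|).
Proof.
pose S : {set {set 'I_s}} := finset.finset (fun J => #|J| == q - #|L|)%N.
have cS : #|S| = 'C(s, q - #|L|) by rewrite cardsE -[X in 'C(X, _)]card_ord -card_draws cardsE.
pose Js k := enum_val (cast_ord (esym cS) k).
exists (fun k => std_form (Js k)) => [k|c ex].
  apply: std_form_closed; have := enum_valP (cast_ord (esym cS) k).
  by rewrite inE => /eqP.
apply: (std_form_free (Ordinal t_gt0) _ ex) => k k' /enum_val_inj.
exact: cast_ord_inj.
Qed.

End DimensionBound.

Lemma Hpq_dim_gt0 (R : realType) (s t : nat) (K : fieldExtType rat)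
    (sigma : 'I_(s + t + t) -> {rmorphism K -> R[i]}) (U : set K) (rho : K -> R[i]) p q N :
  (0 < N)%N -> Hpq_dim_ge sigma U rho p q N -> Hpq_neq0 sigma U rho p q.
Proof.
case: N => // N _ [w cw fw]; exists (w ord0); split=> // ex.
suff /eqP : (1 : R[i]) = 0 by rewrite oner_eq0.
apply: (fw (fun k => (k == ord0)%:R) _ ord0).
rewrite (_ : form_lincomb _ _ = w ord0)//.
apply/funext => A; apply/funext => B; apply/funext => z.
by rewrite /form_lincomb big_ord_recl big1 ?addr0 ?mul1r// => k _; rewrite mul0r.
Qed.

Theorem theorem1p3 (R : realType) (s t : nat) (K : fieldExtType rat)
    (sigma : 'I_(s + t + t) -> {rmorphism K -> R[i]})
    (U : set K) (rho : K -> R[i]) (p q : nat)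
    (s_gt0 : (0 < s)%N) (t_gt0 : (0 < t)%N)
    (sigmaP : OT_embeddings sigma) (UP : OT_group sigma U)
    (rhoP : U_character U rho) :
  (Hpq_neq0 sigma U rho p q <->
     exists (I : {set 'I_s}) (M L : {set 'I_t}),
       [/\ (#|I| + #|M|)%N = p, (#|L| <= q <= #|L| + s)%N
         & rho_formula sigma U rho I M L]) /\
  (forall (I : {set 'I_s}) (M L : {set 'I_t}),
     (#|I| + #|M|)%N = p -> (#|L| <= q)%N ->
     rho_formula sigma U rho I M L ->
     Hpq_dim_ge sigma U rho p q 'C(s, q - #|L|)).
Proof.
have bound (I : {set 'I_s}) (M L : {set 'I_t}) : (#|I| + #|M|)%N = p -> (#|L| <= q)%N ->
    rho_formula sigma U rho I M L -> Hpq_dim_ge sigma U rho p q 'C(s, q - #|L|).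
  by move=> <- Lq rhoE; exact: Hpq_dimension_bound.
split=> //; split; first exact: nonvanishing_formula.
move=> [I [M [L [IM /andP[Lq qL] rhoE]]]].
apply: (Hpq_dim_gt0 _ (bound I M L IM Lq rhoE)).
(* The upper bound [q <= #|L| + s] is exactly positivity of the binomial coefficient. *)
by rewrite bin_gt0 leq_subLR.
Qed.
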